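(* Let $N\ge 2$, $\Omega\subset\mathbb{R}^N$ a bounded domain, $s_1\in(0,1)$, $p\ge2$ and $s_p\in\left(0,\frac{p-1}{p}\right]$. Let $u$ be a locally bounded weak solution of $(-\Delta_1)^{s_1}u+(-\Delta_p)^{s_p}u=0$ in $\Omega$. Then $u\in W^{\gamma,q}_{\mathrm{loc}}(\Omega)$ for every $q\ge p$ and every $\gamma\in\left(0,\frac{s_pp}{p-1}\right)$. Moreover, there exist constants $C,\kappa>0$ depending only on $N,p,q,s_1,s_p,\gamma$ such that for every ball $B_R=B_R(x_0)\subset\subset\Omega$ with $R\in(0,1)$ and every $r\in(0,R)$, $$[u]^q_{W^{\gamma,q}(B_r)}\le \frac{C\left(\mathcal{T}+[u]_{W^{s_p,p}(B_R)}+1\right)^q}{(R-r)^\kappa},\qquad \mathcal{T}:=\|u\|_{L^\infty(B_R(x_0))}+\mathrm{Tail}(u;x_0,R).$$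
   Context: Notation: $B_\rho=B_\rho(x_0)$ is the open ball of radius $\rho$ centered at $x_0$; $A\subset\subset\Omega$ means $\overline A$ is compact and contained in $\Omega$. For $\gamma\in(0,1)$, $q\ge1$ and an open set $U$, $[w]_{W^{\gamma,q}(U)}:=\left(\int_U\int_U\frac{|w(x)-w(y)|^q}{|x-y|^{N+\gamma q}}dxdy\right)^{1/q}$ and $W^{\gamma,q}(U)=\{w\in L^q(U):[w]_{W^{\gamma,q}(U)}<\infty\}$. $W^{\gamma,q}_{\mathrm{loc}}(\Omega)$ (and similarly $W^{1,q}_{\mathrm{loc}}$, $L^\infty_{\mathrm{loc}}$) denotes functions belonging to the corresponding space on every ball $B\subset\subset\Omega$. $W^{\gamma,q}_0(\Omega)$ denotes functions in $W^{\gamma,q}(\mathbb{R}^N)$ vanishing a.e. outside $\Omega$. The tail space $L^{p-1}_{s_pp}(\mathbb{R}^N)$ consists of $w\in L^{p-1}_{\mathrm{loc}}(\mathbb{R}^N)$ with $\int_{\mathbb{R}^N}\frac{|w|^{p-1}}{(1+|x|)^{N+s_pp}}dx<\infty$, and $\mathrm{Tail}(u;x_0,R):=\left(R^{s_pp}\int_{\mathbb{R}^N\setminus B_R(x_0)}\frac{|u(x)|^{p-1}}{|x-x_0|^{N+s_pp}}dx\right)^{\frac1{p-1}}$. The set-valued sign is $\mathrm{sgn}(t)=\{1\}$ if $t>0$, $\{-1\}$ if $t<0$, $[-1,1]$ if $t=0$. Weak solution: a function $u\in W^{s_1,1}_{\mathrm{loc}}(\Omega)\cap W^{s_p,p}_{\mathrm{loc}}(\Omega)\cap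 L^{p-1}_{s_pp}(\mathbb{R}^N)$ is a weak solution of $(-\Delta_1)^{s_1}u+(-\Delta_p)^{s_p}u=0$ in $\Omega$ if there is $Z\in L^\infty(\mathbb{R}^N\times\mathbb{R}^N)$ with $Z(x,y)\in\mathrm{sgn}(u(x)-u(y))$ for a.e. $(x,y)$, such that for every $\varphi\in W^{s_1,1}_0(\Omega)\cap W^{s_p,p}_0(\Omega)$, $$0=\int_{\mathbb{R}^N}\int_{\mathbb{R}^N}Z\frac{\varphi(x)-\varphi(y)}{|x-y|^{N+s_1}}dxdy+\int_{\mathbb{R}^N}\int_{\mathbb{R}^N}\frac{|u(x)-u(y)|^{p-2}(u(x)-u(y))(\varphi(x)-\varphi(y))}{|x-y|^{N+s_pp}}dxdy.$$ A locally bounded weak solution is a weak solution with $u\in L^\infty_{\mathrm{loc}}(\Omega)$. *)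

(* Defs.v *)
(* R^N is modelled as N.-tuple R with its canonical
   (product of Borel) sigma-algebra; Lebesgue integration on R^N is the
   iterated one-dimensional Lebesgue integral (Tonelli). *)
From mathcomp Require Import all_boot all_algebra.
From mathcomp Require Import all_classical all_reals all_analysis.
Set Implicit Arguments. Unset Strict Implicit. Unset Printing Implicit Defensive.
Import GRing.Theory Num.Theory.
Local Open Scope classical_set_scope.
Local Open Scope ring_scope.

Section FracDefs.
Context {R : realType}.

Definition edist (n : nat) (x y : n.-tuple R) : R :=
  Num.sqrt (\sum_(i < n) (tnth x i - tnth y i) ^+ 2).
Definition enorm (n : nat) (x : n.-tuple R) : R :=
  Num.sqrt (\sum_(i < n) (tnth x i) ^+ 2).
Definition eball (n : nat) (x0 : n.-tuple R) (r : R) : set (n.-tuple R) :=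
  [set x | edist x x0 < r].
Definition ecball (n : nat) (x0 : n.-tuple R) (r : R) : set (n.-tuple R) :=
  [set x | edist x x0 <= r].

Definition ball_cc (n : nat) (x0 : n.-tuple R) (rho : R) (Om : set (n.-tuple R)) :=
  0 < rho /\ ecball x0 rho `<=` Om.

Definition eopen (n : nat) (U : set (n.-tuple R)) :=
  forall x, U x -> exists e : R, 0 < e /\ eball x e `<=` U.
Definition bounded_domain (n : nat) (Om : set (n.-tuple R)) :=
  [/\ Om !=set0, eopen Om,
      (forall U V : set (n.-tuple R), eopen U -> eopen V ->
         Om `<=` U `|` V -> Om `&` U `&` V = set0 ->
         Om `&` U = set0 \/ Om `&` V = set0)
    & exists M : R, forall x, Om x -> enorm x <= M].

(* Lebesgue integral of a nonnegative function on R^n (iterated integral) *)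
Fixpoint leb_int (n : nat) : (n.-tuple R -> \bar R) -> \bar R :=
  match n return (n.-tuple R -> \bar R) -> \bar R with
  | 0 => fun f => f [tuple]
  | n'.+1 => fun f =>
      (\int[@lebesgue_measure R]_t leb_int (fun y => f (cons_tuple t y)))%E
  end.

Definition int_on (n : nat) (A : set (n.-tuple R)) (f : n.-tuple R -> \bar R) :=
  leb_int (fun x => ((\1_A x)%:E * f x)%E).

Definition dint_on (n : nat) (A B : set (n.-tuple R))
  (g : n.-tuple R -> n.-tuple R -> \bar R) :=
  leb_int (fun x => ((\1_A x)%:E * leb_int (fun y => (\1_B y)%:E * g x y))%E).

Definition null1 (n : nat) (S : set (n.-tuple R)) :=
  exists B : set (n.-tuple R), [/\ measurable B, S `<=` B & int_on B (fun _ => 1%E) = 0%E].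
Definition null2 (n : nat) (S : set (n.-tuple R * n.-tuple R)) :=
  exists B : set (n.-tuple R * n.-tuple R),
    [/\ measurable B, S `<=` B &
        leb_int (fun x => leb_int (fun y => (\1_B (x, y))%:E)) = 0%E].

Definition ae_on (n : nat) (A : set (n.-tuple R)) (P : n.-tuple R -> Prop) :=
  null1 [set x | A x /\ ~ P x].

Definition gag_q (n : nat) (g q : R) (A : set (n.-tuple R)) (w : n.-tuple R -> R) :=
  dint_on A A (fun x y => (powR `|w x - w y| q / powR (edist x y) (n%:R + g * q))%:E).

(* w in W^{g,q}(A) (w is assumed measurable separately) *)
Definition in_W (n : nat) (g q : R) (A : set (n.-tuple R)) (w : n.-tuple R -> R) :=
  (int_on A (fun x => (powR `|w x| q)%:E) < +oo)%E /\ (gag_q g q A w < +oo)%E.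

Definition in_Wloc (n : nat) (g q : R) (Om : set (n.-tuple R)) (w : n.-tuple R -> R) :=
  forall x0 rho, ball_cc x0 rho Om -> in_W g q (eball x0 rho) w.

Definition in_W0 (n : nat) (g q : R) (Om : set (n.-tuple R)) (w : n.-tuple R -> R) :=
  in_W g q setT w /\ ae_on (~` Om) (fun x => w x = 0).

Definition esssup_on (n : nat) (A : set (n.-tuple R)) (w : n.-tuple R -> R) : \bar R :=
  ereal_inf [set M%:E | M in [set M : R | ae_on A (fun x => `|w x| <= M)]].

Definition in_Linfloc (n : nat) (Om : set (n.-tuple R)) (w : n.-tuple R -> R) :=
  forall x0 rho, ball_cc x0 rho Om -> (esssup_on (eball x0 rho) w < +oo)%E.

(* tail space L^{p-1}_{s p}(R^n); here sp stands for the product s_p * p *)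
Definition in_tail_space (n : nat) (sp p : R) (w : n.-tuple R -> R) :=
  (forall x0 rho, 0 < rho ->
     (int_on (eball x0 rho) (fun x => (powR `|w x| (p - 1))%:E) < +oo)%E) /\
  (leb_int (fun x => (powR `|w x| (p - 1) / powR (1 + enorm x) (n%:R + sp))%:E) < +oo)%E.

(* Tail(w; x0, rho), sp stands for s_p * p *)
Definition Tail (n : nat) (sp p : R) (w : n.-tuple R -> R) (x0 : n.-tuple R) (rho : R) : R :=
  powR (powR rho sp *
        fine (int_on (~` eball x0 rho)
                (fun x => (powR `|w x| (p - 1) / powR (edist x x0) (n%:R + sp))%:E)))
       (p - 1)^-1.

Definition in_sgn (z t : R) :=
  [/\ 0 < t -> z = 1, t < 0 -> z = -1 & t = 0 -> -1 <= z <= 1].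

Definition integrable2 (n : nat) (g : n.-tuple R -> n.-tuple R -> R) :=
  (dint_on setT setT (fun x y => `|g x y|%:E) < +oo)%E.
Definition sint2 (n : nat) (g : n.-tuple R -> n.-tuple R -> R) : R :=
  fine (dint_on setT setT (fun x y => (Num.max (g x y) 0)%:E)) -
  fine (dint_on setT setT (fun x y => (Num.max (- g x y) 0)%:E)).

Definition weak_solution (n : nat) (s1 sp p : R) (Om : set (n.-tuple R))
  (u : n.-tuple R -> R) :=
  [/\ measurable_fun [set: n.-tuple R] u,
      in_Wloc s1 1 Om u, in_Wloc sp p Om u, in_tail_space (sp * p) p u &
      exists Z : n.-tuple R -> n.-tuple R -> R,
        [/\ measurable_fun [set: n.-tuple R * n.-tuple R] (fun xy => Z xy.1 xy.2),
            (exists M : R, null2 [set xy | M < `|Z xy.1 xy.2|]),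
            null2 [set xy | ~ in_sgn (Z xy.1 xy.2) (u xy.1 - u xy.2)] &
            forall phi : n.-tuple R -> R,
              measurable_fun [set: n.-tuple R] phi ->
              in_W0 s1 1 Om phi -> in_W0 sp p Om phi ->
              let g1 := fun x y => Z x y * (phi x - phi y) / powR (edist x y) (n%:R + s1) in
              let g2 := fun x y => powR `|u x - u y| (p - 2) * (u x - u y) * (phi x - phi y)
                                   / powR (edist x y) (n%:R + sp * p) in
              [/\ integrable2 g1, integrable2 g2 & sint2 g1 + sint2 g2 = 0]]].

End FracDefs.

(* Main.v *)
(* Divide u by the amplitude A = T + [u] + 1 and multiply Z by A^(1-p) <= 1; then
   |u| <= 1 on the ball and the seminorm and the tail are bounded by constants, so
   only estimates with absolute constants are needed.

   For d_h u(x) = u(x+h) - u(x), subtract the equation from its translate by h and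
   test with |d_h u|^(b-1) d_h u times a cutoff.  As Z is a monotone function of
   u(x) - u(y), the 1-Laplacian contributes a nonnegative term up to an error from
   the cutoff, and the p-Laplacian controls the W^{s,Q} seminorm of d_h u with
   Q = p-1+b and s Q = s_p p.  If the integral of |d_h u|^m is at most K |h|^(tau m),
   Young's inequality bounds the errors by K |h|^(tau b), where b = m - (p-1)/la for a
   fixed la > 1.  Hence second differences, and by doubling first differences, satisfy
   the same kind of bound with exponents Q and tau', Q tau' = s_p p + tau b.
   Starting from (p, s_p), the distance from tau to s_p p/(p-1) is multiplied by b/Q
   at each step while m grows linearly, so tau tends to s_p p/(p-1) and m to infinity;
   lowering the exponent m to q by interpolation and integrating over h gives
   W^{gamma,q}. *)

Require Import Defs.
From mathcomp Require Import all_boot all_order all_algebra.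
From mathcomp Require Import all_classical all_reals all_analysis.
From mathcomp Require Import measurable_realfun.
From mathcomp Require Import ring lra.
Require Import Defs.
Import Order.TTheory GRing.Theory Num.Theory.
Import numFieldNormedType.Exports.
Local Open Scope classical_set_scope.
Local Open Scope ring_scope.
Set Implicit Arguments. Unset Strict Implicit. Unset Printing Implicit Defensive.

(** With [la = 1] the new exponent Q would equal m and integrability would never improve. With
    [la > 1], Young's inequality asks for the power la m of a difference of u, which |u| <= 1
    reduces to the power m, and each round gains (p-1)(1 - 1/la). The price is the integrability
    near 0 of |z|^(1 - s_p p + tau (p-1)/la - N). For tau = s_p and la = 1 this exponent exceeds -N
    by 1 - s_p > 0, so some la > 1 is allowed, and it stays allowed because tau never decreases.
    Passing from second to first differences needs a rate below 1. This is where s_p <= (p-1)/p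
    enters: it makes t = s_p p/(p-1) at most 1, and every tau stays below t. Convergence is read off
    the product (t - tau) m, which never increases. The 1-Laplacian yields no coercivity, only a
    sign. The sign condition and the bound on u hold almost everywhere only, so u and Z are modified
    on null sets until boundedness and monotonicity hold at every point; then pointwise inequalities
    can simply be integrated. *)

(** * Iterated Lebesgue integral: Tonelli, translation invariance, product integrands *)

Section LebInt.
Context {R : realType}.
Local Notation leb := (@lebesgue_measure R).

Lemma measurable_cons_tuple d (T : measurableType d) n
    (f : T -> R) (g : T -> n.-tuple R) :
  measurable_fun setT f -> measurable_fun setT g ->
  measurable_fun setT (fun x => cons_tuple (f x) (g x)).
Proof. exact: measurable_cons. Qed.

Lemma leb_int_ge0 n (f : n.-tuple R -> \bar R) :
  (forall x, 0 <= f x)%E -> (0 <= leb_int f)%E.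
Proof.
elim: n f => [|n IH] f f0 /=; first exact: f0.
by apply: integral_ge0 => t _; apply: IH.
Qed.

(** The parameter space is arbitrary because the induction enlarges it: one coordinate of the tuple
    is moved into [T * R], and the one-dimensional Fubini-Tonelli theorem then integrates it out. *)
Lemma measurable_leb_int d (T : measurableType d) n
    (f : T * n.-tuple R -> \bar R) :
  measurable_fun setT f -> (forall z, 0 <= f z)%E ->
  measurable_fun setT (fun x => leb_int (fun y => f (x, y))).
Proof.
elim: n d T f => [|n IH] d T f mf f0 /=.
  by apply: (measurableT_comp mf); exact: measurable_fun_pair.
pose F (z : T * R) := leb_int (fun y => f (z.1, cons_tuple z.2 y)).
have mF : measurable_fun setT F.
  pose f' (w : (T * R) * n.-tuple R) := f (w.1.1, cons_tuple w.1.2 w.2).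
  apply: (IH _ _ f') => [|z]; last exact: f0.
  apply: (measurableT_comp mf); apply: measurable_fun_pair.
    exact: measurableT_comp.
  by apply: measurable_cons_tuple => //; exact: measurableT_comp.
have F0 z : (0 <= F z)%E by apply: leb_int_ge0.
exact: (@measurable_fun_fubini_tonelli_F _ _ _ _ _ leb F mF F0).
Qed.

Lemma measurable_leb_int_cons n (f : n.+1.-tuple R -> \bar R) :
  measurable_fun setT f -> (forall z, 0 <= f z)%E ->
  measurable_fun setT (fun t => leb_int (fun y => f (cons_tuple t y))).
Proof.
move=> mf f0.
apply: (@measurable_leb_int _ R n (fun z => f (cons_tuple z.1 z.2))) => //.
by apply: (measurableT_comp mf); exact: measurable_cons_tuple.
Qed.

Lemma measurable_slice_cons n (f : n.+1.-tuple R -> \bar R) (t : R) :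
  measurable_fun setT f ->
  measurable_fun setT (fun y => f (cons_tuple t y)).
Proof. by move=> mf; apply: (measurableT_comp mf); exact: measurable_cons_tuple. Qed.

Lemma le_leb_int n (f g : n.-tuple R -> \bar R) :
  measurable_fun setT f -> measurable_fun setT g ->
  (forall x, 0 <= f x)%E -> (forall x, f x <= g x)%E ->
  (leb_int f <= leb_int g)%E.
Proof.
elim: n f g => [|n IH] f g mf mg f0 fg /=; first exact: fg.
have g0 x : (0 <= g x)%E by apply: (le_trans (f0 x)).
apply: ge0_le_integral => //=.
- by move=> t _; apply: leb_int_ge0.
- exact: measurable_leb_int_cons.
- exact: measurable_leb_int_cons.
- by move=> t _; apply: IH => //; exact: measurable_slice_cons.
Qed.

Lemma leb_intD n (f g : n.-tuple R -> \bar R) :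
  measurable_fun setT f -> measurable_fun setT g ->
  (forall x, 0 <= f x)%E -> (forall x, 0 <= g x)%E ->
  (leb_int (fun x => f x + g x) = leb_int f + leb_int g)%E.
Proof.
elim: n f g => [|n IH] f g mf mg f0 g0 //=.
rewrite -ge0_integralD//=; last first.
- exact: measurable_leb_int_cons.
- by move=> t _; apply: leb_int_ge0.
- exact: measurable_leb_int_cons.
- by move=> t _; apply: leb_int_ge0.
apply: eq_integral => t _; apply: IH => //; exact: measurable_slice_cons.
Qed.

Lemma leb_intZl n (k : \bar R) (f : n.-tuple R -> \bar R) :
  measurable_fun setT f -> (forall x, 0 <= f x)%E -> (0 <= k)%E ->
  (leb_int (fun x => k * f x) = k * leb_int f)%E.
Proof.
move=> + + k0; elim: n f => [|n IH] f mf f0 //=.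
rewrite -ge0_integralZl//=; last first.
- by move=> t _; apply: leb_int_ge0.
- exact: measurable_leb_int_cons.
apply: eq_integral => t _; apply: IH => //; exact: measurable_slice_cons.
Qed.

Lemma eq_leb_int n (f g : n.-tuple R -> \bar R) : f =1 g -> leb_int f = leb_int g.
Proof. by move=> /funext ->. Qed.

(** Moves one scalar integral across an n-fold one, coordinate by coordinate; this is the inductive
    step of the exchange of two multiple integrals. *)
Lemma leb_int_integralC n (f : R * n.-tuple R -> \bar R) :
  measurable_fun setT f -> (forall z, 0 <= f z)%E ->
  (leb_int (fun y => \int[leb]_t f (t, y)) =
   \int[leb]_t leb_int (fun y => f (t, y)))%E.
Proof.
elim: n f => [|n IH] f mf f0 //=.
pose g (w : R * R) := leb_int (fun y => f (w.2, cons_tuple w.1 y)).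
have mg : measurable_fun setT g.
  apply: (@measurable_leb_int _ _ n (fun w : (R * R) * n.-tuple R => f (w.1.2, cons_tuple w.1.1 w.2))) => //.
  apply: (measurableT_comp mf); apply: measurable_fun_pair.
    exact: measurableT_comp.
  by apply: measurable_cons_tuple => //; exact: measurableT_comp.
have g0 w : (0 <= g w)%E by apply: leb_int_ge0.
transitivity (\int[leb]_s \int[leb]_t g (s, t))%E.
  apply: eq_integral => s _.
  apply: (IH (fun z => f (z.1, cons_tuple s z.2))) => //.
  apply: (measurableT_comp mf); apply: measurable_fun_pair => //.
  exact: measurable_cons_tuple.
exact: (@fubini_tonelli _ _ _ _ _ leb leb g mg g0).
Qed.

Lemma leb_intC m n (f : m.-tuple R * n.-tuple R -> \bar R) :
  measurable_fun setT f -> (forall z, 0 <= f z)%E ->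
  (leb_int (fun x => leb_int (fun y => f (x, y))) =
   leb_int (fun y => leb_int (fun x => f (x, y))))%E.
Proof.
elim: m f => [|m IH] f mf f0 //=.
have mf' t : measurable_fun setT (fun w : m.-tuple R * n.-tuple R => f (cons_tuple t w.1, w.2)).
  apply: (measurableT_comp mf); apply: measurable_fun_pair => //.
  exact: measurable_cons_tuple.
transitivity (\int[leb]_t leb_int (fun y => leb_int (fun x => f (cons_tuple t x, y))))%E.
  by apply: eq_integral => t _; apply: (IH (fun w => f (cons_tuple t w.1, w.2))).
rewrite -(@leb_int_integralC n (fun w => leb_int (fun x => f (cons_tuple w.1 x, w.2))))//.
- apply: (@measurable_leb_int _ _ m (fun w : (R * n.-tuple R) * m.-tuple R => f (cons_tuple w.1.1 w.2, w.1.2))) => //.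
  apply: (measurableT_comp mf); apply: measurable_fun_pair.
    by apply: measurable_cons_tuple => //; exact: measurableT_comp.
  exact: measurableT_comp.
- by move=> z; apply: leb_int_ge0.
Qed.

Definition tadd n (x h : n.-tuple R) : n.-tuple R :=
  [tuple tnth x i + tnth h i | i < n].

(** By uniqueness of Lebesgue measure: the pushforward under a translation agrees with it on
    half-open intervals. *)
Lemma lebesgue_measure_shift (h : R) (A : set R) : measurable A ->
  pushforward leb (fun x : R => (x + h : measurableTypeR R)) A = leb A.
Proof.
move=> mA; apply/esym.
have mh : measurable_fun setT (fun x : R => (x + h : measurableTypeR R)).
  exact: measurable_funD.
pose mu := @pushforward _ _ (measurableTypeR R) (measurableTypeR R) R leb (fun x : R => (x + h : measurableTypeR R)).
apply: (@lebesgue_measure_unique R mu) => //= _ [[a b]] _ <-.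
rewrite /mu /pushforward.
rewrite (_ : _ @^-1` _ = `]a - h, b - h]%classic) ?lebesgue_measure_itv/=; last first.
  by apply/seteqP; split => x /=; rewrite !in_itv/= ltrBlDr lerBrDr.
rewrite !lte_fin ltrD2r; congr (if _ then _ else _).
by rewrite -!EFinB; congr EFin; ring.
Qed.

Lemma ge0_integral_shift (h : R) (f : R -> \bar R) :
  measurable_fun setT f -> (forall x, 0 <= f x)%E ->
  (\int[leb]_t f (t + h)%R = \int[leb]_t f t)%E.
Proof.
move=> mf f0.
transitivity (\int[pushforward leb (fun x : R => (x + h)%R : measurableTypeR R)]_t f t)%E.
  rewrite ge0_integral_pushforward ?preimage_setT//.
  exact: measurable_funD.
apply: eq_measure_integral; first exact: measurable_funD.
by move=> mh A mA _; exact: lebesgue_measure_shift.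
Qed.

Lemma tadd_cons n (t s : R) (x h : n.-tuple R) :
  tadd (cons_tuple t x) (cons_tuple s h) = cons_tuple (t + s) (tadd x h).
Proof.
apply: eq_from_tnth => i; rewrite tnth_mktuple.
case: (unliftP ord0 i) => [j|] ->; last by rewrite !tnth0.
by rewrite !tnthS tnth_mktuple.
Qed.

Lemma leb_int_shift n (h : n.-tuple R) (f : n.-tuple R -> \bar R) :
  measurable_fun setT f -> (forall x, 0 <= f x)%E ->
  leb_int (fun x => f (tadd x h)) = leb_int f.
Proof.
elim: n h f => [|n IH] h f mf f0 /=; first by rewrite (tuple0 (tadd _ _)).
case/tupleP: h => s h.
rewrite -(@ge0_integral_shift s (fun t => leb_int (fun y => f (cons_tuple t y)))); first last.
- by move=> t; apply: leb_int_ge0.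
- exact: measurable_leb_int_cons.
apply: eq_integral => t _.
rewrite -(IH h (fun y => f (cons_tuple (t + s) y)))//; last exact: measurable_slice_cons.
by apply: eq_leb_int => y; congr f; exact: tadd_cons.
Qed.

(** Replaces polar coordinates: all kernel, cube and ball integrals over R^n are computed or bounded
    through a product of functions of one coordinate. *)
Lemma leb_int_prod n (g : R -> R) : measurable_fun setT g -> (forall t, 0 <= g t) ->
  (\int[leb]_t (g t)%:E < +oo)%E ->
  leb_int (fun x : n.-tuple R => (\prod_(i < n) g (tnth x i))%:E) =
  ((fine (\int[leb]_t (g t)%:E)) ^+ n)%:E.
Proof.
move=> mg g0 gfin; elim: n => [|n IH] /=; first by rewrite big_ord0 expr0.
have mp m : measurable_fun setT (fun x : m.-tuple R => \prod_(i < m) g (tnth x i)).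
  rewrite (_ : (fun x => _) = (fun x : m.-tuple R => \prod_(i <- index_enum 'I_m) (fun x => g (tnth x i)) x)) //.
  elim: (index_enum 'I_m) => [|i s IHs]; first by under eq_fun do rewrite big_nil; exact: measurable_cst.
  under eq_fun do rewrite big_cons.
  apply: measurable_funM => //; apply: (measurableT_comp mg); exact: measurable_tnth.
have pp m (x : m.-tuple R) : 0 <= \prod_(i < m) g (tnth x i) by apply: prodr_ge0.
transitivity (\int[leb]_t ((g t)%:E * (fine (\int[leb]_t (g t)%:E) ^+ n)%:E))%E.
  apply: eq_integral => t _; rewrite -IH -leb_intZl;
    [|by apply: measurableT_comp; [exact: EFin_measurable|exact: mp]|by move=> x; rewrite lee_fin|by rewrite lee_fin].
  apply: eq_leb_int => y; rewrite big_ord_recl tnth0 EFinM.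
  by congr (_ * _)%E; congr EFin; apply: eq_bigr => i _; rewrite tnthS.
rewrite ge0_integralZr//=.
- rewrite exprS EFinM fineK// ge0_fin_numE//.
  by apply: integral_ge0 => t _; rewrite lee_fin.
- exact/measurable_EFinP.
- by move=> t _; rewrite lee_fin.
- rewrite lee_fin exprn_ge0// fine_ge0//.
  by apply: integral_ge0 => t _; rewrite lee_fin.
Qed.

End LebInt.

(** * Translations and the Euclidean norm on tuples *)

Section Euclid.
Context {R : realType}.
Implicit Types n : nat.

Definition topp n (x : n.-tuple R) : n.-tuple R := [tuple - tnth x i | i < n].

Lemma taddC n (x y : n.-tuple R) : tadd x y = tadd y x.
Proof. by apply: eq_from_tnth => i; rewrite !tnth_mktuple addrC. Qed.
Lemma taddA n (x y z : n.-tuple R) : tadd x (tadd y z) = tadd (tadd x y) z.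
Proof. by apply: eq_from_tnth => i; rewrite !tnth_mktuple addrA. Qed.
Lemma taddAC n (x y z : n.-tuple R) : tadd (tadd x y) z = tadd (tadd x z) y.
Proof. by rewrite -!taddA (taddC y). Qed.
Lemma taddNK n (x h : n.-tuple R) : tadd (tadd x (topp h)) h = x.
Proof. by apply: eq_from_tnth => i; rewrite !tnth_mktuple addrNK. Qed.
Lemma taddK n (x h : n.-tuple R) : tadd (tadd x h) (topp h) = x.
Proof. by apply: eq_from_tnth => i; rewrite !tnth_mktuple addrK. Qed.

Lemma enorm_ge0 n (x : n.-tuple R) : 0 <= enorm x.
Proof. exact: sqrtr_ge0. Qed.
Lemma edist_ge0 n (x y : n.-tuple R) : 0 <= edist x y.
Proof. exact: sqrtr_ge0. Qed.
Lemma edistC n (x y : n.-tuple R) : edist x y = edist y x.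
Proof.
by congr Num.sqrt; apply: eq_bigr => i _; rewrite -sqrrN opprB.
Qed.
Lemma edist_tadd n (x y h : n.-tuple R) : edist (tadd x h) (tadd y h) = edist x y.
Proof.
congr Num.sqrt; apply: eq_bigr => i _; rewrite !tnth_mktuple.
by congr (_ ^+ 2); ring.
Qed.
Lemma edist_taddl n (x z : n.-tuple R) : edist (tadd x z) x = enorm z.
Proof.
congr Num.sqrt; apply: eq_bigr => i _; rewrite !tnth_mktuple.
by congr (_ ^+ 2); ring.
Qed.
Lemma edist_taddr n (x z : n.-tuple R) : edist x (tadd x z) = enorm z.
Proof. by rewrite edistC edist_taddl. Qed.
Lemma edist_eq0 n (x y : n.-tuple R) : edist x y = 0 -> x = y.
Proof.
move/eqP; rewrite sqrtr_eq0 => s0.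
apply: eq_from_tnth => i; apply/eqP; rewrite -subr_eq0 -sqrf_eq0.
have : \sum_(i < n) (tnth x i - tnth y i) ^+ 2 == 0.
  by rewrite eq_le s0 sumr_ge0// => j _; exact: sqr_ge0.
by rewrite psumr_eq0 => [/allP/(_ i)|j _]; rewrite ?mem_index_enum ?sqr_ge0//=; apply.
Qed.

Lemma enorm_triangle_aux n (a b : 'I_n -> R) :
  Num.sqrt (\sum_i (a i + b i) ^+ 2) <=
  Num.sqrt (\sum_i a i ^+ 2) + Num.sqrt (\sum_i b i ^+ 2).
Proof.
set A := \sum_i a i ^+ 2; set B := \sum_i b i ^+ 2.
have A0 : 0 <= A by apply: sumr_ge0 => i _; exact: sqr_ge0.
have B0 : 0 <= B by apply: sumr_ge0 => i _; exact: sqr_ge0.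
pose S := \sum_i a i * b i.
have CS : S ^+ 2 <= A * B.
  (* Cauchy-Schwarz from Lagrange's identity: this double sum equals 2 (A B - S^2). *)
  have : 0 <= \sum_i \sum_j (a i * b j - a j * b i) ^+ 2.
    by apply: sumr_ge0 => i _; apply: sumr_ge0 => j _; exact: sqr_ge0.
  have -> : \sum_i \sum_j (a i * b j - a j * b i) ^+ 2 = 2 * (A * B) - 2 * S ^+ 2.
    transitivity (\sum_i (a i ^+ 2 * B + b i ^+ 2 * A - 2 * (a i * b i) * S)).
      apply: eq_bigr => i _.
      rewrite /A /B /S !mulr_sumr -big_split/= -sumrB.
      by apply: eq_bigr => j _; ring.
    rewrite sumrB big_split/= -!mulr_suml -mulr_sumr -/S -/A -/B; ring.
  by move=> H; lra.
rewrite -[leRHS]ger0_norm ?addr_ge0 ?sqrtr_ge0// -sqrtr_sqr ler_wsqrtr//.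
rewrite sqrrD !sqr_sqrtr//.
have -> : \sum_i (a i + b i) ^+ 2 = A + 2 * S + B.
  rewrite /A /B /S mulr_sumr -!big_split/=.
  by apply: eq_bigr => i _; ring.
have : S <= Num.sqrt A * Num.sqrt B.
  rewrite -sqrtrM// (le_trans (ler_norm _))// -sqrtr_sqr.
  exact: ler_wsqrtr.
by move=> H; rewrite -mulr_natl; lra.
Qed.

Lemma edist_triangle n (x y z : n.-tuple R) : edist x z <= edist x y + edist y z.
Proof.
apply: le_trans (enorm_triangle_aux (fun i => tnth x i - tnth y i) (fun i => tnth y i - tnth z i)).
rewrite /edist le_eqVlt; apply/orP; left; apply/eqP.
by congr Num.sqrt; apply: eq_bigr => i _; congr (_ ^+ 2); ring.
Qed.

Lemma ler_tnth_enorm n (x : n.-tuple R) i : `|tnth x i| <= enorm x.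
Proof.
rewrite -sqrtr_sqr ler_wsqrtr// (bigD1 i)//= lerDl.
by apply: sumr_ge0 => j _; exact: sqr_ge0.
Qed.

Lemma enorm_le_sum n (x : n.-tuple R) : enorm x <= \sum_(i < n) `|tnth x i|.
Proof.
have S0 : 0 <= \sum_(i < n) `|tnth x i| by apply: sumr_ge0.
rewrite -[leRHS]ger0_norm// -sqrtr_sqr ler_wsqrtr//.
rewrite expr2 mulr_suml; apply: ler_sum => i _.
rewrite -[leLHS]ger0_norm ?sqr_ge0// normrX expr2 ler_wpM2l//.
by rewrite (bigD1 i)//= lerDl sumr_ge0.
Qed.

Lemma eball_tadd n (x0 x h : n.-tuple R) (r d : R) :
  edist x x0 < r -> enorm h <= d -> edist (tadd x h) x0 < r + d.
Proof.
move=> xr hd; rewrite addrC; apply: le_lt_trans (edist_triangle _ x _) _.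
by rewrite edist_taddl ler_ltD.
Qed.

Lemma enorm_double n (h : n.-tuple R) : enorm (tadd h h) = 2 * enorm h.
Proof.
rewrite /enorm -[2 in RHS]ger0_norm// -sqrtr_sqr -sqrtrM ?sqr_ge0//.
by congr Num.sqrt; rewrite mulr_sumr; apply: eq_bigr => i _; rewrite tnth_mktuple; ring.
Qed.

End Euclid.

(** * Indicator weights and measurability of the integrands *)

Definition ind {R : realType} (b : bool) : R := if b then 1 else 0.

Section Meas.
Context {R : realType}.
Context d (T : measurableType d).

Lemma measurable_tuple n (f : T -> n.-tuple R) :
  (forall i, measurable_fun setT (fun x => tnth (f x) i)) -> measurable_fun setT f.
Proof. by move=> mf; apply/measurable_fun_tnthP => i; exact: mf. Qed.

Lemma measurable_fun_tnth n (f : T -> n.-tuple R) i :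
  measurable_fun setT f -> measurable_fun setT (fun x => tnth (f x) i).
Proof. by move=> mf; exact: (measurableT_comp (measurable_tnth i) mf). Qed.

Lemma measurable_tadd n (f g : T -> n.-tuple R) :
  measurable_fun setT f -> measurable_fun setT g ->
  measurable_fun setT (fun x => tadd (f x) (g x)).
Proof.
move=> mf mg; apply: measurable_tuple => i.
under eq_fun do rewrite tnth_mktuple.
by apply: measurable_funD; exact: measurable_fun_tnth.
Qed.

Lemma measurable_sumR I (s : seq I) (h : I -> T -> R) :
  (forall i, measurable_fun setT (h i)) ->
  measurable_fun setT (fun x => \sum_(i <- s) h i x).
Proof.
move=> mh; elim: s => [|i s IH].
  by under eq_fun do rewrite big_nil; exact: measurable_cst.
under eq_fun do rewrite big_cons.
exact: measurable_funD.
Qed.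

Lemma measurable_sqrt (f : T -> R) : measurable_fun setT f ->
  measurable_fun setT (fun x => Num.sqrt (f x)).
Proof.
move=> mf.
have ms : measurable_fun [set: R] (@Num.sqrt R).
  by apply: nondecreasing_measurable => // x y xy; exact: ler_wsqrtr.
exact: (measurableT_comp ms mf).
Qed.

Lemma measurable_edist n (f g : T -> n.-tuple R) :
  measurable_fun setT f -> measurable_fun setT g ->
  measurable_fun setT (fun x => edist (f x) (g x)).
Proof.
move=> mf mg; apply: measurable_sqrt; apply: measurable_sumR => i.
apply: measurable_funX; apply: measurable_funB; exact: measurable_fun_tnth.
Qed.

Lemma measurable_enorm n (f : T -> n.-tuple R) : measurable_fun setT f ->
  measurable_fun setT (fun x => enorm (f x)).
Proof.
move=> mf; apply: measurable_sqrt; apply: measurable_sumR => i.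
apply: measurable_funX; exact: measurable_fun_tnth.
Qed.

Lemma measurable_powRc (f : T -> R) p : measurable_fun setT f ->
  measurable_fun setT (fun x => powR (f x) p).
Proof. by move=> mf; exact: (measurableT_comp (measurable_powR p) mf). Qed.

Lemma measurable_powRV (f : T -> R) p : measurable_fun setT f ->
  measurable_fun setT (fun x => (powR (f x) p)^-1).
Proof.
move=> mf; under eq_fun do rewrite -powRN.
exact: measurable_powRc.
Qed.

Lemma measurable_normc (f : T -> R) : measurable_fun setT f ->
  measurable_fun setT (fun x => `|f x|).
Proof.
move=> mf; have mn : measurable_fun [set: R] (@Num.norm R R) by exact: normr_measurable.
exact: (measurableT_comp mn mf).
Qed.

Lemma measurable_ind (b : T -> bool) : measurable_fun setT b ->
  measurable_fun setT (fun x => ind (b x) : R).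
Proof. by move=> mb; apply: measurable_fun_ifT => //; exact: measurable_cst. Qed.

Lemma measurable_ltR (f g : T -> R) :
  measurable_fun setT f -> measurable_fun setT g ->
  measurable_fun setT (fun x => ind (f x < g x) : R).
Proof.
by move=> mf mg; apply: measurable_ind; exact: measurable_fun_ltr.
Qed.

Lemma measurable_leR (f g : T -> R) :
  measurable_fun setT f -> measurable_fun setT g ->
  measurable_fun setT (fun x => ind (f x <= g x) : R).
Proof.
by move=> mf mg; apply: measurable_ind; exact: measurable_fun_ler.
Qed.

Lemma measurable_comp2 d1 d2 (T1 : measurableType d1) (T2 : measurableType d2)
    (Z : T1 -> T2 -> R) (f : T -> T1) (g : T -> T2) :
  measurable_fun [set: T1 * T2] (fun w => Z w.1 w.2) ->
  measurable_fun setT f -> measurable_fun setT g ->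
  measurable_fun setT (fun x => Z (f x) (g x)).
Proof.
by move=> mZ mf mg; exact: (measurableT_comp mZ (measurable_fun_pair mf mg)).
Qed.

Lemma measurable_minR (f g : T -> R) :
  measurable_fun setT f -> measurable_fun setT g ->
  measurable_fun setT (fun x => Num.min (f x) (g x)).
Proof. exact: measurable_minr. Qed.
Lemma measurable_maxR (f g : T -> R) :
  measurable_fun setT f -> measurable_fun setT g ->
  measurable_fun setT (fun x => Num.max (f x) (g x)).
Proof. exact: measurable_maxr. Qed.
Lemma measurable_addR (f g : T -> R) :
  measurable_fun setT f -> measurable_fun setT g ->
  measurable_fun setT (fun x => f x + g x).
Proof. exact: measurable_funD. Qed.
Lemma measurable_mulR (f g : T -> R) :
  measurable_fun setT f -> measurable_fun setT g ->
  measurable_fun setT (fun x => f x * g x).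
Proof. exact: measurable_funM. Qed.
Lemma measurable_oppR (f : T -> R) :
  measurable_fun setT f ->
  measurable_fun setT (fun x => - f x).
Proof. exact: measurable_funN. Qed.

End Meas.

Ltac mtac1 :=
  match goal with
  | |- measurable_fun _ (fun _ => ?c) => exact: measurable_cst
  | |- measurable_fun _ (fun x => x) => exact: measurable_id
  | |- measurable_fun _ (fun x => fst x) => exact: measurable_fst
  | |- measurable_fun _ (fun x => snd x) => exact: measurable_snd
  | |- measurable_fun _ fst => exact: measurable_fst
  | |- measurable_fun _ snd => exact: measurable_snd
  | |- measurable_fun _ (fun x => _ + _) => apply: measurable_addR
  | |- measurable_fun _ (fun x => - _) => apply: measurable_oppR
  | |- measurable_fun _ (fun x => ind (_ < _)) => apply: measurable_ltR
  | |- measurable_fun _ (fun x => ind (_ <= _)) => apply: measurable_leR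
  | |- measurable_fun _ (fun x => _ * _) => apply: measurable_mulR
  | |- measurable_fun _ (fun x => (powR _ ?p)^-1) => apply: measurable_powRV
  | |- measurable_fun _ (fun x => powR _ ?p) => apply: measurable_powRc
  | |- measurable_fun _ (fun x => `|_|) => apply: measurable_normc
  | |- measurable_fun _ (fun x => Num.min _ _) => apply: measurable_minR
  | |- measurable_fun _ (fun x => Num.max _ _) => apply: measurable_maxR
  | |- measurable_fun _ (fun x => edist _ _) => apply: measurable_edist
  | |- measurable_fun _ (fun x => enorm _) => apply: measurable_enorm
  | |- measurable_fun _ (fun x => tadd _ _) => apply: measurable_tadd
  | |- measurable_fun _ (enorm (n:=_)) => apply: (measurable_enorm (@measurable_id _ _ _))
  | |- measurable_fun _ (edist ?a) =>
      apply: (measurable_edist (@measurable_cst _ _ _ _ _ a) (@measurable_id _ _ _))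
  | |- measurable_fun _ (tadd ?a) =>
      apply: (measurable_tadd (@measurable_cst _ _ _ _ _ a) (@measurable_id _ _ _))
  | H : measurable_fun _ ?u |- measurable_fun _ ?u => exact: H
  | H : measurable_fun _ ?u |- measurable_fun _ (fun x => ?u _) =>
      apply: (measurableT_comp H)
  | H : measurable_fun _ (fun w => ?u (fst w) (snd w)) |- measurable_fun _ (fun x => ?u _ _) =>
      apply: (measurable_comp2 H)
  end.
Ltac mtac := cbv beta; repeat mtac1.

Notation mf2 f := (measurable_fun setT (fun w => f w.1 w.2)).

(** * Single and double integrals of nonnegative real functions *)

Section RealInt.
Context {R : realType} {n : nat}.
Local Notation V := (n.-tuple R).
Implicit Types (f g : V -> R) (F G : V -> V -> R).

(** Values are extended reals, so nonnegative integrands need no integrability assumption; signs are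
    treated separately by [S2]. *)
Definition I1 f : \bar R := leb_int (fun x => (f x)%:E).
Definition I2 F : \bar R := leb_int (fun x => leb_int (fun y => (F x y)%:E)).

Lemma ind_ge0 b : 0 <= ind b :> R. Proof. by case: b. Qed.
Lemma ind_le1 b : ind b <= 1 :> R. Proof. by case: b. Qed.
Lemma indM a b : ind a * ind b = ind (a && b) :> R.
Proof. by case: a; case: b; rewrite ?mulr1 ?mul0r ?mulr0. Qed.

Lemma measurable_EFinc d (T : measurableType d) (f : T -> R) :
  measurable_fun setT f -> measurable_fun setT (fun x => (f x)%:E).
Proof.
move=> mf; have mE : measurable_fun [set: R] (@EFin R) by exact: EFin_measurable.
exact: (measurableT_comp mE mf).
Qed.

Lemma measurable_slice1 F x : mf2 F -> measurable_fun setT (F x).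
Proof.
move=> mF; rewrite (_ : F x = fun y => F x y)//.
by have mid : measurable_fun [set: V] id by []; mtac.
Qed.
Lemma measurable_slice2 F y : mf2 F -> measurable_fun setT (fun x => F x y).
Proof. by move=> mF; have mid : measurable_fun [set: V] id by []; mtac. Qed.

Lemma measurable_I1_slice F : mf2 F -> (forall x y, 0 <= F x y) ->
  measurable_fun setT (fun x => leb_int (fun y => (F x y)%:E)).
Proof.
move=> mF F0.
apply: (@measurable_leb_int R _ V n (fun w => (F w.1 w.2)%:E)) => [|w].
  exact: measurable_EFinc.
by rewrite lee_fin.
Qed.

Lemma I1_ge0 f : (forall x, 0 <= f x) -> (0 <= I1 f)%E.
Proof. by move=> f0; apply: leb_int_ge0 => x; rewrite lee_fin. Qed.
Lemma I2_ge0 F : (forall x y, 0 <= F x y) -> (0 <= I2 F)%E.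
Proof. by move=> f0; apply: leb_int_ge0 => x; apply: I1_ge0. Qed.

Lemma I1_le f g : measurable_fun setT f -> measurable_fun setT g ->
  (forall x, 0 <= f x) -> (forall x, f x <= g x) -> (I1 f <= I1 g)%E.
Proof.
move=> mf mg f0 fg; apply: le_leb_int => [||x|x]; rewrite ?lee_fin//.
- exact: measurable_EFinc.
- exact: measurable_EFinc.
Qed.

Lemma I1D f g : measurable_fun setT f -> measurable_fun setT g ->
  (forall x, 0 <= f x) -> (forall x, 0 <= g x) ->
  I1 (fun x => f x + g x) = (I1 f + I1 g)%E.
Proof.
move=> mf mg f0 g0; rewrite /I1 -leb_intD//; try exact: measurable_EFinc.
Qed.

Lemma I1Z c f : measurable_fun setT f -> (forall x, 0 <= f x) -> 0 <= c ->
  I1 (fun x => c * f x) = (c%:E * I1 f)%E.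
Proof.
move=> mf f0 c0; rewrite /I1 -leb_intZl//; first exact: measurable_EFinc.
Qed.

Lemma I1_shift h f : measurable_fun setT f -> (forall x, 0 <= f x) ->
  I1 (fun x => f (tadd x h)) = I1 f.
Proof.
move=> mf f0; rewrite /I1 (@leb_int_shift _ _ h (fun x => (f x)%:E))//.
exact: measurable_EFinc.
Qed.

Lemma I1_shiftl h f : measurable_fun setT f -> (forall x, 0 <= f x) ->
  I1 (fun x => f (tadd h x)) = I1 f.
Proof.
by move=> mf f0; rewrite -(I1_shift h mf f0); apply: eq_leb_int => x; rewrite taddC.
Qed.

Lemma I2_le F G : mf2 F -> mf2 G ->
  (forall x y, 0 <= F x y) -> (forall x y, F x y <= G x y) -> (I2 F <= I2 G)%E.
Proof.
move=> mF mG F0 FG.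
have G0 x y : 0 <= G x y by apply: le_trans (FG x y).
apply: le_leb_int; try exact: measurable_I1_slice.
- by move=> x; apply: I1_ge0.
- by move=> x; apply: I1_le => //; exact: measurable_slice1.
Qed.

Lemma I2D F G : mf2 F -> mf2 G ->
  (forall x y, 0 <= F x y) -> (forall x y, 0 <= G x y) ->
  I2 (fun x y => F x y + G x y) = (I2 F + I2 G)%E.
Proof.
move=> mF mG F0 G0; rewrite /I2 -leb_intD; try exact: measurable_I1_slice.
- by apply: eq_leb_int => x; apply: I1D => //; exact: measurable_slice1.
- by move=> x; apply: I1_ge0.
- by move=> x; apply: I1_ge0.
Qed.

Lemma I2Z c F : mf2 F -> (forall x y, 0 <= F x y) -> 0 <= c ->
  I2 (fun x y => c * F x y) = (c%:E * I2 F)%E.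
Proof.
move=> mF F0 c0; rewrite /I2 -leb_intZl//; try exact: measurable_I1_slice.
- by apply: eq_leb_int => x; apply: I1Z => //; exact: measurable_slice1.
- by move=> x; apply: I1_ge0.
Qed.

Lemma I2C F : mf2 F -> (forall x y, 0 <= F x y) -> I2 F = I2 (fun x y => F y x).
Proof.
move=> mF F0; rewrite /I2 (@leb_intC _ _ _ (fun w => (F w.1 w.2)%:E))//.
  exact: measurable_EFinc.
by move=> w; rewrite lee_fin.
Qed.

Lemma I2_shift h F : mf2 F -> (forall x y, 0 <= F x y) ->
  I2 (fun x y => F (tadd x h) (tadd y h)) = I2 F.
Proof.
move=> mF F0; rewrite /I2.
rewrite -(@leb_int_shift _ _ h (fun x => leb_int (fun y => (F x y)%:E))).
- by apply: eq_leb_int => x; apply: (@I1_shift h) => //; exact: measurable_slice1.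
- exact: measurable_I1_slice.
- by move=> x; apply: I1_ge0.
Qed.

(** The substitution y = x + z: a kernel in |x - y| becomes a kernel in |z|, and after exchanging
    the integrals the inner one runs over differences of u by a fixed vector z. *)
Lemma I2_polar F : mf2 F -> (forall x y, 0 <= F x y) ->
  I2 (fun x z => F x (tadd x z)) = I2 F.
Proof.
move=> mF F0; apply: eq_leb_int => x.
by apply: (@I1_shiftl x) => //; exact: measurable_slice1.
Qed.

(** The inner bound is only asked where [f x] is nonzero, so that [f] can carry the restriction to a
    ball. *)
Lemma I2_mul_le c f F : measurable_fun setT f -> mf2 F ->
  (forall x, 0 <= f x) -> (forall x y, 0 <= F x y) -> 0 <= c ->
  (forall x, f x != 0 -> (I1 (F x) <= c%:E)%E) ->
  (I2 (fun x y => f x * F x y)%R <= c%:E * I1 f)%E.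
Proof.
move=> mf mF f0 F0 c0 H; rewrite -I1Z//.
apply: le_leb_int.
- apply: measurable_I1_slice => [|x y]; last exact: mulr_ge0.
  by mtac.
- by apply: measurable_EFinc; mtac.
- by move=> x; apply: I1_ge0 => y; exact: mulr_ge0.
- move=> x.
  have -> : leb_int (fun y => (f x * F x y)%:E) = ((f x)%:E * I1 (F x))%E.
    by apply: I1Z => //; exact: measurable_slice1.
  rewrite mulrC EFinM; have [->|fx] := eqVneq (f x) 0; first by rewrite !mul0e.
  by apply: lee_wpmul2l; [rewrite lee_fin|exact: H].
Qed.

(** Coordinate hyperplanes are null. They have to be excluded because [powR 0 (- a)] is 0 for a
    nonzero [a], so a product of negative powers of the coordinates vanishes there instead of being
    infinite. *)
Lemma le_leb_int_off0 (f g : V -> \bar R) :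
  measurable_fun setT f -> measurable_fun setT g ->
  (forall x, 0 <= f x)%E -> (forall x, 0 <= g x)%E ->
  (forall x, (forall i, tnth x i != 0) -> (f x <= g x)%E) ->
  (leb_int f <= leb_int g)%E.
Proof.
elim: n f g => [|m IH] f g mf mg f0 g0 fg /=; first by apply: fg => -[].
apply: ae_ge0_le_integral => //=.
- by move=> t _; apply: leb_int_ge0.
- exact: measurable_leb_int_cons.
- by move=> t _; apply: leb_int_ge0.
- exact: measurable_leb_int_cons.
exists [set 0]; split.
- exact: measurable_set1.
- exact: lebesgue_measure_set1.
move=> t /= H; apply: contrapT => /eqP t0; apply: H => _.
apply: IH => //; try exact: measurable_slice_cons.
move=> x x0; apply: fg => i.
by case: (unliftP ord0 i) => [j|] ->; rewrite ?tnth0// tnthS.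
Qed.

Lemma measurable_prod_tnth (g : R -> R) : measurable_fun setT g ->
  measurable_fun setT (fun x : V => \prod_(i < n) g (tnth x i)).
Proof.
move=> mg; rewrite (_ : (fun x => _) = (fun x : V => \prod_(i <- index_enum 'I_n) (fun x => g (tnth x i)) x)) //.
elim: (index_enum 'I_n) => [|i s IHs].
  by under eq_fun do rewrite big_nil; exact: measurable_cst.
under eq_fun do rewrite big_cons.
apply: measurable_funM => //.
exact: (measurableT_comp mg (measurable_tnth i)).
Qed.

Lemma I1_prod_le f (g : R -> R) : measurable_fun setT f -> measurable_fun setT g ->
  (forall x, 0 <= f x) -> (forall t, 0 <= g t) ->
  (\int[lebesgue_measure]_t (g t)%:E < +oo)%E ->
  (forall x, (forall i, tnth x i != 0) -> f x <= \prod_(i < n) g (tnth x i)) ->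
  exists2 C, 0 <= C & (I1 f <= C%:E)%E.
Proof.
move=> mf mg f0 g0 gfin fg.
exists (fine (\int[lebesgue_measure]_t (g t)%:E)%E ^+ n).
  by rewrite exprn_ge0// fine_ge0//; apply: integral_ge0 => t _; rewrite lee_fin.
rewrite -leb_int_prod//; apply: le_leb_int_off0.
- exact: measurable_EFinc.
- by apply: measurable_EFinc; exact: measurable_prod_tnth.
- by move=> x; rewrite lee_fin.
- by move=> x; rewrite lee_fin; apply: prodr_ge0.
- by move=> x x0; rewrite lee_fin; exact: fg.
Qed.

End RealInt.

(** * Integrability of one-dimensional power weights, by dyadic layers *)

Section Kernel1D.
Context {R : realType}.
Local Notation leb := (@lebesgue_measure R).

Lemma integral_ind_itv (a b : R) : a <= b ->
  (\int[leb]_t (ind (a <= t) * ind (t <= b))%:E = (b - a)%:E)%E.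
Proof.
move=> ab.
transitivity (\int[leb]_t (\1_(`[a, b]%classic : set R) t)%:E)%E.
  apply: eq_integral => t _; rewrite indM indicE /ind; congr EFin.
  case: ifP => H; first by rewrite mem_set//= in_itv/= H.
  by rewrite memNset//= in_itv/= H.
rewrite integral_indic// setIT [LHS]lebesgue_measure_itv/= lte_fin.
case: ltP => //= ba; rewrite -?EFinB//.
by congr EFin; apply/esym/eqP; rewrite subr_eq0 eq_le ab ba.
Qed.

(** Wherever [f] is nonzero, one of the boxes of height [c k] over [-r k, r k] lies above it; the
    areas of these boxes form a convergent geometric series. *)
Lemma geometric_cover_integral (f : R -> R) (c r : nat -> R) (C th : R) :
  measurable_fun setT f -> (forall t, 0 <= f t) ->
  (forall k, 0 <= c k) -> (forall k, 0 <= r k) ->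
  0 <= C -> 0 < th < 1 -> (forall k, c k * r k <= C * th ^+ k) ->
  (forall t, f t != 0 -> exists2 k, f t <= c k & `|t| <= r k) ->
  (\int[leb]_t (f t)%:E < +oo)%E.
Proof.
move=> mf f0 c0 r0 C0 /andP[th0 th1] crC H.
pose u k t := (c k * (ind (- r k <= t) * ind (t <= r k)))%:E.
have u0 k t : (0 <= u k t)%E by rewrite lee_fin !mulr_ge0// ind_ge0.
have mu_ k : measurable_fun setT (u k) by apply: measurable_EFinc; mtac.
apply: (@le_lt_trans _ _ (\int[leb]_t (\sum_(k <oo) u k t))%E).
  apply: ge0_le_integral => //=.
  - by move=> t _; rewrite lee_fin.
  - exact: measurable_EFinc.
  - by apply: (ge0_emeasurable_sum (P := predT)) => [k t _ _|k _]; [exact: u0|exact: mu_].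
  - move=> t _; have [ft0|ft0] := eqVneq (f t) 0.
      by rewrite ft0; apply: nneseries_ge0 => k _ _; exact: u0.
    have [k fk tk] := H t ft0.
    apply: (@le_trans _ _ (u k t)).
      move: tk; rewrite ler_norml => /andP[t1 t2].
      by rewrite /u t1 t2 /= !mulr1 lee_fin.
    apply: le_trans (nneseries_lim_ge k.+1 _) => [|i _ _]; last exact: u0.
    rewrite big_mkord big_ord_recr/= leeDr//.
    by apply: sume_ge0 => i _; exact: u0.
rewrite integral_nneseries//.
apply: (@le_lt_trans _ _ (2 * C / (1 - th))%:E); last exact: ltry.
apply: lime_le.
  by apply: is_cvg_nneseries => k _ _; apply: integral_ge0 => t _; exact: u0.
apply: nearW => m.
have -> : (\sum_(0 <= k < m) \int[leb]_t u k t)%E = (\sum_(0 <= k < m) c k * (r k - - r k))%:E.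
  rewrite -sumEFin; apply: eq_bigr => k _; rewrite /u.
  rewrite (EFinM (c k)) -integral_ind_itv; last by rewrite (le_trans _ (r0 k))// oppr_le0.
  rewrite -ge0_integralZl_EFin//=.
  - by move=> t _; rewrite lee_fin mulr_ge0// ind_ge0.
  - by apply: measurable_EFinc; mtac.
rewrite lee_fin.
apply: (@le_trans _ _ (series (geometric (2 * C) th) m)).
  rewrite /series/= ; apply: ler_sum => k _.
  by have := crC k; rewrite opprK mulrDr -[2 * C * _]mulrA; lra.
by apply: geometric_le_lim; rewrite ?mulr_ge0 ?gtr0_norm.
Qed.

Lemma dyadic_ge1 (t : R) : 1 <= t ->
  exists k : nat, powR 2 k%:R <= t /\ t < powR 2 (k.+1%:R).
Proof.
move=> t1.
have ex : exists k, t < powR 2 (k.+1%:R).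
  exists (Num.bound t).
  have := archi_boundP (le_trans ler01 t1) => /lt_le_trans; apply.
  rewrite powR_mulrn// exprS -natrX -natrM ler_nat.
  by apply: leq_trans (ltnW (ltn_expl _ _)) (leq_pmull _ _).
case: (ex_minnP ex) => k tk kmin; exists k; split=> //.
case: k tk kmin => [|k] tk kmin; first by rewrite powRr0.
by rewrite leNgt; apply/negP => /kmin; rewrite ltnn.
Qed.

(** On the shell 2^-(k+1) < |t| <= 2^-k the integrand is at most 2^(a (k+1)), so the areas have
    ratio 2^(a-1), which is below 1 since a < 1. *)
Lemma integral_near1 (a : R) : 0 < a < 1 ->
  (\int[leb]_t (ind (`|t| < 1) * powR `|t| (- a))%:E < +oo)%E.
Proof.
move=> /andP[a0 a1].
have th0 : 0 < powR 2 (a - 1) :> R by rewrite powR_gt0.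
have th1 : powR 2 (a - 1) < 1 :> R.
  rewrite -[ltRHS](powRr0 (2 : R)) /powR pnatr_eq0/= ltr_expR ltr_pM2r ?ln_gt0 ?ltr1n//.
  by rewrite subr_lt0.
apply: (@geometric_cover_integral _ (fun k => powR 2 (a * k.+1%:R)) (fun k => powR 2 (- k%:R)) (powR 2 a) (powR 2 (a - 1))).
- have mid : measurable_fun [set: R] (fun x : R => x) by exact: measurable_id.
  by mtac.
- by move=> t; rewrite mulr_ge0 ?ind_ge0 ?powR_ge0.
- by move=> k; exact: powR_ge0.
- by move=> k; exact: powR_ge0.
- exact: powR_ge0.
- by rewrite th0.
- move=> k; rewrite -powR_mulrn ?powR_ge0// -powRrM -!powRD; try by rewrite pnatr_eq0 implybT.
  rewrite le_eqVlt; apply/orP; left; apply/eqP; congr powR.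
  by rewrite -[k.+1]addn1 natrD; ring.
move=> t; have [->|t0] := eqVneq t 0.
  by rewrite normr0 powR0 ?mulr0 ?eqxx// oppr_eq0 gt_eqF.
case: (ltP `|t| 1) => [t1 _|_]; last by rewrite mul0r eqxx.
rewrite mul1r.
have nt0 : 0 < `|t| by rewrite normr_gt0.
have [|k [k1 k2]] := @dyadic_ge1 `|t|^-1; first by rewrite invf_ge1// ltW.
exists k; last by rewrite powRN -[leLHS]invrK lef_pV2// posrE ?invr_gt0 ?powR_gt0.
have -> : powR `|t| (- a) = powR `|t|^-1 a by rewrite -powR_inv1// -powRrM mulN1r.
rewrite [a * _]mulrC powRrM ge0_ler_powR// ?nnegrE ?powR_ge0 ?invr_ge0//; exact: ltW.
Qed.

(** Shells 2^k <= max(1, |t|) < 2^(k+1), with height 2^(-(1+b) k): the areas have ratio 2^-b. *)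
Lemma integral_far1 (b : R) : 0 < b ->
  (\int[leb]_t (powR (Num.max 1 `|t|) (- (1 + b)))%:E < +oo)%E.
Proof.
move=> b0.
have th0 : 0 < powR 2 (- b) :> R by rewrite powR_gt0.
have th1 : powR 2 (- b) < 1 :> R.
  rewrite -[ltRHS](powRr0 (2 : R)) /powR pnatr_eq0/= ltr_expR ltr_pM2r ?ln_gt0 ?ltr1n//.
  by rewrite oppr_lt0.
apply: (@geometric_cover_integral _ (fun k => powR 2 (- (1 + b) * k%:R)) (fun k => powR 2 (k.+1%:R)) 2 (powR 2 (- b))).
- have mid : measurable_fun [set: R] (fun x : R => x) by exact: measurable_id.
  by mtac.
- by move=> t; exact: powR_ge0.
- by move=> k; exact: powR_ge0.
- by move=> k; exact: powR_ge0.
- by [].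
- by rewrite th0.
- move=> k; rewrite -[X in _ <= X * _]powRr1// -powR_mulrn ?powR_ge0// -powRrM -!powRD; try by rewrite pnatr_eq0 implybT.
  rewrite le_eqVlt; apply/orP; left; apply/eqP; congr powR.
  by rewrite -[k.+1]addn1 natrD; ring.
move=> t _.
have [|k [k1 k2]] := @dyadic_ge1 (Num.max 1 `|t|); first by rewrite le_max lexx.
exists k; last by apply: le_trans (ltW k2); rewrite le_max lexx orbT.
have m0 : 0 < Num.max 1 `|t| by rewrite lt_max ltr01.
rewrite [_ * k%:R]mulrC powRrM powRN [leRHS]powRN lef_pV2 ?posrE ?powR_gt0//.
by rewrite ge0_ler_powR// ?nnegrE ?powR_ge0 ?addr_ge0// ltW.
Qed.

End Kernel1D.

(** * Power inequalities, monotone powers, and the pointwise energy inequality *)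

Section Elementary.
Context {R : realType}.
Implicit Types a b s t e x y : R.

Lemma powR_le e a b : 0 <= e -> 0 <= a -> a <= b -> powR a e <= powR b e.
Proof.
by move=> e0 a0 ab; rewrite ge0_ler_powR// nnegrE// (le_trans a0).
Qed.

Lemma powR_ler_neg e a b : 0 <= e -> 0 < a -> a <= b -> powR b (- e) <= powR a (- e).
Proof.
move=> e0 a0 ab; rewrite !powRN lef_pV2 ?posrE ?powR_gt0//; last exact: lt_le_trans ab.
by apply: powR_le => //; exact: ltW.
Qed.

Lemma powRD_ne x a b : x != 0 -> powR x (a + b) = powR x a * powR x b.
Proof. by move=> x0; rewrite powRD// x0 implybT. Qed.

Lemma le_powR_d (d a b : R) : 0 < d <= 1 -> a <= b -> powR d (- a) <= powR d (- b).
Proof. by move=> d1 ab; apply: ger_powR => //; rewrite lerN2. Qed.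

Lemma powR_d_ge1 (d b : R) : 0 < d <= 1 -> 0 <= b -> 1 <= powR d (- b).
Proof.
by move=> d1 b0; rewrite -[leLHS](powRr0 d); apply: ger_powR => //; rewrite oppr_le0.
Qed.

Lemma powR_le1 x e : 0 <= x <= 1 -> 0 <= e -> powR x e <= 1.
Proof.
move=> /andP[x0 x1] e0; have := powR_le e0 x0 x1.
by rewrite powR1.
Qed.

Lemma powR_ge1 x e : 1 <= x -> 0 <= e -> 1 <= powR x e.
Proof.
by move=> x1 e0; have := powR_le e0 ler01 x1; rewrite powR1.
Qed.

Lemma powR_add_le e a b : 0 <= e -> 0 <= a -> 0 <= b ->
  powR (a + b) e <= powR 2 e * (powR a e + powR b e).
Proof.
move=> e0 a0 b0.
wlog ab : a b a0 b0 / a <= b => [H|].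
  have [ab|/ltW ba] := leP a b; first exact: H.
  by rewrite addrC [X in _ * X]addrC; exact: H.
apply: (@le_trans _ _ (powR (2 * b) e)).
  by apply: powR_le; rewrite ?addr_ge0//; lra.
rewrite powRM// ler_wpM2l ?powR_ge0// lerDr; exact: powR_ge0.
Qed.

Lemma powR_norm_sub e x y : 0 <= e ->
  powR `|x - y| e <= powR 2 e * (powR `|x| e + powR `|y| e).
Proof.
move=> e0; apply: le_trans (powR_add_le e0 (normr_ge0 x) (normr_ge0 y)).
by apply: powR_le => //; exact: ler_normB.
Qed.

(** Write a^e = a a^(e-1) <= a (a+b)^(e-1), the same for b, and add. *)
Lemma powR_superadd e a b : 1 <= e -> 0 <= a -> 0 <= b ->
  powR a e + powR b e <= powR (a + b) e.
Proof.
move=> e1 a0 b0.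
have e0 : 0 < e by exact: lt_le_trans e1.
rewrite -(mulr_powRB1 a0 e0) -(mulr_powRB1 b0 e0) -(mulr_powRB1 (addr_ge0 a0 b0) e0) mulrDl.
have e10 : 0 <= e - 1 by rewrite subr_ge0.
apply: lerD; apply: ler_wpM2l => //; apply: powR_le => //; lra.
Qed.

Lemma powR_lip e M s t : 1 <= e -> 0 <= s -> s <= t -> t <= M ->
  powR t e - powR s e <= e * powR M (e - 1) * (t - s).
Proof.
move=> e1 s0 st tM; have e0 : 0 < e by exact: lt_le_trans e1.
have t0 : 0 <= t by apply: le_trans st.
have [t00|tn0] := eqVneq t 0.
  have -> : s = t by lra.
  by rewrite !subrr mulr0.
have tp : 0 < t by rewrite lt_neqAle eq_sym tn0.
apply: (@le_trans _ _ (e * powR t (e - 1) * (t - s))); last first.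
  rewrite ler_wpM2r ?subr_ge0// ler_wpM2l ?(ltW e0)//.
  by apply: powR_le; rewrite ?subr_ge0.
have -> : s = t * (s / t) by field.
set x := s / t.
have x0 : 0 <= x by rewrite divr_ge0.
rewrite powRM// -(mulr_powRB1 t0 e0).
(* Bernoulli's inequality, from Young's inequality applied to x and 1; it replaces the mean value
   theorem. *)
have B : e * x <= powR x e + (e - 1).
  have [->|en1] := eqVneq e 1; first by rewrite powRr1// mul1r subrr addr0.
  have e1' : 1 < e by rewrite lt_neqAle eq_sym en1.
  have em1 : e - 1 != 0 by rewrite subr_eq0.
  have := @conjugate_powR R x 1 e (e / (e - 1)) x0 ler01 e0.
  rewrite divr_gt0// ?subr_gt0// => /(_ isT).
  have -> : e^-1 + (e / (e - 1))^-1 = 1 by field; rewrite em1 gt_eqF.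
  move=> /(_ erefl); rewrite powR1 mulr1 => /(ler_wpM2l (ltW e0)).
  suff -> : e * (powR x e / e + 1 / (e / (e - 1))) = powR x e + (e - 1) by [].
  by field; rewrite em1 gt_eqF.
have P0 : 0 <= t * powR t (e - 1) by rewrite mulr_ge0 ?powR_ge0.
have : t * powR t (e - 1) * (e * x) <= t * powR t (e - 1) * (powR x e + (e - 1)).
  exact: ler_wpM2l.
by move=> H; nra.
Qed.

(** Odd power of exponent e. For e = p - 1 it is the flux of the p-Laplacian; for e = [be] it is the
    nonlinearity of the test function. *)
Definition Jp e t : R := powR `|t| (e - 1) * t.

Lemma Jp_ge0E e t : 0 < e -> 0 <= t -> Jp e t = powR t e.
Proof. by move=> e0 t0; rewrite /Jp ger0_norm// mulrC mulr_powRB1. Qed.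

Lemma JpN e t : Jp e (- t) = - Jp e t.
Proof. by rewrite /Jp normrN mulrN. Qed.

Lemma Jp_norm e t : 0 < e -> `|Jp e t| = powR `|t| e.
Proof.
by move=> e0; rewrite /Jp normrM (ger0_norm (powR_ge0 _ _)) mulrC mulr_powRB1.
Qed.

(** By oddness t >= 0 may be assumed. If s >= 0 this is superadditivity of the power; if s < 0 the
    two powers add up and control the power of the sum up to 2^e. *)
Lemma Jp_coercive_lt e s t : 1 <= e -> s < t ->
  powR (t - s) e <= powR 2 e * (Jp e t - Jp e s).
Proof.
move=> e1 st; have e0 : 0 < e by exact: lt_le_trans e1.
have two1 : 1 <= powR 2 e :> R by apply: powR_ge1 => //; [rewrite ler1n|exact: ltW].
wlog t0 : s t st / 0 <= t => [H|].
  have [t0|t0] := leP 0 t; first exact: H.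
  have := H (- t) (- s); rewrite !JpN => {}H.
  have -> : t - s = - s - - t by ring.
  have -> : Jp e t - Jp e s = - Jp e s - - Jp e t by ring.
  by apply: H; [rewrite ltrN2|rewrite oppr_ge0; exact: le_trans (ltW st) (ltW t0)].
have [s0|s0] := leP 0 s.
  rewrite !Jp_ge0E//; apply: (@le_trans _ _ (powR t e - powR s e)).
    rewrite lerBrDr; have := @powR_superadd e (t - s) s e1; rewrite subrK; apply => //.
    by rewrite subr_ge0 ltW.
  rewrite -[leLHS]mul1r ler_wpM2r// subr_ge0; apply: powR_le => //; exact: ltW.
have -> : Jp e s = - powR (- s) e.
  by rewrite -[s in LHS]opprK JpN Jp_ge0E// oppr_ge0 ltW.
rewrite opprK Jp_ge0E//; apply: powR_add_le => //; first exact: ltW.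
by rewrite oppr_ge0 ltW.
Qed.

Lemma Jp_mono e s t : 1 <= e -> s <= t -> Jp e s <= Jp e t.
Proof.
move=> e1; rewrite le_eqVlt => /predU1P[->//|st].
have := Jp_coercive_lt e1 st => H.
have : 0 <= powR 2 e * (Jp e t - Jp e s) by apply: le_trans H; exact: powR_ge0.
by rewrite pmulr_rge0 ?powR_gt0// subr_ge0.
Qed.

Lemma Jp_lip e M s t : 1 <= e -> `|s| <= M -> `|t| <= M ->
  `|Jp e s - Jp e t| <= 2 * (e * powR M (e - 1)) * `|s - t|.
Proof.
move=> e1; have e0 : 0 < e by exact: lt_le_trans e1.
set L := e * powR M (e - 1).
have L0 : 0 <= L by rewrite mulr_ge0 ?powR_ge0// ltW.
wlog st : s t / s <= t => [H|].
  have [st|/ltW ts] := leP s t; first exact: H.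
  by move=> sM tM; rewrite distrC (distrC s t); exact: H.
wlog t0 : s t st / 0 <= t => [H|].
  have [t0|t0] := leP 0 t; first exact: H.
  have := H (- t) (- s); rewrite !JpN lerN2 !normrN => {}H sM tM.
  have -> : Jp e s - Jp e t = - Jp e t - - Jp e s by ring.
  have -> : s - t = - t - - s by ring.
  by apply: H => //; rewrite oppr_ge0; exact: le_trans st (ltW t0).
move=> sM tM.
rewrite distrC (distrC s t) !ger0_norm ?subr_ge0//; last exact: Jp_mono.
have tM' : t <= M by exact: le_trans (ler_norm _) tM.
have sM' : - s <= M by apply: le_trans (ler_norm _) _; rewrite normrN.
have [s0|s0] := leP 0 s.
  rewrite !Jp_ge0E//; have := powR_lip e1 s0 st tM'; rewrite -/L.
  have : 0 <= L * (t - s) by rewrite mulr_ge0// subr_ge0.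
  by move=> *; rewrite -mulrA; lra.
have -> : Jp e s = - powR (- s) e.
  by rewrite -[s in LHS]opprK JpN Jp_ge0E// oppr_ge0 ltW.
rewrite Jp_ge0E// opprK.
have H1 := powR_lip e1 (lexx 0) t0 tM'.
have ns0 : 0 <= - s by rewrite oppr_ge0 ltW.
have H2 := powR_lip e1 (lexx 0) ns0 sM'.
rewrite !subr0 powR0 ?subr0 -/L in H1 H2; last by rewrite gt_eqF.
have : 0 <= L * t by rewrite mulr_ge0.
have : 0 <= L * - s by rewrite mulr_ge0.
by move=> *; nra.
Qed.

(** Origin of the exponent Q = e + be. It is applied with a, b the increments of the translated and
    of the original u between x and y, and s, t the values of the difference d_h u at x and y, for
    which a - b = s - t. *)
Lemma Jp_coercive_prod e be s t a b : 1 <= e -> 1 <= be -> a - b = s - t ->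
  powR `|s - t| (e + be) <=
    powR 2 (e + be) * ((Jp e a - Jp e b) * (Jp be s - Jp be t)).
Proof.
move=> e1 be1; wlog st : s t a b / t <= s => [H|].
  have [ts|/ltW st] := leP t s; first exact: H.
  move=> abst; have := H t s b a st; rewrite distrC => {}H.
  have -> : (Jp e a - Jp e b) * (Jp be s - Jp be t) =
    (Jp e b - Jp e a) * (Jp be t - Jp be s) by ring.
  by apply: H; lra.
move=> abst; move: st; rewrite le_eqVlt => /predU1P[ts|ts].
  have ab : a = b by lra.
  by rewrite ts ab !subrr normr0 powR0 ?mul0r ?mulr0// gt_eqF//; lra.
have ba : b < a by lra.
rewrite ger0_norm ?subr_ge0 ?(ltW ts)//.
rewrite !powRD_ne ?pnatr_eq0 ?gt_eqF ?subr_gt0//.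
have H1 := Jp_coercive_lt e1 ba; have H2 := Jp_coercive_lt be1 ts.
rewrite mulrACA -{1}abst; apply: ler_pM => //; exact: powR_ge0.
Qed.

(** Integrand of the tested difference of the two equations at a pair (x, y): [zh], [z] are values
    of the sign field, [k1], [kp] the two kernels, [ex], [ey] values of the cutoff. The monotonicity
    of the field makes the [k1] term nonnegative except where the cutoff varies. *)
Lemma energy_pointwise e be vx vy a b zh z ex ey de k1 kp :
  1 <= e -> 1 <= be -> a - b = vx - vy -> `|zh| <= 1 -> `|z| <= 1 ->
  (b < a -> z <= zh) -> (a < b -> zh <= z) ->
  0 <= ex -> 0 <= ey -> `|ex - ey| <= de -> 0 <= k1 -> 0 <= kp ->
  (Jp e a - Jp e b) * (Jp be vx - Jp be vy) * ((ex + ey) / 2) * kp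
   - (powR `|vx| be + powR `|vy| be) * de * (2 * k1 + (powR `|a| e + powR `|b| e) * kp)
  <= (zh - z) * (Jp be vx * ex - Jp be vy * ey) * k1
     + (Jp e a - Jp e b) * (Jp be vx * ex - Jp be vy * ey) * kp.
Proof.
move=> e1 be1 abv zh1 z1 mon1 mon2 ex0 ey0 exy k10 kp0.
have e0 : 0 < e by exact: lt_le_trans e1.
have be0 : 0 < be by exact: lt_le_trans be1.
set X := Jp be vx; set Y := Jp be vy.
set A := Jp e a - Jp e b.
have HX : `|X| = powR `|vx| be by exact: Jp_norm.
have HY : `|Y| = powR `|vy| be by exact: Jp_norm.
have HA : `|A| <= powR `|a| e + powR `|b| e.
  by apply: le_trans (ler_normB _ _) _; rewrite !Jp_norm.
have Hz : `|zh - z| <= 2.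
  apply: le_trans (ler_normB _ _) _; lra.
have Zmon : 0 <= (zh - z) * (X - Y).
  case: (ltgtP a b) => ab.
  - apply: mulr_le0; first by rewrite subr_le0 mon2.
    by rewrite subr_le0; apply: Jp_mono => //; lra.
  - apply: mulr_ge0; first by rewrite subr_ge0 mon1.
    by rewrite subr_ge0; apply: Jp_mono => //; lra.
  - have vxy : vx = vy by lra.
    by rewrite /X /Y vxy subrr mulr0.
rewrite -HX -HY.
(* Discrete product rule: the first term carries the sign, the second is the error caused by the
   cutoff. *)
have -> : X * ex - Y * ey = (X - Y) * ((ex + ey) / 2) + (X + Y) * ((ex - ey) / 2) by field.
have S : `|(X + Y) * ((ex - ey) / 2)| <= (`|X| + `|Y|) * de.
  rewrite normrM; apply: ler_pM => //; first exact: ler_normD.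
  by rewrite normrM [X in _ * X]ger0_norm ?invr_ge0//; have := normr_ge0 (ex - ey); lra.
set P := (X + Y) * ((ex - ey) / 2) in S *.
set D := (`|X| + `|Y|) * de in S *.
have D0 : 0 <= D by exact: le_trans S.
have T1 : - (2 * D) <= (zh - z) * P.
  rewrite lerNl -mulNr; apply: le_trans (ler_norm _) _.
  by rewrite normrM normrN; apply: ler_pM.
have T2 : - ((powR `|a| e + powR `|b| e) * D) <= A * P.
  rewrite lerNl -mulNr; apply: le_trans (ler_norm _) _.
  by rewrite normrM normrN; apply: ler_pM.
have E2 : 0 <= (ex + ey) / 2 by rewrite divr_ge0 ?addr_ge0.
have T3 : 0 <= (zh - z) * ((X - Y) * ((ex + ey) / 2)) by rewrite mulrA mulr_ge0.
have U1 := ler_wpM2r k10 T1.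
have U2 := ler_wpM2r kp0 T2.
have U3 := mulr_ge0 T3 k10.
lra.
Qed.

(** The free weight [th] is later chosen to balance the two terms; the factors 1/l and 1/l' of
    Young's inequality are bounded by 1. *)
Lemma young_weight s t th l l' : 0 <= s -> 0 <= t -> 0 < th ->
  1 < l -> l'^-1 + l^-1 = 1 -> 0 < l' ->
  s * t <= powR s l' * powR th l' + powR t l * powR th (- l).
Proof.
move=> s0 t0 th0 l1 ll l'0.
have l0 : 0 < l by exact: lt_trans l1.
have thn : th != 0 by rewrite gt_eqF.
have -> : s * t = (s * th) * (t * th^-1) by field.
have H := @conjugate_powR R (s * th) (t * th^-1) l' l.
have thi : 0 <= th^-1 by rewrite invr_ge0 ltW.
apply: le_trans (H _ _ _ _ _) _ => //; rewrite ?mulr_ge0// ?(ltW th0)//.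
rewrite !powRM// ?(ltW th0)//.
have -> : powR th^-1 l = powR th (- l) by rewrite -powR_inv1 ?(ltW th0)// -powRrM mulN1r.
have l'1 : 1 <= l'.
  rewrite -invf_le1//; have : 0 < l^-1 by rewrite invr_gt0.
  by lra.
have X0 : 0 <= powR s l' * powR th l' by rewrite mulr_ge0 ?powR_ge0.
have Y0 : 0 <= powR t l * powR th (- l) by rewrite mulr_ge0 ?powR_ge0.
by apply: lerD; rewrite ler_pdivrMr// ler_peMr// ltW.
Qed.

End Elementary.

(** * Further rules for double integrals *)

Section DoubleIntegrals.
Context {R : realType} {n : nat}.
Local Notation V := (n.-tuple R).
Implicit Types (f g : V -> R) (F G : V -> V -> R).

Lemma I2_le_I1 F g : mf2 F -> measurable_fun setT g ->
  (forall x y, 0 <= F x y) -> (forall x, 0 <= g x) ->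
  (forall x, (I1 (F x) <= (g x)%:E)%E) -> (I2 F <= I1 g)%E.
Proof.
move=> mF mg F0 g0 H; apply: le_leb_int => //.
- exact: measurable_I1_slice.
- exact: measurable_EFinc.
- by move=> x; apply: I1_ge0.
Qed.

Lemma I2_sep f g c : measurable_fun setT f -> measurable_fun setT g ->
  (forall x, 0 <= f x) -> (forall x, 0 <= g x) -> I1 g = c%:E ->
  (I2 (fun x y => f x * g y)%R = c%:E * I1 f)%E.
Proof.
move=> mf mg f0 g0 gc.
have c0 : 0 <= c by rewrite -lee_fin -gc; apply: I1_ge0.
rewrite -I1Z//; apply: eq_leb_int => x.
transitivity ((f x)%:E * I1 g)%E; first by rewrite -I1Z.
by rewrite gc -EFinM mulrC.
Qed.

Lemma I2_shiftl h F : mf2 F -> (forall x y, 0 <= F x y) ->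
  I2 (fun x y => F (tadd x h) y) = I2 F.
Proof.
move=> mF F0; rewrite I2C//; last by mtac.
rewrite [RHS]I2C//; apply: eq_leb_int => y.
by apply: (I1_shift h) => //; exact: measurable_slice2.
Qed.

Lemma I1_le_div c f (X : R) : 0 < c -> (c%:E * I1 f <= X%:E)%E ->
  (I1 f <= (X / c)%:E)%E.
Proof.
move=> c0; rewrite mulrC EFinM -lee_pdivlMl//.
Qed.

End DoubleIntegrals.

(** * Kernel integrals in R^n, and volumes of cubes and balls *)

Section KernelN.
Context {R : realType} {n : nat}.
Hypothesis n0 : (0 < n)%N.
Local Notation V := (n.-tuple R).

Let nR0 : 0 < n%:R :> R. Proof. by rewrite ltr0n. Qed.

(** The norm dominates each coordinate, so |z|^(-a n) is at most the product of the |z_i|^(-a),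
    which is integrable near 0 for a < 1. *)
Lemma kernel_near e : 0 < e -> exists2 C, 0 <= C &
  (I1 (fun z : V => ind (enorm z < 1) * powR (enorm z) (e - n%:R))%R <= C%:E)%E.
Proof.
(* Capping the exponent keeps a = 1 - e'/n strictly between 0 and 1; as |z| < 1, a smaller exponent
   only enlarges the integrand. *)
move=> e0; pose e' := Num.min e (n%:R / 2).
have e'0 : 0 < e' by rewrite lt_min e0 divr_gt0.
have e'n : e' <= n%:R / 2 by rewrite ge_min lexx orbT.
have e'e : e' <= e by rewrite ge_min lexx.
pose a := 1 - e' / n%:R.
have a0 : 0 < a.
  by rewrite subr_gt0 ltr_pdivrMr// mul1r; apply: le_lt_trans e'n _; have := nR0; lra.
have a1 : a < 1 by rewrite ltrBlDr ltrDl divr_gt0.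
pose g (t : R) := ind (`|t| < 1) * powR `|t| (- a).
have mid : measurable_fun [set: R] (fun t : R => t) by exact: measurable_id.
apply: (@I1_prod_le _ _ _ g).
- by mtac.
- by rewrite /g; mtac.
- by move=> x; rewrite mulr_ge0 ?ind_ge0 ?powR_ge0.
- by move=> x; rewrite mulr_ge0 ?ind_ge0 ?powR_ge0.
- by apply: integral_near1; rewrite a0.
move=> x x0; case: (ltP (enorm x) 1) => [x1|_]; last first.
  by rewrite mul0r prodr_ge0// => i _; rewrite mulr_ge0 ?ind_ge0 ?powR_ge0.
have i0 : 'I_n by exact: (Ordinal n0).
have xp : 0 < enorm x.
  by apply: lt_le_trans (ler_tnth_enorm x i0); rewrite normr_gt0.
rewrite mul1r; apply: (@le_trans _ _ (powR (enorm x) (- a * n%:R))).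
  apply: ger_powR; first by rewrite xp ltW.
  have -> : - a * n%:R = e' - n%:R by rewrite /a; field; rewrite gt_eqF.
  by rewrite lerD2r.
rewrite powRrM powR_mulrn ?powR_ge0// -[X in _ ^+ X]card_ord -prodr_const.
apply: ler_prod => i _; rewrite powR_ge0/= /g.
have -> : `|tnth x i| < 1 by apply: le_lt_trans x1; exact: ler_tnth_enorm.
rewrite mul1r; apply: powR_ler_neg; [exact: ltW|by rewrite normr_gt0|exact: ler_tnth_enorm].
Qed.

(** For |z| >= d and d <= 1, each max(1, |z_i|) is at most |z|/d. This pointwise comparison gives
    the power d^-(n+s); rescaling would give d^-s, but any power of d is admissible, since it only
    ends up in kappa. *)
Lemma kernel_far s : 0 < s -> exists2 C, 0 <= C & forall d, 0 < d <= 1 ->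
  (I1 (fun z : V => ind (d <= enorm z) * powR (enorm z) (- (n%:R + s)))%R <=
     (C * powR d (- (n%:R + s)))%:E)%E.
Proof.
move=> s0; pose b := s / n%:R.
have b0 : 0 < b by rewrite divr_gt0.
pose g (t : R) := powR (Num.max 1 `|t|) (- (1 + b)).
have mid : measurable_fun [set: R] (fun t : R => t) by exact: measurable_id.
have mg : measurable_fun setT g by rewrite /g; mtac.
have g0 t : 0 <= g t by exact: powR_ge0.
have ns0 : 0 <= n%:R + s by rewrite addr_ge0// ltW.
have [C C0 HC] := @I1_prod_le R n (fun x : V => \prod_(i < n) g (tnth x i)) g
  (measurable_prod_tnth mg) mg (fun x => prodr_ge0 _ (fun i _ => g0 _)) g0 (integral_far1 b0) (fun x _ => lexx _).
exists C => // d /andP[d0 d1].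
apply: (@le_trans _ _ ((powR d (- (n%:R + s)))%:E * I1 (fun x : V => \prod_(i < n) g (tnth x i))%R)%E); last first.
  by rewrite mulrC EFinM lee_wpmul2l// lee_fin powR_ge0.
have mp := measurable_prod_tnth (n := n) mg.
rewrite -I1Z//; [|by move=> x; apply: prodr_ge0|exact: powR_ge0].
apply: I1_le; [by mtac|by mtac|by move=> x; rewrite mulr_ge0 ?ind_ge0 ?powR_ge0|].
move=> x; case: (leP d (enorm x)) => [dx|_]; last first.
  by rewrite mul0r mulr_ge0 ?powR_ge0// prodr_ge0.
rewrite mul1r.
have xp : 0 < enorm x by exact: lt_le_trans dx.
have -> : enorm x = d * (enorm x / d) by field; rewrite gt_eqF.
have xd1 : 1 <= enorm x / d by rewrite ler_pdivlMr// mul1r.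
have xd0 : 0 < enorm x / d by exact: lt_le_trans xd1.
rewrite powRM ?(ltW d0) ?(ltW xd0)// ler_wpM2l ?powR_ge0//.
have -> : - (n%:R + s) = - (1 + b) * n%:R by rewrite /b; field; rewrite gt_eqF.
rewrite powRrM powR_mulrn ?powR_ge0// -[X in _ ^+ X]card_ord -prodr_const.
apply: ler_prod => i _; rewrite powR_ge0/= /g.
apply: powR_ler_neg; [by rewrite addr_ge0// ltW|by rewrite lt_max ltr01|].
rewrite ge_max xd1/= ler_pdivlMr//.
by apply: le_trans (ler_tnth_enorm x i); rewrite ler_piMr.
Qed.

(** The weight min(1, |z|/d) comes from differences of a cutoff of slope 1/d; its q-th power cures
    the singularity at 0 because q > a. *)
Lemma kernel_mid a q : 0 < a < q -> exists2 C, 0 <= C & forall d, 0 < d <= 1 ->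
  (I1 (fun z : V => powR (Num.min 1 (enorm z / d)) q * powR (enorm z) (- (n%:R + a)))%R <=
     (C * powR d (- (n%:R + a + q)))%:E)%E.
Proof.
move=> /andP[a0 aq].
have q0 : 0 < q by exact: lt_trans aq.
have [C1 C10 H1] := @kernel_near (q - a) ltac:(by rewrite subr_gt0).
have [C2 C20 H2] := kernel_far a0.
exists (C1 + C2); first exact: addr_ge0.
move=> d d1; have /andP[d0 dle1] := d1.
pose f1 (z : V) := powR d (- q) * (ind (enorm z < 1) * powR (enorm z) (q - a - n%:R)).
pose f2 (z : V) := ind (d <= enorm z) * powR (enorm z) (- (n%:R + a)).
have f10 z : 0 <= f1 z by rewrite mulr_ge0 ?powR_ge0// mulr_ge0 ?ind_ge0 ?powR_ge0.
have f20 z : 0 <= f2 z by rewrite mulr_ge0 ?ind_ge0 ?powR_ge0.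
have mf1 : measurable_fun setT f1 by rewrite /f1; mtac.
have mf2 : measurable_fun setT f2 by rewrite /f2; mtac.
apply: (@le_trans _ _ (I1 (fun z => f1 z + f2 z)%R)).
  apply: I1_le; [by mtac|by mtac| |].
    by move=> z; rewrite mulr_ge0 ?powR_ge0.
  move=> z; have md0 : 0 <= Num.min 1 (enorm z / d).
    by rewrite le_min ler01/= divr_ge0 ?enorm_ge0// ltW.
  have [dz|dz] := leP d (enorm z).
    apply: (@le_trans _ _ (f2 z)); last by rewrite lerDr.
    rewrite /f2 dz mul1r ler_piMl ?powR_ge0// powR_le1 ?(ltW q0)// md0/=.
    by rewrite ge_min lexx.
  apply: (@le_trans _ _ (f1 z)); last by rewrite lerDl.
  rewrite /f1 (lt_le_trans dz dle1) mul1r.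
  have [->|z0] := eqVneq (enorm z) 0.
    rewrite mul0r min_r// [X in X * _]powR0 ?gt_eqF// mul0r.
    by rewrite mulr_ge0 ?powR_ge0.
  have -> : q - a - n%:R = q + - (n%:R + a) by ring.
  rewrite (powRD_ne _ _ z0) mulrA ler_wpM2r ?powR_ge0//.
  apply: (@le_trans _ _ (powR (enorm z / d) q)).
    by apply: powR_le => //; [exact: ltW|rewrite ge_min lexx orbT].
  rewrite powRM ?enorm_ge0 ?invr_ge0 ?(ltW d0)// mulrC.
  by rewrite -[d^-1]powR_inv1 ?(ltW d0)// -powRrM mulN1r.
rewrite I1D// mulrDl EFinD; apply: leeD.
  rewrite /f1 I1Z//; [|by mtac|by move=> z; rewrite mulr_ge0 ?ind_ge0 ?powR_ge0|exact: powR_ge0].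
  apply: (@le_trans _ _ ((powR d (- q))%:E * C1%:E)%E).
    by rewrite lee_wpmul2l// lee_fin powR_ge0.
  rewrite -EFinM lee_fin mulrC ler_wpM2l//; apply: le_powR_d => //.
  by rewrite lerDr addr_ge0// ltW.
apply: le_trans (H2 d d1) _; rewrite lee_fin ler_wpM2l//.
by apply: le_powR_d => //; rewrite lerDl ltW.
Qed.

Lemma I1_cube (c : R) : 0 <= c ->
  I1 (fun z : V => \prod_(i < n) (ind (0 <= tnth z i) * ind (tnth z i <= c))) = (c ^+ n)%:E.
Proof.
move=> c0; have mid : measurable_fun [set: R] (fun t : R => t) by exact: measurable_id.
pose g (t : R) := ind (0 <= t) * ind (t <= c) : R.
have gi : (\int[lebesgue_measure]_t (g t)%:E = c%:E)%E.
  by rewrite integral_ind_itv// subr0.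
rewrite /I1 (@leb_int_prod R n g) ?gi//.
- by rewrite /g; mtac.
- by move=> t; rewrite mulr_ge0 ?ind_ge0.
- exact: ltry.
Qed.

Lemma measurable_cube (c : R) : measurable_fun setT
  (fun z : V => \prod_(i < n) (ind (0 <= tnth z i) * ind (tnth z i <= c)) : R).
Proof.
have mid : measurable_fun [set: R] (fun t : R => t) by exact: measurable_id.
apply: (@measurable_prod_tnth R n (fun t => ind (0 <= t) * ind (t <= c))).
by mtac.
Qed.

Lemma I1_ball (r : R) (x0 : V) : 0 <= r ->
  (I1 (fun x : V => ind (edist x x0 < r))%R <= ((2 * r) ^+ n)%:E)%E.
Proof.
move=> r0; rewrite -(@I1_shift _ _ x0); last 2 first.
- by mtac.
- by move=> x; exact: ind_ge0.
have mid : measurable_fun [set: R] (fun t : R => t) by exact: measurable_id.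
pose g (t : R) := ind (- r <= t) * ind (t <= r) : R.
have gi : (\int[lebesgue_measure]_t (g t)%:E = (2 * r)%:E)%E.
  by rewrite integral_ind_itv; [congr EFin; ring|lra].
have mg : measurable_fun setT g by rewrite /g; mtac.
have g0 t : 0 <= g t by rewrite mulr_ge0 ?ind_ge0.
have -> : ((2 * r) ^+ n)%:E = I1 (fun x : V => \prod_(i < n) g (tnth x i)).
  by rewrite /I1 (@leb_int_prod R n g) ?gi// ltry.
apply: I1_le.
- by mtac.
- exact: measurable_prod_tnth.
- by move=> x; exact: ind_ge0.
move=> x; rewrite [tadd x x0]taddC edist_taddl.
case: (ltP (enorm x) r) => [xr|_]; last by rewrite prodr_ge0.
rewrite big1// => i _; rewrite /g.
have := ler_tnth_enorm x i => /le_lt_trans/(_ xr); rewrite ltr_norml => /andP[/ltW -> /ltW ->].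
by rewrite mulr1.
Qed.

End KernelN.

(** * From seminorms to translates, from second to first differences, and interpolation of
    exponents *)

Section Differences.
Context {R : realType} {n : nat}.
Hypothesis n0 : (0 < n)%N.
Local Notation V := (n.-tuple R).
Implicit Types (u w : V -> R).

Let nR0 : 0 < n%:R :> R. Proof. by rewrite ltr0n. Qed.

Definition inb (x0 : V) (r : R) (x : V) : R := ind (edist x x0 < r).

Ltac mt := rewrite ?/inb; mtac.

Lemma inb_ge0 x0 r x : 0 <= inb x0 r x. Proof. exact: ind_ge0. Qed.

Lemma measurable_inb x0 r : measurable_fun setT (inb x0 r).
Proof. by rewrite /inb; mt. Qed.

(** Here [a] is the whole exponent of the kernel, not the order of differentiability: in the energy
    of d_h u the power Q grows while [a] stays N + s_p p. *)
Definition gagI (x0 : V) (r Q a : R) (w : V -> R) : \bar R :=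
  I2 (fun x y => inb x0 r x * inb x0 r y * (powR `|w x - w y| Q * powR (edist x y) (- a))).

Lemma cube_norm (c : R) (z : V) : 0 <= c ->
  \prod_(i < n) (ind (0 <= tnth z i) * ind (tnth z i <= c)) != 0 :> R ->
  enorm z <= n%:R * c.
Proof.
move=> c0 /prodf_neq0 H; apply: le_trans (enorm_le_sum z) _.
apply: (@le_trans _ _ (\sum_(i < n) c)); last by rewrite sumr_const card_ord mulr_natl.
apply: ler_sum => i _; move: (H i isT); rewrite indM /ind.
case: ifP => [/andP[h1 h2] _|]; last by rewrite eqxx.
by rewrite ger0_norm.
Qed.

(* Averages |w(x+h) - w(x)| over intermediate points x + z, with z in a cube of
   side |h|/n. *)
Lemma gagI_shift (Q a : R) : 0 < Q -> 0 <= a ->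
  exists2 C, 0 <= C & forall w x0 r d A h, measurable_fun setT w ->
    0 <= A -> 0 < enorm h -> enorm h <= d ->
    (gagI x0 r Q a w <= A%:E)%E ->
    (I1 (fun x => inb x0 (r - d) x * powR `|w (tadd x h) - w x| Q)%R <=
       (C * A * powR (enorm h) (a - n%:R))%:E)%E.
Proof.
move=> Q0 a0.
pose C : R := powR 2 Q * powR 2 a * 2 * n%:R ^+ n.
exists C; first by rewrite !mulr_ge0 ?powR_ge0 ?exprn_ge0 ?(ltW nR0).
move=> w x0 r d A h mw A0 h0 hd HA.
pose c := enorm h / n%:R.
have c0 : 0 < c by rewrite divr_gt0.
have nc : n%:R * c = enorm h by rewrite /c; field; rewrite gt_eqF.
pose cube (z : V) : R := \prod_(i < n) (ind (0 <= tnth z i) * ind (tnth z i <= c)).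
have mcube : measurable_fun setT cube by exact: measurable_cube.
have cube0 z : 0 <= cube z by apply: prodr_ge0 => i _; rewrite mulr_ge0 ?ind_ge0.
have cube1 z : cube z <= 1.
  by apply: prodr_ile1 => i _; rewrite mulr_ge0 ?ind_ge0//= mulr_ile1 ?ind_ge0 ?ind_le1.
pose f x := inb x0 (r - d) x * powR `|w (tadd x h) - w x| Q.
have mf : measurable_fun setT f by rewrite /f; mt.
have f0 x : 0 <= f x by rewrite mulr_ge0 ?inb_ge0 ?powR_ge0.
pose Phi x y := inb x0 r x * inb x0 r y * (powR `|w x - w y| Q * powR (edist x y) (- a)).
have mPhi : mf2 Phi by rewrite /Phi; mt.
have Phi0 x y : 0 <= Phi x y by rewrite !mulr_ge0 ?inb_ge0 ?powR_ge0.
have key x z : f x * cube z <=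
    powR 2 Q * powR (2 * enorm h) a * (Phi (tadd x h) (tadd x z) + Phi x (tadd x z)).
  have R0 : 0 <= powR 2 Q * powR (2 * enorm h) a * (Phi (tadd x h) (tadd x z) + Phi x (tadd x z)).
    by rewrite !mulr_ge0 ?powR_ge0// addr_ge0.
  rewrite /f /inb; case: (ltP (edist x x0) (r - d)) => [xr|_]; last by rewrite !mul0r.
  have [->|cz] := eqVneq (cube z) 0; first by rewrite mulr0.
  rewrite mul1r; apply: (@le_trans _ _ (powR `|w (tadd x h) - w x| Q)).
    by rewrite ler_piMr ?powR_ge0.
  have zh : enorm z <= enorm h by rewrite -nc; apply: cube_norm => //; exact: ltW.
  have d0 : 0 <= d by exact: le_trans (ltW h0) hd.
  have B1 : edist x x0 < r by apply: lt_le_trans xr _; rewrite gerBl.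
  have B2 : edist (tadd x h) x0 < r by have := eball_tadd xr hd; rewrite subrK.
  have B3 : edist (tadd x z) x0 < r.
    by have := eball_tadd xr (le_trans zh hd); rewrite subrK.
  (* Inserting the kernel costs (2 |h|)^a because the points are that close; division by the volume
     (|h|/n)^n of the cube then produces the power a - n. *)
  have loc (p q : V) : edist p q <= 2 * enorm h ->
     powR `|w p - w q| Q <= powR (2 * enorm h) a * (powR `|w p - w q| Q * powR (edist p q) (- a)).
    move=> pq; have [e0|e0] := eqVneq (edist p q) 0.
      by rewrite (edist_eq0 e0) subrr normr0 powR0 ?mul0r ?mulr0// gt_eqF.
    have ep : 0 < edist p q by rewrite lt_neqAle eq_sym e0 edist_ge0.
    rewrite mulrCA ler_peMr ?powR_ge0// powRN ler_pdivlMr ?powR_gt0// mul1r.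
    by apply: powR_le => //; exact: edist_ge0.
  have D1 : edist (tadd x h) (tadd x z) <= 2 * enorm h.
    apply: le_trans (edist_triangle _ x _) _.
    by rewrite edist_taddl edist_taddr mulr_natl mulr2n lerD2l.
  have D2 : edist x (tadd x z) <= 2 * enorm h.
    by rewrite edist_taddr; apply: le_trans zh _; rewrite ler_peMl ?ler1n// ltW.
  have -> : w (tadd x h) - w x = (w (tadd x h) - w (tadd x z)) - (w x - w (tadd x z)) by ring.
  apply: le_trans (powR_norm_sub _ _ (ltW Q0)) _.
  rewrite -mulrA ler_wpM2l ?powR_ge0// mulrDr; apply: lerD.
    by rewrite /Phi /inb B2 B3 /= !mul1r; exact: loc.
  by rewrite /Phi /inb B1 B3 /= !mul1r; exact: loc.
have cn0 : 0 < c ^+ n by rewrite exprn_gt0.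
have cubeI : I1 cube = (c ^+ n)%:E by exact: (I1_cube (ltW c0)).
rewrite -/f.
have HA' : (I2 Phi <= A%:E)%E by exact: HA.
clearbody Phi f cube.
have -> : C * A * powR (enorm h) (a - n%:R) = (powR 2 Q * powR (2 * enorm h) a * (A + A)) / c ^+ n.
  rewrite /C /c expr_div_n powRM ?(ltW h0)// (powRD_ne _ _ (lt0r_neq0 h0)) powRN powR_mulrn ?(ltW h0)//.
  by field; rewrite !expf_neq0// gt_eqF.
apply: I1_le_div => //.
rewrite -(I2_sep mf mcube f0 cube0 cubeI).
pose G1 x z := Phi (tadd x h) (tadd x z).
pose G2 x z := Phi x (tadd x z).
have mG1 : mf2 G1 by rewrite /G1; mtac.
have mG2 : mf2 G2 by rewrite /G2; mtac.
have G10 x z : 0 <= G1 x z by exact: Phi0.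
have G20 x z : 0 <= G2 x z by exact: Phi0.
have IG2 : I2 G2 = I2 Phi by exact: I2_polar.
have IG1 : I2 G1 = I2 Phi.
  rewrite -(I2_shiftl h mPhi Phi0).
  have mPsi : mf2 (fun x y => Phi (tadd x h) y) by mtac.
  by rewrite -(@I2_polar _ _ (fun x y => Phi (tadd x h) y))//.
have {}key x z : f x * cube z <= powR 2 Q * powR (2 * enorm h) a * (G1 x z + G2 x z) by exact: key.
clearbody G1 G2.
apply: (@le_trans _ _ (I2 (fun x z => powR 2 Q * powR (2 * enorm h) a * (G1 x z + G2 x z))%R)).
  apply: I2_le => [||x z|x z]; last exact: key.
  - by mtac.
  - by mtac.
  - exact: mulr_ge0.
have mG : mf2 (fun x z => G1 x z + G2 x z) by mtac.
rewrite (I2Z mG); last 2 first.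
- by move=> x z; exact: addr_ge0.
- by rewrite mulr_ge0 ?powR_ge0.
rewrite [leRHS]EFinM; apply: lee_wpmul2l; first by rewrite lee_fin mulr_ge0 ?powR_ge0.
by rewrite (I2D mG1 mG2 G10 G20) EFinD IG1 IG2; exact: leeD.
Qed.

(** A triangle inequality whose constant on s is close to 1, by cases on |t| <= th |s|. With the
    usual 2^Q the doubling argument would not contract. *)
Lemma abs_split_pow (Q th s t : R) : 0 <= Q -> 0 < th ->
  powR `|s - t| Q <= powR (1 + th) Q * powR `|s| Q + powR (1 + th^-1) Q * powR `|t| Q.
Proof.
move=> Q0 th0.
have A0 : 0 <= powR (1 + th) Q * powR `|s| Q by rewrite mulr_ge0 ?powR_ge0.
have B0 : 0 <= powR (1 + th^-1) Q * powR `|t| Q by rewrite mulr_ge0 ?powR_ge0.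
have thV : 0 < th^-1 by rewrite invr_gt0.
have [ts|st] := leP `|t| (th * `|s|).
  apply: (@le_trans _ _ (powR (1 + th) Q * powR `|s| Q)); last by rewrite lerDl.
  rewrite -powRM ?addr_ge0 ?(ltW th0)//; apply: powR_le => //.
  by apply: le_trans (ler_normB _ _) _; rewrite mulrDl mul1r lerD2l.
apply: (@le_trans _ _ (powR (1 + th^-1) Q * powR `|t| Q)); last by rewrite lerDr.
rewrite -powRM ?addr_ge0 ?(ltW thV)//; apply: powR_le => //.
apply: le_trans (ler_normB _ _) _; rewrite mulrDl mul1r addrC lerD2l.
by rewrite mulrC ler_pdivlMr// mulrC ltW.
Qed.

(* 2 (u(x+h) - u(x)) = (u(x+2h) - u(x)) - (second difference), so bounds on second
   differences at a rate tau < 1 pass to first differences by iterated doubling. *)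
Lemma second_to_first (Q tau : R) : 1 <= Q -> 0 <= tau < 1 ->
  exists2 C, 0 <= C & forall u x0 r d A M, measurable_fun setT u ->
    0 < d <= 1 -> 0 <= A -> 0 <= M ->
    (forall h, enorm h <= d ->
       (I1 (fun x => inb x0 r x * powR `|u (tadd x h) - u x| Q)%R <= M%:E)%E) ->
    (forall h, 0 < enorm h -> enorm h <= d ->
       (I1 (fun x => inb x0 r x *
          powR `|(u (tadd (tadd x h) h) - u (tadd x h)) - (u (tadd x h) - u x)| Q)%R <=
        (A * powR (enorm h) (tau * Q))%:E)%E) ->
    forall h, 0 < enorm h -> enorm h <= d ->
      (I1 (fun x => inb x0 r x * powR `|u (tadd x h) - u x| Q)%R <=
        (C * (A + M * powR d (- (tau * Q))) * powR (enorm h) (tau * Q))%:E)%E.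
Proof.
move=> Q1 /andP[tau0 tau1].
have Q0 : 0 < Q by exact: lt_le_trans Q1.
(* Half of the room 1 - tau is spent on 1 + th, so that one doubling multiplies the normalized bound
   by q0 = 2^(-Q (1 - tau)/2) < 1. *)
pose th : R := powR 2 ((1 - tau) / 2) - 1.
have two_gt : (1 : R) < 2 by rewrite ltr1n.
have ltpow (x y : R) : x < y -> powR 2 x < powR 2 y.
  by move=> xy; rewrite /powR pnatr_eq0/= ltr_expR ltr_pM2r ?ln_gt0.
have th0 : 0 < th by rewrite subr_gt0 -[ltLHS](powRr0 (2 : R)) ltpow// divr_gt0// subr_gt0.
have th1 : 1 + th = powR 2 ((1 - tau) / 2) by rewrite addrC subrK.
pose q0 := powR 2 (- (Q * ((1 - tau) / 2))).
have q01 : q0 < 1.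
  by rewrite -[ltRHS](powRr0 (2 : R)) ltpow// oppr_lt0 mulr_gt0// divr_gt0// subr_gt0.
have q0E : powR 2 (- Q) * powR (1 + th) Q * powR 2 (tau * Q) = q0.
  rewrite th1 -powRrM -!powRD; try by rewrite pnatr_eq0 implybT.
  by congr powR; field.
pose b := powR 2 (- Q) * powR (1 + th^-1) Q.
have b0 : 0 <= b by rewrite mulr_ge0 ?powR_ge0.
have omq : 0 < 1 - q0 by rewrite subr_gt0.
pose C := powR 2 (tau * Q) + b / (1 - q0).
exists C; first by rewrite addr_ge0 ?powR_ge0// divr_ge0// ltW.
move=> u x0 r d A M mu d1 A0 M0 HM HA h h0 hd.
have /andP[d0 dle1] := d1.
(* Chosen to cover the crude bound for |h| > d/2 and to satisfy q0 K + b A <= K, which makes it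
   invariant under a doubling step. *)
set K := C * (A + M * powR d (- (tau * Q))).
have MP0 : 0 <= M * powR d (- (tau * Q)) by rewrite mulr_ge0 ?powR_ge0.
have K1 : powR 2 (tau * Q) * (M * powR d (- (tau * Q))) <= K.
  rewrite /K /C mulrDl -[leLHS]addr0 lerD//; last by rewrite mulr_ge0 ?addr_ge0 ?divr_ge0// ltW.
  by rewrite ler_wpM2l ?powR_ge0// lerDr.
have K2 : b / (1 - q0) * A <= K.
  rewrite /K /C mulrDl -[leLHS]add0r lerD//; first by rewrite mulr_ge0 ?addr_ge0 ?powR_ge0.
  by rewrite ler_wpM2l ?lerDl// divr_ge0// ltW.
have K0 : 0 <= K by apply: le_trans K1; rewrite mulr_ge0 ?powR_ge0.
have bK : b * A <= (1 - q0) * K.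
  have := ler_wpM2l (ltW omq) K2.
  suff -> : (1 - q0) * (b / (1 - q0) * A) = b * A by [].
  by field; rewrite gt_eqF.
pose om k := I1 (fun x => inb x0 r x * powR `|u (tadd x k) - u x| Q).
(* N bounds the number of doublings that bring |h| into (d/2, d]; the induction is on N. *)
have [N hN] : exists N : nat, d / 2 ^+ N < enorm h.
  exists (Num.bound (d / enorm h)).
  rewrite ltr_pdivrMr ?exprn_gt0// mulrC -ltr_pdivrMr//.
  apply: lt_trans (archi_boundP _) _; first by rewrite divr_ge0 ?(ltW d0)// ltW.
  by rewrite -natrX ltr_nat ltn_expl.
rewrite -/(om h).
elim: N h h0 hd hN => [|N IH] h h0 hd hN.
  by move: hN; rewrite expr0 divr1 ltNge hd.
have [hd2|hd2] := ltP (d / 2) (enorm h).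
  apply: le_trans (HM h hd) _; rewrite lee_fin.
  apply: (@le_trans _ _ (powR 2 (tau * Q) * (M * powR d (- (tau * Q))) * powR (enorm h) (tau * Q))); last first.
    by rewrite ler_wpM2r ?powR_ge0.
  have : powR (d / 2) (tau * Q) <= powR (enorm h) (tau * Q).
    by apply: powR_le; rewrite ?mulr_ge0 ?divr_ge0 ?(ltW d0) ?(ltW Q0)// ltW.
  rewrite powRM ?(ltW d0)// -[2^-1]powR_inv1// -powRrM mulN1r => H.
  apply: (@le_trans _ _ (powR 2 (tau * Q) * (M * powR d (- (tau * Q))) * (powR d (tau * Q) * powR 2 (- (tau * Q))))); last first.
    by rewrite ler_wpM2l// mulr_ge0 ?powR_ge0.
  have -> : powR 2 (tau * Q) * (M * powR d (- (tau * Q))) * (powR d (tau * Q) * powR 2 (- (tau * Q))) = M * (powR 2 (tau * Q) * powR 2 (- (tau * Q))) * (powR d (tau * Q) * powR d (- (tau * Q))) by ring.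
  rewrite -!powRD ?subrr ?powRr0 ?mulr1//; by rewrite ?pnatr_eq0 ?(gt_eqF d0) implybT.
have h2d : enorm (tadd h h) <= d by rewrite enorm_double; lra.
have h20 : 0 < enorm (tadd h h) by rewrite enorm_double mulr_gt0.
have IH2 : (om (tadd h h) <= (K * powR (enorm (tadd h h)) (tau * Q))%:E)%E.
  apply: IH => //; rewrite enorm_double; move: hN.
  by rewrite exprSr invfM mulrA ltr_pdivrMr// [_ * 2]mulrC.
have HA2 := HA h h0 hd.
pose f1 x := inb x0 r x * powR `|u (tadd x (tadd h h)) - u x| Q.
pose f2 x := inb x0 r x *
  powR `|(u (tadd (tadd x h) h) - u (tadd x h)) - (u (tadd x h) - u x)| Q.
have mf1 : measurable_fun setT f1 by rewrite /f1; mt.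
have mf2 : measurable_fun setT f2 by rewrite /f2; mt.
have f10 x : 0 <= f1 x by rewrite mulr_ge0 ?inb_ge0 ?powR_ge0.
have f20 x : 0 <= f2 x by rewrite mulr_ge0 ?inb_ge0 ?powR_ge0.
pose a := powR 2 (- Q) * powR (1 + th) Q.
have a0 : 0 <= a by rewrite mulr_ge0 ?powR_ge0.
have pt x : inb x0 r x * powR `|u (tadd x h) - u x| Q <= a * f1 x + b * f2 x.
  rewrite /f1 /f2 /a /b.
  set s := u (tadd x (tadd h h)) - u x.
  set t := u (tadd (tadd x h) h) - u (tadd x h) - (u (tadd x h) - u x).
  have -> : u (tadd x h) - u x = 2^-1 * (s - t).
    by rewrite /s /t -taddA; field.
  rewrite normrM ger0_norm ?invr_ge0// powRM//.
  have -> : powR 2^-1 Q = powR 2 (- Q) by rewrite -[2^-1]powR_inv1// -powRrM mulN1r.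
  have := abs_split_pow s t (ltW Q0) th0 => /(ler_wpM2l (powR_ge0 2 (- Q))) /(ler_wpM2l (inb_ge0 x0 r x)).
  by move=> H; apply: le_trans H _; rewrite le_eqVlt; apply/orP; left; apply/eqP; ring.
have B1 : (I1 f1 <= (K * powR (enorm (tadd h h)) (tau * Q))%:E)%E by exact: IH2.
have B2 : (I1 f2 <= (A * powR (enorm h) (tau * Q))%:E)%E by exact: HA2.
have aE : powR 2 (tau * Q) * a = q0 by rewrite -q0E /a mulrC.
clearbody f1 f2 a b.
apply: (@le_trans _ _ (I1 (fun x => a * f1 x + b * f2 x)%R)).
  apply: I1_le; [by rewrite /inb; mtac|by mtac|by move=> x; rewrite mulr_ge0 ?inb_ge0 ?powR_ge0|exact: pt].
rewrite I1D; [|by mtac|by mtac|by move=> x; exact: mulr_ge0|by move=> x; exact: mulr_ge0].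
rewrite (I1Z mf1 f10 a0) (I1Z mf2 f20 b0).
apply: (@le_trans _ _ (a%:E * (K * powR (enorm (tadd h h)) (tau * Q))%:E + b%:E * (A * powR (enorm h) (tau * Q))%:E)%E).
  by apply: leeD; [apply: (lee_wpmul2l _ B1)|apply: (lee_wpmul2l _ B2)]; rewrite lee_fin.
rewrite -!EFinM -EFinD lee_fin enorm_double powRM ?enorm_ge0//.
have -> : a * (K * (powR 2 (tau * Q) * powR (enorm h) (tau * Q))) + b * (A * powR (enorm h) (tau * Q)) =
  (q0 * K + b * A) * powR (enorm h) (tau * Q) by rewrite -aE; ring.
by rewrite ler_wpM2r ?powR_ge0//; move: bK; rewrite mulrBl mul1r lerBrDl.
Qed.

(** Compare t with the threshold H^tau: below it t^be is at most H^(tau be), above it the missing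
    power t^(be - m) is at most H^(tau (be - m)). *)
Lemma powR_interp (t H m be tau : R) : 0 <= t -> 0 < H -> 0 <= be -> be <= m ->
  powR t be <= powR t m * powR H (tau * (be - m)) + powR H (tau * be).
Proof.
move=> t0 H0 be0 bem.
have [tH|Ht] := leP t (powR H tau).
  apply: (@le_trans _ _ (powR H (tau * be))).
    by rewrite powRrM; apply: powR_le.
  by rewrite lerDr mulr_ge0 ?powR_ge0.
have t0' : 0 < t by apply: le_lt_trans Ht; exact: powR_ge0.
apply: (@le_trans _ _ (powR t m * powR H (tau * (be - m)))); last first.
  by rewrite lerDl powR_ge0.
have {1}-> : be = m + (be - m) by ring.
rewrite (powRD_ne _ _ (lt0r_neq0 t0')) ler_wpM2l ?powR_ge0//.
rewrite powRrM -[be - m]opprB; apply: powR_ler_neg; [by rewrite subr_ge0|exact: powR_gt0|exact: ltW].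
Qed.

(** The exponent is lowered at an unchanged rate tau; the values below the threshold cost the volume
    of the ball. *)
Lemma I1_interp u x0 r h m be tau K : measurable_fun setT u -> 0 < enorm h ->
  0 <= be -> be <= m -> 0 <= r -> 0 <= K ->
  (I1 (fun x => inb x0 r x * powR `|u (tadd x h) - u x| m)%R <= (K * powR (enorm h) (tau * m))%:E)%E ->
  (I1 (fun x => inb x0 r x * powR `|u (tadd x h) - u x| be)%R <=
     ((K + (2 * r) ^+ n) * powR (enorm h) (tau * be))%:E)%E.
Proof.
move=> mu h0 be0 bem r0 K0 HK.
pose f x := inb x0 r x * powR `|u (tadd x h) - u x| m.
have mf : measurable_fun setT f by rewrite /f; mt.
have f0 x : 0 <= f x by rewrite mulr_ge0 ?inb_ge0 ?powR_ge0.
set H := enorm h in h0 HK *.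
have pt x : inb x0 r x * powR `|u (tadd x h) - u x| be <=
    powR H (tau * (be - m)) * f x + powR H (tau * be) * inb x0 r x.
  have := @powR_interp `|u (tadd x h) - u x| H m be tau (normr_ge0 _) h0 be0 bem.
  move=> /(ler_wpM2l (inb_ge0 x0 r x)) E; apply: le_trans E _.
  by rewrite /f le_eqVlt; apply/orP; left; apply/eqP; ring.
have If : (I1 f <= (K * powR H (tau * m))%:E)%E by exact: HK.
clearbody f.
have minb := @measurable_inb x0 r.
have X0 : 0 <= powR H (tau * (be - m)) by exact: powR_ge0.
have Y0 : 0 <= powR H (tau * be) by exact: powR_ge0.
apply: (@le_trans _ _ (I1 (fun x => powR H (tau * (be - m)) * f x + powR H (tau * be) * inb x0 r x)%R)).
  by apply: I1_le; [rewrite /inb; mtac|mtac|move=> x; rewrite mulr_ge0 ?inb_ge0 ?powR_ge0|exact: pt].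
rewrite I1D; [|by mtac|by mtac|by move=> x; exact: mulr_ge0|
  by move=> x; rewrite mulr_ge0 ?inb_ge0].
rewrite (I1Z mf f0 X0) (I1Z minb (inb_ge0 x0 r) Y0).
apply: (@le_trans _ _ ((powR H (tau * (be - m)))%:E * (K * powR H (tau * m))%:E +
   (powR H (tau * be))%:E * ((2 * r) ^+ n)%:E)%E).
  by apply: leeD; apply: lee_wpmul2l; [rewrite lee_fin|exact: If|rewrite lee_fin|exact: I1_ball].
rewrite -!EFinM -EFinD lee_fin.
have -> : powR H (tau * be) = powR H (tau * (be - m)) * powR H (tau * m).
  by rewrite -powRD_ne ?gt_eqF//; congr powR; ring.
by rewrite le_eqVlt; apply/orP; left; apply/eqP; ring.
Qed.

End Differences.

(** * Error terms created by the cutoff *)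

Section ErrorTerm.
Context {R : realType} {n : nat}.
Hypothesis n0 : (0 < n)%N.
Local Notation V := (n.-tuple R).
Implicit Types (u : V -> R).

Let nR0 : 0 < n%:R :> R. Proof. by rewrite ltr0n. Qed.

(** With e = p - 1 and a = s_p p the last condition says that the tail is at most 1. The bound on
    the ball holds at every point, not only almost everywhere. *)
Definition normalized (x0 : V) (Rad e a : R) u := [/\ measurable_fun setT u,
  (forall x, edist x x0 < Rad -> `|u x| <= 1) &
  (I1 (fun y => ind (Rad <= edist y x0) *
        (powR `|u y| e * powR (edist y x0) (- (n%:R + a))))%R <= (powR Rad (- a))%:E)%E].

Definition diff_bound (m tau : R) (x0 : V) (rho d K : R) u :=
  forall h, 0 < enorm h -> enorm h <= d ->
    (I1 (fun x => inb x0 rho x * powR `|u (tadd x h) - u x| m)%R <=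
      (K * powR (enorm h) (tau * m))%:E)%E.

(** Inside the ball |u| <= 1 and the far kernel suffices; outside, the kernel centered at x is
    compared with the tail kernel centered at x0. [Rm] bounds the radii so that the constant is
    uniform in [Rad]. *)
Lemma far_bound (e a Rm : R) : 0 < e -> 0 < a ->
  exists2 C, 0 <= C & forall u x0 Rad d x, normalized x0 Rad e a u ->
   0 < d <= 1 -> 0 < Rad <= Rm -> edist x x0 < Rad - d ->
   (I1 (fun y => ind (d <= edist x y) *
      (powR `|u x - u y| e * powR (edist x y) (- (n%:R + a))))%R <=
    (C * powR d (- (n%:R + a)))%:E)%E.
Proof.
move=> e0 a0; have [C1 C10 H1] := kernel_far n0 a0.
have na0 : 0 < n%:R + a by rewrite addr_gt0.
exists (powR 2 e * (2 * C1 + powR Rm n%:R)).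
  by rewrite mulr_ge0 ?powR_ge0// addr_ge0 ?powR_ge0// mulr_ge0.
move=> u x0 Rad d x [mu ub ut] d1 /andP[Rad0 RadRm] xR.
have /andP[d0 dle1] := d1.
have xRad : edist x x0 < Rad by apply: lt_le_trans xR _; rewrite gerBl ltW.
pose k y := ind (d <= edist x y) * powR (edist x y) (- (n%:R + a)).
pose T y := ind (Rad <= edist y x0) *
        (powR `|u y| e * powR (edist y x0) (- (n%:R + a))).
have mk : measurable_fun setT k by rewrite /k; mtac.
have mT : measurable_fun setT T by rewrite /T; mtac.
have k0 y : 0 <= k y by rewrite mulr_ge0 ?ind_ge0 ?powR_ge0.
have T0 y : 0 <= T y by rewrite !mulr_ge0 ?ind_ge0 ?powR_ge0.
(* For y outside the ball of radius Rad and x within Rad - d of x0, the triangle inequality gives |x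
   - y| >= (d/Rad) |y - x0|. *)
pose c := powR (d / Rad) (- (n%:R + a)).
have c0 : 0 <= c by exact: powR_ge0.
have two0 : 0 <= powR 2 e :> R by exact: powR_ge0.
have pt y : ind (d <= edist x y) *
      (powR `|u x - u y| e * powR (edist x y) (- (n%:R + a))) <=
    powR 2 e * (2 * k y + c * T y).
  have Q0 : 0 <= powR 2 e * (2 * k y + c * T y) by apply: mulr_ge0 => //; apply: addr_ge0; exact: mulr_ge0.
  move: Q0; rewrite /k /T; case: (leP d (edist x y)) => dxy; last by rewrite !mul0r.
  rewrite !mul1r => _.
  have xy0 : 0 < edist x y by exact: lt_le_trans dxy.
  apply: (@le_trans _ _ (powR 2 e * (1 + powR `|u y| e) * powR (edist x y) (- (n%:R + a)))).
    rewrite ler_wpM2r ?powR_ge0//; apply: le_trans (powR_norm_sub _ _ (ltW e0)) _.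
    rewrite ler_wpM2l// lerD2r powR_le1 ?(ltW e0)// normr_ge0/=; exact: ub.
  rewrite -mulrA ler_wpM2l// [2 * _]mulr_natl mulr2n mulrDl mul1r -addrA lerD2l.
  have [Ry|yR] := leP Rad (edist y x0); last first.
    rewrite mul0r mulr0 addr0 ler_piMl ?powR_ge0//.
    by rewrite powR_le1 ?(ltW e0)// normr_ge0/=; exact: ub.
  rewrite mul1r; apply: (@le_trans _ _ (c * (powR `|u y| e * powR (edist y x0) (- (n%:R + a))))); last first.
    by rewrite lerDr powR_ge0.
  rewrite mulrCA ler_wpM2l ?powR_ge0// /c.
  have y0 : 0 < edist y x0 by exact: lt_le_trans Ry.
  have dR : 0 < d / Rad by rewrite divr_gt0.
  rewrite -powRM ?edist_ge0 ?(ltW dR)//; apply: powR_ler_neg; [exact: ltW|by rewrite mulr_gt0|].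
  rewrite mulrAC ler_pdivrMr//.
  have tri := edist_triangle y x x0; rewrite (edistC y x) in tri.
  have : (Rad - d) * Rad <= (Rad - d) * edist y x0.
    by rewrite ler_wpM2l//; apply: le_trans (ltW xR); exact: edist_ge0.
  have : edist y x0 * Rad <= (edist x y + (Rad - d)) * Rad.
    by rewrite ler_wpM2r ?(ltW Rad0)//; lra.
  by move=> P1 P2; lra.
have Ik : (I1 k <= (C1 * powR d (- (n%:R + a)))%:E)%E.
  rewrite -(I1_shiftl x mk k0) (_ : I1 _ = I1 (fun z : V => ind (d <= enorm z) * powR (enorm z) (- (n%:R + a)))).
    exact: H1.
  by apply: eq_leb_int => z; rewrite /k edist_taddr.
have IT : (I1 T <= (powR Rad (- a))%:E)%E by exact: ut.
clearbody k T.
apply: (@le_trans _ _ (I1 (fun y => powR 2 e * (2 * k y + c * T y))%R)).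
  apply: I1_le; [by mtac|by mtac|by move=> y; rewrite !mulr_ge0 ?ind_ge0 ?powR_ge0|exact: pt].
have m2 : measurable_fun setT (fun y => 2 * k y + c * T y) by mtac.
rewrite (I1Z m2) //; last by move=> y; rewrite addr_ge0 ?mulr_ge0.
rewrite -mulrA [leRHS]EFinM; apply: lee_wpmul2l; first by rewrite lee_fin.
rewrite I1D; [|by mtac|by mtac|by move=> y; rewrite mulr_ge0|by move=> y; rewrite mulr_ge0].
rewrite (I1Z mk k0)// (I1Z mT T0 c0).
apply: (@le_trans _ _ (2%:E * (C1 * powR d (- (n%:R + a)))%:E + c%:E * (powR Rad (- a))%:E)%E).
  by apply: leeD; apply: lee_wpmul2l; rewrite ?lee_fin.
rewrite -!EFinM -EFinD lee_fin [leRHS]mulrDl mulrA lerD2l.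
have Rn : powR Rad n%:R <= powR Rm n%:R by apply: powR_le => //; exact: ltW.
apply: (@le_trans _ _ (powR Rad n%:R * powR d (- (n%:R + a)))); last first.
  by rewrite ler_wpM2r ?powR_ge0.
rewrite /c powRM ?invr_ge0 ?(ltW d0) ?(ltW Rad0)// -mulrA [leRHS]mulrC ler_wpM2l ?powR_ge0//.
rewrite -[Rad^-1]powR_inv1 ?(ltW Rad0)// -powRrM -powRD_ne ?gt_eqF//.
by rewrite le_eqVlt; apply/orP; left; apply/eqP; congr powR; ring.
Qed.

(** A mixed product of differences by h and by z is bounded using the same [diff_bound] for both.
    The translation by w lets one statement serve u and its translate by h. *)
Lemma near_inner (e la m tau : R) : 0 < e -> 1 < la -> e < la * m -> 0 <= tau ->
  exists2 C, 0 <= C & forall u x0 rho d K h z w, measurable_fun setT u ->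
   (forall x, edist x x0 < rho + d + d -> `|u x| <= 1) -> 0 <= K ->
   diff_bound m tau x0 (rho + d) d K u ->
   0 < enorm h -> enorm h <= d -> 0 < enorm z -> enorm z <= d -> enorm w <= d ->
   (I1 (fun x => inb x0 rho x * powR `|u (tadd x h) - u x| (m - e / la)
        * powR `|u (tadd x w) - u (tadd (tadd x w) z)| e)%R <=
     (C * K * powR (enorm h) (tau * (m - e / la)) * powR (enorm z) (tau * (e / la)))%:E)%E.
Proof.
move=> e0 la1 elm tau0.
have la0 : 0 < la by exact: lt_trans la1.
have m0 : 0 < m by have := lt_trans e0 elm; rewrite pmulr_rgt0.
exists (powR 2 (la * m - m) + 1); first by rewrite addr_ge0 ?powR_ge0.
move=> u x0 rho d K h z w mu ub K0 HD h0 hd z0 zd wd.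
have d0 : 0 <= d by exact: le_trans (ltW h0) hd.
set be := m - e / la.
have be0 : 0 < be by rewrite subr_gt0 ltr_pdivrMr// mulrC.
(* These exponents are conjugate exactly because be = m - e/la. They raise the difference by h to
   the power m and the difference by z to la m. *)
pose l := m / be; pose l' := la * m / e.
have l0 : 1 < l by rewrite /l ltr_pdivlMr// mul1r gtrBl divr_gt0.
have l'0 : 0 < l' by rewrite divr_gt0// mulr_gt0.
have ll : l'^-1 + l^-1 = 1.
  by rewrite /l /l' /be; field; rewrite !gt_eqF//= subr_gt0// mulrC.
pose H := enorm h; pose Z := enorm z.
(* Balances the two terms of Young's inequality: each becomes a multiple of K H^(tau be) Z^(tau
   e/la). *)
pose th := powR (H / Z) (tau * be / l').
have HZ0 : 0 < H / Z by rewrite divr_gt0.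
have th0 : 0 < th by exact: powR_gt0.
pose T1 := powR th l'; pose T2 := powR th (- l).
have T10 : 0 <= T1 by exact: powR_ge0.
have T20 : 0 <= T2 by exact: powR_ge0.
have T1E : T1 = powR H (tau * be) * powR Z (- (tau * be)).
  rewrite /T1 /th -powRrM powRM ?invr_ge0 ?enorm_ge0// -[Z^-1]powR_inv1 ?enorm_ge0// -powRrM.
  by congr (powR _ _ * powR _ _); field; rewrite gt_eqF.
have T2E : T2 = powR H (- (tau * (e / la))) * powR Z (tau * (e / la)).
  rewrite /T2 /th -powRrM powRM ?invr_ge0 ?enorm_ge0// -[Z^-1]powR_inv1 ?enorm_ge0// -powRrM.
  by congr (powR _ _ * powR _ _); rewrite /l /l'; field; rewrite !gt_eqF.
pose f1 x := inb x0 (rho + d) (tadd x w) * powR `|u (tadd (tadd x w) z) - u (tadd x w)| m.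
pose f2 x := inb x0 (rho + d) x * powR `|u (tadd x h) - u x| m.
have mf1 : measurable_fun setT f1 by rewrite /f1 /inb; mtac.
have mf2 : measurable_fun setT f2 by rewrite /f2 /inb; mtac.
have f10 x : 0 <= f1 x by rewrite mulr_ge0 ?inb_ge0 ?powR_ge0.
have f20 x : 0 <= f2 x by rewrite mulr_ge0 ?inb_ge0 ?powR_ge0.
set c1 := powR 2 (la * m - m).
have c10 : 0 <= c1 by exact: powR_ge0.
have pt x : inb x0 rho x * powR `|u (tadd x h) - u x| be
        * powR `|u (tadd x w) - u (tadd (tadd x w) z)| e <=
    (c1 * T1) * f1 x + T2 * f2 x.
  have Q0 : 0 <= (c1 * T1) * f1 x + T2 * f2 x.
    exact: (addr_ge0 (mulr_ge0 (mulr_ge0 c10 T10) (f10 x)) (mulr_ge0 T20 (f20 x))).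
  move: Q0; rewrite /f1 /f2 /inb.
  have [xr|_] := ltP (edist x x0) rho; last by rewrite !mul0r.
  have xw := eball_tadd xr wd.
  have xwz := eball_tadd xw zd.
  have xrd : edist x x0 < rho + d by apply: lt_le_trans xr _; rewrite lerDl.
  rewrite xrd xw !mul1r => _.
  set s := `|u (tadd x w) - u (tadd (tadd x w) z)|.
  have -> : `|u (tadd (tadd x w) z) - u (tadd x w)| = s by exact: distrC.
  set t := `|u (tadd x h) - u x|.
  have s0 : 0 <= s by exact: normr_ge0.
  have t0 : 0 <= t by exact: normr_ge0.
  have s2 : s <= 2.
    rewrite /s; apply: le_trans (ler_normB _ _) _.
    have xw' : edist (tadd x w) x0 < rho + d + d by apply: lt_le_trans xw _; rewrite lerDl.
    have -> : (2 : R) = 1 + 1 by ring.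
    by apply: lerD; exact: ub.
  rewrite mulrC.
  have Y := young_weight (powR_ge0 s e) (powR_ge0 t be) th0 l0 ll l'0.
  apply: le_trans Y _; rewrite -/T1 -/T2 -!powRrM.
  have -> : e * l' = la * m by rewrite /l'; field; rewrite gt_eqF.
  have -> : be * l = m by rewrite /l; field; rewrite gt_eqF.
  rewrite [powR t m * _]mulrC lerD2r [_ * T1]mulrC -[c1 * T1]mulrC -mulrA ler_wpM2l//.
  have [s00|sn0] := eqVneq s 0.
    by rewrite s00 powR0 ?gt_eqF ?mulr_gt0// mulr_ge0 ?powR_ge0.
  (* The surplus power la m - m is absorbed by |s| <= 2, that is, by the boundedness of u. *)
  have -> : la * m = (la * m - m) + m by ring.
  rewrite (powRD_ne _ _ sn0) ler_wpM2r ?powR_ge0//.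
  by apply: powR_le => //; rewrite subr_ge0 ler_peMl// ltW.
have I1f1 : (I1 f1 <= (K * powR Z (tau * m))%:E)%E.
  apply: le_trans (HD z z0 zd).
  pose g x := inb x0 (rho + d) x * powR `|u (tadd x z) - u x| m.
  have mg : measurable_fun setT g by rewrite /g /inb; mtac.
  have g0 x : 0 <= g x by rewrite mulr_ge0 ?inb_ge0 ?powR_ge0.
  by rewrite -(I1_shift w mg g0).
have I1f2 : (I1 f2 <= (K * powR H (tau * m))%:E)%E by exact: HD.
clearbody f1 f2 T1 T2.
have cT : 0 <= c1 * T1 by exact: mulr_ge0.
apply: (@le_trans _ _ (I1 (fun x => (c1 * T1) * f1 x + T2 * f2 x)%R)).
  apply: I1_le; [by rewrite /inb; mtac|by mtac| |exact: pt].
  by move=> x; rewrite !mulr_ge0 ?inb_ge0 ?powR_ge0.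
rewrite I1D; [|by mtac|by mtac|by move=> y; exact: mulr_ge0|by move=> y; exact: mulr_ge0].
rewrite (I1Z mf1 f10 cT) (I1Z mf2 f20 T20).
apply: (@le_trans _ _ ((c1 * T1)%:E * (K * powR Z (tau * m))%:E + T2%:E * (K * powR H (tau * m))%:E)%E).
  by apply: leeD; apply: lee_wpmul2l; [rewrite lee_fin|exact: I1f1|rewrite lee_fin|exact: I1f2].
rewrite -!EFinM -EFinD lee_fin T1E T2E.
have nZ : Z != 0 by rewrite gt_eqF.
have nH : H != 0 by rewrite gt_eqF.
have -> : powR Z (tau * m) = powR Z (tau * be) * powR Z (tau * (e / la)).
  by rewrite -powRD_ne//; congr powR; rewrite /be; ring.
have -> : powR H (tau * m) = powR H (tau * be) * powR H (tau * (e / la)).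
  by rewrite -powRD_ne//; congr powR; rewrite /be; ring.
have EZ : powR Z (- (tau * be)) * powR Z (tau * be) = 1.
  by rewrite -powRD_ne// addNr powRr0.
have EH : powR H (- (tau * (e / la))) * powR H (tau * (e / la)) = 1.
  by rewrite -powRD_ne// addNr powRr0.
rewrite -/H -/Z; move: EZ EH.
move: (powR Z (- (tau * be))) (powR Z (tau * be)) (powR Z (tau * (e / la))) => z1 z2 z3.
move: (powR H (- (tau * (e / la)))) (powR H (tau * be)) (powR H (tau * (e / la))) => h1 h2 h3 EZ EH.
have -> : c1 * (h2 * z1) * (K * (z2 * z3)) + h1 * z3 * (K * (h2 * h3)) =
  c1 * K * h2 * z3 * (z1 * z2) + K * h2 * z3 * (h1 * h3) by clear; ring.
by rewrite EZ EH le_eqVlt; apply/orP; left; apply/eqP; ring.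
Qed.

Lemma diff_bound_le m tau x0 rho rho' d d' K K' u : measurable_fun setT u ->
  rho' <= rho -> d' <= d -> K <= K' ->
  diff_bound m tau x0 rho d K u -> diff_bound m tau x0 rho' d' K' u.
Proof.
move=> mu rr dd KK H h h0 hd.
apply: (@le_trans _ _ (K * powR (enorm h) (tau * m))%:E); last first.
  by rewrite lee_fin ler_wpM2r ?powR_ge0.
apply: le_trans (H h h0 (le_trans hd dd)).
apply: I1_le; [by rewrite /inb; mtac|by rewrite /inb; mtac| |].
  by move=> x; rewrite mulr_ge0 ?inb_ge0 ?powR_ge0.
move=> x; rewrite ler_wpM2r ?powR_ge0// /inb.
by case: (ltP (edist x x0) rho') => [/lt_le_trans -> //|_]; exact: ind_ge0.
Qed.

Lemma weight_bound u x0 rho h m be tau d K : measurable_fun setT u ->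
  0 < enorm h -> enorm h <= d -> 0 <= be -> be <= m -> 0 <= rho -> 0 <= K ->
  diff_bound m tau x0 rho d K u ->
  (I1 (fun x => inb x0 rho x * powR `|u (tadd x h) - u x| be)%R <=
     ((K + (2 * rho) ^+ n) * powR (enorm h) (tau * be))%:E)%E.
Proof. by move=> mu h0 hd be0 bem r0 K0 H; apply: (I1_interp (m := m)) => //; exact: H. Qed.

Lemma measurable_polar (F : V -> V -> R) : mf2 F -> mf2 (fun x z => F x (tadd x z)).
Proof. by move=> mF; mtac. Qed.

Lemma measurable_polarC (F : V -> V -> R) : mf2 F -> mf2 (fun z x => F x (tadd x z)).
Proof. by move=> mF; mtac. Qed.

(** Close to the diagonal the cutoff contributes |z|/d and the mixed differences contribute |z|^(tau
    e/la); against |z|^-(n+a) this is integrable exactly when 1 - a + tau e/la > 0. Far from the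
    diagonal the tail estimate applies. *)
Lemma gradient_error (e a la m tau Rm : R) : 0 < e -> 0 < a -> 1 < la -> e < la * m ->
  0 <= tau -> 0 < 1 - a + tau * (e / la) ->
  exists2 C, 0 <= C & forall u x0 Rad rho d K (h w : V), normalized x0 Rad e a u ->
   0 < d <= 1 -> 0 <= rho -> rho + d + d <= Rad -> Rad <= Rm -> 0 <= K ->
   diff_bound m tau x0 (rho + d) d K u ->
   0 < enorm h -> enorm h <= d -> enorm w <= d ->
   (I2 (fun x y => inb x0 rho x * powR `|u (tadd x h) - u x| (m - e / la) *
     (Num.min 1 (edist x y / d) *
       (powR `|u (tadd x w) - u (tadd y w)| e * powR (edist x y) (- (n%:R + a)))))%R <=
     (C * powR d (- (n%:R + a + 1)) * (K + 1) * powR (enorm h) (tau * (m - e / la)))%:E)%E.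
Proof.
move=> e0 a0 la1 elm tau0 eps0.
have la0 : 0 < la by exact: lt_trans la1.
set be := m - e / la.
have be0 : 0 < be by rewrite subr_gt0 ltr_pdivrMr// mulrC.
have bem : be <= m by rewrite gerBl divr_ge0// ltW.
set eps := 1 - a + tau * (e / la).
have [C1 C10 H1] := kernel_near n0 eps0.
have [C2 C20 H2] := near_inner e0 la1 elm tau0.
have [C3 C30 H3] := far_bound Rm e0 a0.
have Rn0 : 0 <= (2 * `|Rm|) ^+ n by rewrite exprn_ge0// mulr_ge0.
exists (C2 * C1 + C3 * (1 + (2 * `|Rm|) ^+ n)).
  by rewrite addr_ge0 ?mulr_ge0// addr_ge0.
move=> u x0 Rad rho d K h w nu d1 r0 rR RRm K0 HD h0 hd wd.
have [mu ub ut] := nu; have /andP[d0 dle1] := d1.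
have Rad0 : 0 < Rad by apply: lt_le_trans rR; rewrite -addrA ltr_wpDl// addr_gt0.
have Rm0 : 0 < Rm by exact: lt_le_trans RRm.
pose f x := inb x0 rho x * powR `|u (tadd x h) - u x| be.
pose N x y := ind (edist x y < d) * (edist x y / d) *
   (powR `|u (tadd x w) - u (tadd y w)| e * powR (edist x y) (- (n%:R + a))).
pose F x y := ind (d <= edist x y) *
   (powR `|u (tadd x w) - u (tadd y w)| e * powR (edist x y) (- (n%:R + a))).
have mf : measurable_fun setT f by rewrite /f /inb; mtac.
have mN : mf2 N by rewrite /N; mtac.
have mF : mf2 F by rewrite /F; mtac.
have f0 x : 0 <= f x by rewrite mulr_ge0 ?inb_ge0 ?powR_ge0.
have dV0 : 0 <= d^-1 by rewrite invr_ge0 ltW.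
have N0 x y : 0 <= N x y.
  by apply: mulr_ge0; apply: mulr_ge0; rewrite ?ind_ge0 ?powR_ge0// divr_ge0 ?edist_ge0// ltW.
have F0 x y : 0 <= F x y by apply: mulr_ge0; rewrite ?ind_ge0// mulr_ge0 ?powR_ge0.
have pt x y : f x * (Num.min 1 (edist x y / d) *
   (powR `|u (tadd x w) - u (tadd y w)| e * powR (edist x y) (- (n%:R + a)))) <=
   f x * N x y + f x * F x y.
  rewrite -mulrDr ler_wpM2l// /N /F.
  case: (ltP (edist x y) d) => [xyd|dxy].
    rewrite mul0r addr0 mul1r ler_wpM2r ?mulr_ge0 ?powR_ge0//.
    by rewrite ge_min lexx orbT.
  by rewrite !mul0r add0r ler_wpM2r ?mulr_ge0 ?powR_ge0// ge_min lexx.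
have Hf : (I1 f <= ((K + (2 * `|Rm|) ^+ n) * powR (enorm h) (tau * be))%:E)%E.
  have HD' : diff_bound m tau x0 rho d K u.
    by apply: diff_bound_le HD => //; rewrite lerDl ltW.
  apply: le_trans (weight_bound mu h0 hd (ltW be0) bem r0 K0 HD') _.
  rewrite lee_fin ler_wpM2r ?powR_ge0// lerD2l lerXn2r ?nnegrE ?mulr_ge0//.
  rewrite ler_wpM2l// (ger0_norm (ltW Rm0)); apply: le_trans RRm.
  by apply: le_trans rR; rewrite -addrA lerDl addr_ge0// ltW.
have HF x : f x != 0 -> (I1 (F x) <= (C3 * powR d (- (n%:R + a)))%:E)%E.
  move=> fx; have xr : edist x x0 < rho.
    by move: fx; rewrite /f /inb; case: ltP => // _; rewrite mul0r eqxx.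
  have xw := eball_tadd xr wd.
  have xR : edist (tadd x w) x0 < Rad - d by apply: lt_le_trans xw _; rewrite lerBrDr.
  have RR : 0 < Rad <= Rm by rewrite Rad0.
  pose G y := ind (d <= edist (tadd x w) y) * (powR `|u (tadd x w) - u y| e *
      powR (edist (tadd x w) y) (- (n%:R + a))).
  have mG : measurable_fun setT G by rewrite /G; mtac.
  have G0 y : 0 <= G y by apply: mulr_ge0; rewrite ?ind_ge0// mulr_ge0 ?powR_ge0.
  have -> : I1 (F x) = I1 G.
    by rewrite -(I1_shift w mG G0); apply: eq_leb_int => y; rewrite /F /G edist_tadd.
  exact: (H3 u x0 Rad d (tadd x w) nu d1 RR xR).
have HN : (I2 (fun x y => f x * N x y)%R <=
    (d^-1 * (C2 * K * powR (enorm h) (tau * be)) * C1)%:E)%E.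
  pose P x y := f x * N x y.
  have mP : mf2 P by rewrite /P; mtac.
  have P0 x y : 0 <= P x y by exact: mulr_ge0.
  rewrite -/(I2 P) -(I2_polar mP P0).
  have mP' := measurable_polar mP.
  rewrite I2C; [|exact: mP'|by move=> x z; exact: P0].
  set c := d^-1 * (C2 * K * powR (enorm h) (tau * be)).
  have c0 : 0 <= c by rewrite !mulr_ge0 ?powR_ge0.
  pose g (z : V) := ind (enorm z < 1) * powR (enorm z) (eps - n%:R).
  have mg : measurable_fun setT g by rewrite /g; mtac.
  have g0 z : 0 <= g z by rewrite mulr_ge0 ?ind_ge0 ?powR_ge0.
  have mP2 := measurable_polarC mP.
  apply: (@le_trans _ _ (I1 (fun z => c * g z)%R)); last first.
    rewrite (I1Z mg g0 c0) (EFinM c C1); apply: lee_wpmul2l; [by rewrite lee_fin|exact: H1].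
  apply: I2_le_I1; [exact: mP2|by mtac|by move=> z x; exact: P0|by move=> z; exact: mulr_ge0|].
  move=> z.
  have [zd|zd] := ltP (enorm z) d; last first.
    rewrite (_ : I1 _ = I1 (fun x : V => 0 * f x)%R).
      by rewrite (I1Z mf f0)// mul0e lee_fin mulr_ge0.
    apply: eq_leb_int => x; rewrite /P /N edist_taddr.
    by rewrite ltNge zd/= !mul0r mulr0.
  have [z00|zn0] := eqVneq (enorm z) 0.
    rewrite (_ : I1 _ = I1 (fun x : V => 0 * f x)%R).
      by rewrite (I1Z mf f0)// mul0e lee_fin mulr_ge0.
    by apply: eq_leb_int => x; rewrite /P /N edist_taddr z00 mul0r !(mulr0,mul0r).
  have z0 : 0 < enorm z by rewrite lt_neqAle eq_sym zn0 enorm_ge0.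
  have ub' x : edist x x0 < rho + d + d -> `|u x| <= 1.
    by move=> xr; apply: ub; exact: lt_le_trans rR.
  have B := H2 u x0 rho d K h z w mu ub' K0 HD h0 hd z0 (ltW zd) wd.
  pose q x := inb x0 rho x * powR `|u (tadd x h) - u x| be *
     powR `|u (tadd x w) - u (tadd (tadd x w) z)| e.
  have mq : measurable_fun setT q by rewrite /q /inb; mtac.
  have q0 x : 0 <= q x by rewrite !mulr_ge0 ?inb_ge0 ?powR_ge0.
  set cz := enorm z / d * powR (enorm z) (- (n%:R + a)).
  have cz0 : 0 <= cz by rewrite !mulr_ge0 ?powR_ge0 ?enorm_ge0.
  rewrite (_ : I1 _ = I1 (fun x => cz * q x)%R); last first.
    apply: eq_leb_int => x; congr EFin.
    rewrite /P /N /q /f edist_taddr zd mul1r (taddAC x z w) /cz; ring.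
  rewrite (I1Z mq q0 cz0); apply: (@le_trans _ _ (cz%:E * (C2 * K * powR (enorm h) (tau * be) * powR (enorm z) (tau * (e / la)))%:E)%E).
    by apply: lee_wpmul2l; rewrite ?lee_fin//; exact: B.
  rewrite -EFinM lee_fin /cz /c /g (lt_le_trans zd dle1) mul1r.
  have -> : powR (enorm z) (eps - n%:R) =
      powR (enorm z) 1 * powR (enorm z) (- (n%:R + a)) * powR (enorm z) (tau * (e / la)).
    by rewrite -(powRD_ne _ _ zn0) -(powRD_ne _ _ zn0); congr powR; rewrite /eps; ring.
  rewrite (powRr1 (enorm_ge0 z)).
  move: (d^-1) (enorm z) (powR (enorm h) (tau * be)) (powR (enorm z) (- (n%:R + a))) (powR (enorm z) (tau * (e / la))).
  by move=> dv zz hh z1 z2; clear; rewrite le_eqVlt; apply/orP; left; apply/eqP; ring.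
rewrite (_ : I2 _ = I2 (fun x y => f x * (Num.min 1 (edist x y / d) *
       (powR `|u (tadd x w) - u (tadd y w)| e * powR (edist x y) (- (n%:R + a))))))//.
clearbody f N F.
have mfN : mf2 (fun x y => f x * N x y) by mtac.
have mfF : mf2 (fun x y => f x * F x y) by mtac.
have fN0 x y : 0 <= f x * N x y by exact: mulr_ge0.
have fF0 x y : 0 <= f x * F x y by exact: mulr_ge0.
have HFF := I2_mul_le mf mF f0 F0 (mulr_ge0 C30 (powR_ge0 d (- (n%:R + a)))) HF.
apply: (@le_trans _ _ (I2 (fun x y => f x * N x y + f x * F x y)%R)).
  apply: I2_le; [by mtac|by mtac| |exact: pt].
  move=> x y; rewrite !mulr_ge0 ?powR_ge0// le_min ler01/= mulr_ge0 ?edist_ge0//.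
rewrite (I2D mfN mfF fN0 fF0).
apply: le_trans (leeD HN HFF) _.
apply: (@le_trans _ _ ((d^-1 * (C2 * K * powR (enorm h) (tau * be)) * C1)%:E +
  (C3 * powR d (- (n%:R + a)))%:E * ((K + (2 * `|Rm|) ^+ n) * powR (enorm h) (tau * be))%:E)%E).
  apply: leeD2l; apply: lee_wpmul2l; last exact: Hf.
  by rewrite lee_fin mulr_ge0 ?powR_ge0.
rewrite -EFinM -EFinD lee_fin.
set D := powR d (- (n%:R + a + 1)); set X := powR (enorm h) (tau * be).
have X0 : 0 <= X by exact: powR_ge0.
have D1 : d^-1 <= D.
  rewrite -[leLHS](@powR_inv1 R d) ?(ltW d0)//; apply: le_powR_d => //.
  by rewrite lerDr addr_ge0// ltW.
have D2 : powR d (- (n%:R + a)) <= D by apply: le_powR_d => //; rewrite lerDl.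
have D0 : 0 <= D by exact: powR_ge0.
move: D1 D2 Rn0; move: (powR d _) (d^-1) ((2 * `|Rm|) ^+ n) dV0 => D' dV rn dV0 D1 D2 Rn0.
apply: (@le_trans _ _ (D * (C2 * K * X) * C1 + C3 * D * ((K + rn) * X))).
  apply: lerD; first by rewrite !ler_wpM2r// !mulr_ge0.
  by rewrite ler_wpM2r ?mulr_ge0 ?addr_ge0// ler_wpM2l.
rewrite -subr_ge0.
have -> : (C2 * C1 + C3 * (1 + rn)) * D * (K + 1) * X - (D * (C2 * K * X) * C1 + C3 * D * ((K + rn) * X)) =
  D * X * (C2 * C1 + C3 * (K * rn + 1)) by ring.
by rewrite !mulr_ge0// addr_ge0 ?mulr_ge0// addr_ge0 ?mulr_ge0.
Qed.

End ErrorTerm.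

(** * Signed double integrals *)

Section Signed.
Context {R : realType} {n : nat}.
Local Notation V := (n.-tuple R).
Implicit Types (f g F : V -> V -> R).

Definition abs_int2 g : \bar R := I2 (fun x y => `|g x y|).
(** Since [fine] sends an infinite integral to 0, this is the integral of [g] only when [abs_int2 g]
    is finite; finiteness therefore accompanies every use of it. *)
Definition S2 g : R := fine (I2 (fun x y => Num.max (g x y) 0)) -
  fine (I2 (fun x y => Num.max (- g x y) 0)).

Lemma max0_ge0 (t : R) : 0 <= Num.max t 0. Proof. by rewrite le_max lexx orbT. Qed.

Lemma mf2_pos g : mf2 g -> mf2 (fun x y => Num.max (g x y) 0).
Proof. by move=> mg; mtac. Qed.
Lemma mf2_neg g : mf2 g -> mf2 (fun x y => Num.max (- g x y) 0).
Proof. by move=> mg; mtac. Qed.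
Lemma mf2_opp g : mf2 g -> mf2 (fun x y => - g x y).
Proof. by move=> mg; mtac. Qed.
Lemma mf2_add f g : mf2 f -> mf2 g -> mf2 (fun x y => f x y + g x y).
Proof. by move=> mf mg; mtac. Qed.
Lemma mf2_abs g : mf2 g -> mf2 (fun x y => `|g x y|).
Proof. by move=> mg; mtac. Qed.
Lemma mf2_shift g h : mf2 g -> mf2 (fun x y => g (tadd x h) (tadd y h)).
Proof. by move=> mg; mtac. Qed.

Lemma mf2_swap g : mf2 g -> mf2 (fun x y => g y x).
Proof. by move=> mg; mtac. Qed.

Lemma pos_le_abs g : mf2 g -> (I2 (fun x y => Num.max (g x y) 0)%R <= abs_int2 g)%E.
Proof.
move=> mg; apply: I2_le; [exact: mf2_pos|exact: mf2_abs|by move=> x y; exact: max0_ge0|].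
by move=> x y; rewrite ge_max normr_ge0 ler_norm.
Qed.

Lemma neg_le_abs g : mf2 g -> (I2 (fun x y => Num.max (- g x y) 0)%R <= abs_int2 g)%E.
Proof.
move=> mg; apply: I2_le; [exact: mf2_neg|exact: mf2_abs|by move=> x y; exact: max0_ge0|].
by move=> x y; rewrite ge_max normr_ge0 -normrN ler_norm.
Qed.

Lemma pos_fin g : mf2 g -> (abs_int2 g < +oo)%E ->
  I2 (fun x y => Num.max (g x y) 0) \is a fin_num.
Proof.
move=> mg H; rewrite ge0_fin_numE; first exact: le_lt_trans (pos_le_abs mg) H.
by apply: I2_ge0 => x y; exact: max0_ge0.
Qed.

Lemma neg_fin g : mf2 g -> (abs_int2 g < +oo)%E ->
  I2 (fun x y => Num.max (- g x y) 0) \is a fin_num.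
Proof.
move=> mg H; rewrite ge0_fin_numE; first exact: le_lt_trans (neg_le_abs mg) H.
by apply: I2_ge0 => x y; exact: max0_ge0.
Qed.

Lemma abs_int2D f g : mf2 f -> mf2 g -> (abs_int2 f < +oo)%E -> (abs_int2 g < +oo)%E ->
  (abs_int2 (fun x y => f x y + g x y)%R < +oo)%E.
Proof.
move=> mf mg ff gf.
apply: (@le_lt_trans _ _ (I2 (fun x y => `|f x y| + `|g x y|)%R)).
  apply: I2_le; [exact: (mf2_abs (mf2_add mf mg))|exact: mf2_add (mf2_abs mf) (mf2_abs mg)|by []|].
  by move=> x y; exact: ler_normD.
by rewrite (I2D (mf2_abs mf) (mf2_abs mg))// lte_add_pinfty.
Qed.

Lemma abs_int2N g : abs_int2 (fun x y => - g x y) = abs_int2 g.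
Proof.
by apply: eq_leb_int => x; apply: eq_leb_int => y; rewrite normrN.
Qed.

Lemma abs_int2_shift h g : mf2 g ->
  abs_int2 (fun x y => g (tadd x h) (tadd y h)) = abs_int2 g.
Proof. by move=> mg; exact: (I2_shift h (mf2_abs mg)). Qed.

Lemma S2N g : S2 (fun x y => - g x y) = - S2 g.
Proof.
rewrite /S2 opprB; congr (_ - fine _).
by apply: eq_leb_int => x; apply: eq_leb_int => y; rewrite opprK.
Qed.

Lemma S2_shift h g : mf2 g -> S2 (fun x y => g (tadd x h) (tadd y h)) = S2 g.
Proof.
move=> mg; rewrite /S2; congr (fine _ - fine _).
  by apply: (I2_shift h (mf2_pos mg)) => x y; exact: max0_ge0.
by apply: (I2_shift h (mf2_neg mg)) => x y; exact: max0_ge0.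
Qed.

Lemma max_decomp (t : R) : t = Num.max t 0 - Num.max (- t) 0.
Proof.
have [t0|/ltW t0] := leP t 0.
  by rewrite max_l ?oppr_ge0// sub0r opprK.
by rewrite max_r ?oppr_le0// subr0.
Qed.

Lemma S2D f g : mf2 f -> mf2 g -> (abs_int2 f < +oo)%E -> (abs_int2 g < +oo)%E ->
  S2 (fun x y => f x y + g x y) = S2 f + S2 g.
Proof.
move=> mf mg ff gf; have mfg := mf2_add mf mg; have fgf := abs_int2D mf mg ff gf.
have fp := pos_fin mf ff; have fn := neg_fin mf ff.
have gp := pos_fin mg gf; have gn := neg_fin mg gf.
have sp := pos_fin mfg fgf; have sn := neg_fin mfg fgf.
have p0 k x y : 0 <= Num.max (k x y : R) 0 := max0_ge0 (k x y).
(* Positive and negative parts are arranged so that both sides are sums of nonnegative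
   integrands. *)
have E : (I2 (fun x y => Num.max (f x y + g x y) 0)%R +
          (I2 (fun x y => Num.max (- f x y) 0)%R + I2 (fun x y => Num.max (- g x y) 0)%R) =
         I2 (fun x y => Num.max (- (f x y + g x y)) 0)%R +
          (I2 (fun x y => Num.max (f x y) 0)%R + I2 (fun x y => Num.max (g x y) 0)%R))%E.
  have A0 x y : 0 <= Num.max (- f x y) 0 + Num.max (- g x y) 0 by rewrite addr_ge0 ?max0_ge0.
  have B0 x y : 0 <= Num.max (f x y) 0 + Num.max (g x y) 0 by rewrite addr_ge0 ?max0_ge0.
  have mA := mf2_add (mf2_neg mf) (mf2_neg mg).
  have mB := mf2_add (mf2_pos mf) (mf2_pos mg).
  rewrite -(I2D (mf2_neg mf) (mf2_neg mg)); [|by move=> x y; exact: max0_ge0|by move=> x y; exact: max0_ge0].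
  rewrite -(I2D (mf2_pos mf) (mf2_pos mg)); [|by move=> x y; exact: max0_ge0|by move=> x y; exact: max0_ge0].
  rewrite -(I2D (mf2_pos mfg) mA (fun x y => max0_ge0 _) A0).
  rewrite -(I2D (mf2_neg mfg) mB (fun x y => max0_ge0 _) B0).
  apply: eq_leb_int => x; apply: eq_leb_int => y; congr EFin.
  have := max_decomp (f x y); have := max_decomp (g x y); have := max_decomp (f x y + g x y).
  lra.
move: E; rewrite /S2 -(fineK fp) -(fineK fn) -(fineK gp) -(fineK gn) -(fineK sp) -(fineK sn).
by rewrite -!EFinD => -[]; rewrite /=; lra.
Qed.

(** Integrate c + F^- <= e + F^+ and cancel the equal finite integrals of F^- and F^+. Thus c and e
    may have infinite integrals, and the energy need not be known to be finite beforehand. *)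
Lemma S2_lower F (c e : V -> V -> R) : mf2 F -> mf2 c -> mf2 e ->
  (forall x y, 0 <= c x y) -> (forall x y, 0 <= e x y) ->
  (abs_int2 F < +oo)%E -> S2 F = 0 ->
  (forall x y, c x y - e x y <= F x y) -> (I2 c <= I2 e)%E.
Proof.
move=> mF mc me c0 e0 Ff SF H.
have Fp := pos_fin mF Ff; have Fn := neg_fin mF Ff.
have m0 k x y : 0 <= Num.max (k x y : R) 0 := max0_ge0 (k x y).
have E : I2 (fun x y => Num.max (F x y) 0) = I2 (fun x y => Num.max (- F x y) 0).
  by rewrite -(fineK Fp) -(fineK Fn); congr EFin; apply/eqP; rewrite -subr_eq0; apply/eqP.
rewrite -(leeD2rE _ _ Fn) -{2}E.
rewrite -(I2D mc (mf2_neg mF) c0); last by move=> x y; exact: max0_ge0.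
rewrite -(I2D me (mf2_pos mF) e0); last by move=> x y; exact: max0_ge0.
apply: I2_le.
- exact: mf2_add mc (mf2_neg mF).
- exact: mf2_add me (mf2_pos mF).
- by move=> x y; rewrite addr_ge0// max0_ge0.
- by move=> x y; have := H x y; have := max_decomp (F x y); lra.
Qed.

End Signed.

(** * Admissibility of the test functions *)

Section Admissible.
Context {R : realType} {n : nat}.
Hypothesis n0 : (0 < n)%N.
Local Notation V := (n.-tuple R).

Definition Wfin (s q : R) (phi : V -> R) :=
  (I1 (fun x => powR `|phi x| q) < +oo)%E /\
  (I2 (fun x y => powR `|phi x - phi y| q * powR (edist x y) (- (n%:R + s * q)))%R < +oo)%E.

Lemma Wfin_shift s q phi h : measurable_fun setT phi -> Wfin s q phi ->
  Wfin s q (fun x => phi (tadd x h)).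
Proof.
move=> mphi [H1 H2]; split.
  have m1 : measurable_fun setT (fun x : V => powR `|phi x| q) by mtac.
  by rewrite (I1_shift h m1)// => x; exact: powR_ge0.
pose F x y := powR `|phi x - phi y| q * powR (edist x y) (- (n%:R + s * q)).
have mF : mf2 F by rewrite /F; mtac.
have F0 x y : 0 <= F x y by rewrite mulr_ge0 ?powR_ge0.
have -> : I2 (fun x y => powR `|phi (tadd x h) - phi (tadd y h)| q *
    powR (edist x y) (- (n%:R + s * q))) = I2 F.
  rewrite -(I2_shift h mF F0).
  by apply: eq_leb_int => x; apply: eq_leb_int => y; rewrite /F edist_tadd.
exact: H2.
Qed.

Lemma powR_add3 (q a b c : R) : 0 <= q -> 0 <= a -> 0 <= b -> 0 <= c ->
  powR (a + b + c) q <= powR 2 q * powR 2 q * (powR a q + powR b q + powR c q).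
Proof.
move=> q0 a0 b0 c0.
have two1 : 1 <= powR 2 q :> R by apply: powR_ge1; rewrite ?ler1n.
apply: le_trans (powR_add_le q0 (addr_ge0 a0 b0) c0) _.
rewrite -mulrA ler_wpM2l ?powR_ge0// mulrDr; apply: lerD.
  exact: powR_add_le.
by rewrite ler_peMl ?powR_ge0.
Qed.

(** Inside the ball of radius rho, increments of phi are controlled by those of u, of its translate
    and of the cutoff. The lemma is used twice, for (s_1, 1) and for (s_p, p). *)
Lemma cutoff_Wfin (s q L : R) (u phi : V -> R) x0 Rad rho d h :
  0 < s < 1 -> 1 <= q -> measurable_fun setT u -> measurable_fun setT phi ->
  0 < d <= 1 -> 0 <= rho -> rho + d <= Rad -> enorm h <= d -> 0 <= L ->
  (gagI x0 Rad q (n%:R + s * q) u < +oo)%E ->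
  (forall x, rho - d <= edist x x0 -> phi x = 0) ->
  (forall x, `|phi x| <= L) ->
  (forall x y, edist x x0 < rho -> edist y x0 < rho ->
     `|phi x - phi y| <= L * (`|u x - u y| + `|u (tadd x h) - u (tadd y h)| +
        Num.min 1 (edist x y / d))) ->
  Wfin s q phi.
Proof.
move=> /andP[s0 s1] q1 mu mphi d1 rho0 rR hd L0 gu supp bnd lip.
have /andP[d0 dle1] := d1.
have q0 : 0 < q by exact: lt_le_trans q1.
have vol : (I1 (inb x0 rho) < +oo)%E.
  by apply: le_lt_trans (I1_ball x0 rho0) _; exact: ltry.
have minb : measurable_fun setT (inb x0 rho) by exact: measurable_inb.
have off x : ~~ (edist x x0 < rho) -> phi x = 0.
  by rewrite -leNgt => H; apply: supp; apply: le_trans H; rewrite gerBl ltW.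
split.
  apply: (@le_lt_trans _ _ (I1 (fun x => powR L q * inb x0 rho x)%R)).
    apply: I1_le; [by mtac|by mtac|by move=> x; exact: powR_ge0|].
    move=> x; rewrite /inb; case: (boolP (edist x x0 < rho)) => xr /=.
      by rewrite mulr1; apply: powR_le => //; exact: ltW.
    by rewrite off// normr0 powR0 ?mulr0// gt_eqF.
  rewrite (I1Z minb (inb_ge0 x0 rho) (powR_ge0 _ _)).
  by rewrite lte_mul_pinfty// ?lee_fin ?powR_ge0.
have sq0 : 0 < s * q by rewrite mulr_gt0.
have sqq : s * q < q by rewrite gtr_pMl.
have [C C0 HC] := @kernel_mid R n n0 (s * q) q ltac:(by rewrite sq0 sqq).
pose k (x y : V) := powR (Num.min 1 (edist x y / d)) q * powR (edist x y) (- (n%:R + s * q)) : R.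
have mk : mf2 k by rewrite /k; mtac.
have k0 x y : 0 <= k x y by rewrite mulr_ge0 ?powR_ge0.
have Ik x : (I1 (k x) <= (C * powR d (- (n%:R + s * q + q)))%:E)%E.
  have mkx : measurable_fun setT (k x) by exact: measurable_slice1.
  rewrite -(I1_shiftl x mkx (k0 x)) (_ : I1 _ = I1 (fun z : V => powR (Num.min 1 (enorm z / d)) q * powR (enorm z) (- (n%:R + s * q)))).
    exact: HC.
  by apply: eq_leb_int => z; rewrite /k edist_taddr.
pose G x y := inb x0 Rad x * inb x0 Rad y * (powR `|u x - u y| q * powR (edist x y) (- (n%:R + s * q))).
have mG : mf2 G by rewrite /G /inb; mtac.
have G0 x y : 0 <= G x y by rewrite !mulr_ge0 ?inb_ge0 ?powR_ge0.
have IG : (I2 G < +oo)%E by exact: gu.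
pose M x y := inb x0 rho x * k x y.
have mM : mf2 M by rewrite /M; mtac.
have M0 x y : 0 <= M x y by rewrite mulr_ge0 ?inb_ge0.
have IM : (I2 M < +oo)%E.
  have cc : 0 <= C * powR d (- (n%:R + s * q + q)) by rewrite mulr_ge0 ?powR_ge0.
  apply: le_lt_trans (I2_mul_le minb mk (inb_ge0 x0 rho) k0 cc (fun x _ => Ik x)) _.
  by rewrite lte_mul_pinfty.
pose c := powR L q * (powR 2 q * powR 2 q).
have c0 : 0 <= c by rewrite !mulr_ge0 ?powR_ge0.
have LE1 (t1 t2 t3 : R) : 0 <= t1 -> 0 <= t3 -> t2 <= t1 + (t2 + t3) by clear; lra.
have LE2 (t1 t2 t3 : R) : 0 <= t1 -> 0 <= t2 -> t3 <= t1 + (t2 + t3) by clear; lra.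
have two1 : 1 <= powR 2 q * powR 2 q :> R.
  by rewrite mulr_ege1// powR_ge1 ?ler1n ?(ltW q0).
(* If phi x is nonzero, then x lies within rho - d of x0, so x and y are at distance at least d and
   the min equals 1. *)
have M' x y : edist x x0 < rho -> ~~ (edist y x0 < rho) ->
   powR `|phi x - phi y| q * powR (edist x y) (- (n%:R + s * q)) <= c * M x y.
  move=> xr yr; rewrite (off y yr) subr0 /M /inb xr mul1r /k mulrA.
  rewrite ler_wpM2r ?powR_ge0//.
  have [xd|xd] := leP (rho - d) (edist x x0).
    by rewrite supp// normr0 powR0 ?gt_eqF// !mulr_ge0 ?powR_ge0.
  have dxy : d <= edist x y.
    move: yr; rewrite -leNgt => yr; have := edist_triangle y x x0; rewrite (edistC y x); lra.
  rewrite min_l ?ler_pdivlMr ?mul1r// powR1 mulr1.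
  apply: (@le_trans _ _ (powR L q)); first by apply: powR_le => //; exact: ltW.
  by rewrite ler_peMr ?powR_ge0.
have pt x y : powR `|phi x - phi y| q * powR (edist x y) (- (n%:R + s * q)) <=
   c * ((G x y + G (tadd x h) (tadd y h)) + (M x y + M y x)).
  have T0 : 0 <= (G x y + G (tadd x h) (tadd y h)) by exact: addr_ge0.
  have T1 : 0 <= (M x y + M y x) by exact: addr_ge0.
  have [xr|xr] := boolP (edist x x0 < rho); have [yr|yr] := boolP (edist y x0 < rho).
  - apply: (@le_trans _ _ (c * (G x y + G (tadd x h) (tadd y h) + M x y))); last first.
      by rewrite ler_wpM2l// lerD2l lerDl.
    have rR' : rho <= Rad by apply: le_trans rR; rewrite lerDl ltW.
    have xh : edist (tadd x h) x0 < Rad by apply: lt_le_trans (eball_tadd xr hd) rR.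
    have yh : edist (tadd y h) x0 < Rad by apply: lt_le_trans (eball_tadd yr hd) rR.
    rewrite /G /M /inb xr xh yh (lt_le_trans xr rR') (lt_le_trans yr rR') /= !mul1r /k edist_tadd.
    rewrite -!mulrDl mulrA ler_wpM2r ?powR_ge0//.
    have md0 : 0 <= Num.min 1 (edist x y / d).
      by rewrite le_min ler01/= divr_ge0 ?edist_ge0// ltW.
    apply: (@le_trans _ _ (powR (L * (`|u x - u y| + `|u (tadd x h) - u (tadd y h)| +
        Num.min 1 (edist x y / d))) q)); first by apply: powR_le; [exact: ltW| |exact: lip].
    rewrite powRM ?addr_ge0// /c -mulrA ler_wpM2l ?powR_ge0//.
    by apply: powR_add3 => //; exact: ltW.
  - apply: le_trans (M' x y xr yr) _; rewrite ler_wpM2l//.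
    exact: (LE1 _ _ _ T0 (M0 y x)).
  - rewrite -normrN opprB edistC; apply: le_trans (M' y x yr xr) _; rewrite ler_wpM2l//.
    exact: (LE2 _ _ _ T0 (M0 x y)).
  - rewrite (off x xr) (off y yr) subrr normr0 powR0 ?gt_eqF// mul0r.
    exact: (mulr_ge0 c0 (addr_ge0 T0 T1)).
pose Gh x y := G (tadd x h) (tadd y h).
have mGh : mf2 Gh by exact: mf2_shift.
have Gh0 x y : 0 <= Gh x y by exact: G0.
have IGh : I2 Gh = I2 G by exact: I2_shift.
pose Mt x y := M y x.
have mMt : mf2 Mt := mf2_swap mM.
have Mt0 x y : 0 <= Mt x y by exact: M0.
have IMt : I2 Mt = I2 M := esym (I2C mM M0).
have {}pt x y : powR `|phi x - phi y| q * powR (edist x y) (- (n%:R + s * q)) <=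
   c * ((G x y + Gh x y) + (M x y + Mt x y)) by exact: pt.
clearbody c Gh Mt G M.
have mA := mf2_add mG mGh; have mB := mf2_add mM mMt.
have A0 x y : 0 <= G x y + Gh x y by exact: addr_ge0.
have B0 x y : 0 <= M x y + Mt x y by exact: addr_ge0.
have mAB : mf2 (fun x y => (G x y + Gh x y) + (M x y + Mt x y)) by mtac.
have AB0 x y : 0 <= (G x y + Gh x y) + (M x y + Mt x y) by exact: addr_ge0.
apply: (@le_lt_trans _ _ (I2 (fun x y => c * ((G x y + Gh x y) + (M x y + Mt x y)))%R)).
  apply: I2_le; [by mtac|by mtac| |exact: pt].
  by move=> x y; rewrite mulr_ge0 ?powR_ge0.
rewrite (I2Z mAB AB0 c0) (I2D mA mB A0 B0) (I2D mG mGh G0 Gh0) (I2D mM mMt M0 Mt0) IGh IMt.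
by rewrite lte_mul_pinfty ?lee_fin// ; repeat apply: lte_add_pinfty.
Qed.

End Admissible.

(** * Testing the difference of the translated and the original equation *)

Section Energy.
Context {R : realType} {n : nat}.
Hypothesis n0 : (0 < n)%N.
Local Notation V := (n.-tuple R).

Definition flux1 (s : R) (Z : V -> V -> R) (phi : V -> R) (x y : V) : R :=
  Z x y * (phi x - phi y) * powR (edist x y) (- (n%:R + s)).
Definition flux2 (e a : R) (u phi : V -> R) (x y : V) : R :=
  Jp e (u x - u y) * (phi x - phi y) * powR (edist x y) (- (n%:R + a)).

(** Two tested equations are subtracted after translating the second; the four signed integrals
    become one integrand F, to which [S2_lower] applies. *)
Lemma S2_diff (f1 f2 g1 g2 : V -> V -> R) h : mf2 f1 -> mf2 f2 -> mf2 g1 -> mf2 g2 ->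
  (abs_int2 f1 < +oo)%E -> (abs_int2 f2 < +oo)%E ->
  (abs_int2 g1 < +oo)%E -> (abs_int2 g2 < +oo)%E ->
  S2 f1 + S2 f2 = 0 -> S2 g1 + S2 g2 = 0 ->
  let F x y := g1 (tadd x h) (tadd y h) + g2 (tadd x h) (tadd y h) - (f1 x y + f2 x y) in
  [/\ mf2 F, (abs_int2 F < +oo)%E & S2 F = 0].
Proof.
move=> mf1 mf2' mg1 mg2 ff1 ff2 fg1 fg2 Sf Sg F.
have [G1 G1E] : exists G, G = fun x y => g1 (tadd x h) (tadd y h) by eexists.
have [G2 G2E] : exists G, G = fun x y => g2 (tadd x h) (tadd y h) by eexists.
have [H HE] : exists G, G = fun x y => f1 x y + f2 x y by eexists.
have mG1 : mf2 G1 by rewrite G1E; exact: mf2_shift.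
have mG2 : mf2 G2 by rewrite G2E; exact: mf2_shift.
have mH : mf2 H by rewrite HE; exact: mf2_add.
have fG1 : (abs_int2 G1 < +oo)%E by rewrite G1E abs_int2_shift.
have fG2 : (abs_int2 G2 < +oo)%E by rewrite G2E abs_int2_shift.
have fH : (abs_int2 H < +oo)%E by rewrite HE; exact: abs_int2D.
have SH : S2 H = 0 by rewrite HE S2D.
have SG : S2 G1 + S2 G2 = 0 by rewrite G1E G2E !S2_shift.
have FE : F = fun x y => (G1 x y + G2 x y) + - H x y by rewrite G1E G2E HE.
have [G GE] : exists G, G = fun x y => G1 x y + G2 x y by eexists.
have mG : mf2 G by rewrite GE; exact: mf2_add.
have fG : (abs_int2 G < +oo)%E by rewrite GE; exact: abs_int2D.
have SGG : S2 G = 0 by rewrite GE S2D.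
have [N NE] : exists N, N = fun x y => - H x y by eexists.
have mN : mf2 N by rewrite NE; exact: mf2_opp.
have fN : (abs_int2 N < +oo)%E by rewrite NE abs_int2N.
have SN : S2 N = 0 by rewrite NE S2N SH oppr0.
have {}FE : F = fun x y => G x y + N x y by rewrite FE GE NE.
rewrite FE; split; [exact: mf2_add|exact: abs_int2D|by rewrite S2D// SGG SN addr0].
Qed.

(** Only test functions vanishing off the ball are kept, so the domain no longer appears. *)
Definition weak_eq (x0 : V) (Rad s1 sp p : R) (u : V -> R) (Z : V -> V -> R) :=
  forall phi : V -> R, measurable_fun setT phi -> (forall x, Rad <= edist x x0 -> phi x = 0) ->
    Wfin s1 1 phi -> Wfin sp p phi ->
    [/\ (abs_int2 (flux1 s1 Z phi) < +oo)%E,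
        (abs_int2 (flux2 (p - 1) (sp * p) u phi) < +oo)%E &
        S2 (flux1 s1 Z phi) + S2 (flux2 (p - 1) (sp * p) u phi) = 0].

(** After rescaling, Z is no longer a sign; its bound by 1 and its monotonicity in u x - u y
    survive. The p-energy is at most 1, while the W^{s_1,1} seminorm is merely finite and serves to
    admit test functions. *)
Definition normalized_solution (x0 : V) (Rad s1 sp p : R) (u : V -> R) (Z : V -> V -> R) :=
  [/\ normalized x0 Rad (p - 1) (sp * p) u,
      mf2 Z /\ (forall x y, `|Z x y| <= 1),
      (forall x y x' y', u x - u y < u x' - u y' -> Z x y <= Z x' y'),
      (gagI x0 Rad 1 (n%:R + s1 * 1) u < +oo)%E /\
      (gagI x0 Rad p (n%:R + sp * p) u <= 1%:E)%E &
      weak_eq x0 Rad s1 sp p u Z].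

Lemma measurable_Jp d (T : measurableType d) (e : R) (f : T -> R) :
  measurable_fun setT f -> measurable_fun setT (fun x => Jp e (f x)).
Proof. by move=> mf; rewrite /Jp; mtac. Qed.

Lemma mf2_flux1 s Z phi : mf2 Z -> measurable_fun setT phi -> mf2 (flux1 s Z phi).
Proof. by move=> mZ mphi; rewrite /flux1; mtac. Qed.
Lemma mf2_flux2 e a u phi : measurable_fun setT u -> measurable_fun setT phi ->
  mf2 (flux2 e a u phi).
Proof. by move=> mu mphi; rewrite /flux2 /Jp; mtac. Qed.

Definition cutoff (x0 : V) (rho d : R) (x : V) : R :=
  Num.max 0 (Num.min 1 ((rho - edist x x0) / d)).

Lemma measurable_cutoff x0 rho d : measurable_fun setT (cutoff x0 rho d).
Proof. by rewrite /cutoff; mtac. Qed.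

Lemma cutoff_ge0 x0 rho d x : 0 <= cutoff x0 rho d x.
Proof. by rewrite le_max lexx. Qed.

Lemma cutoff_le1 x0 rho d x : cutoff x0 rho d x <= 1.
Proof. by rewrite ge_max ler01 ge_min lexx. Qed.

Lemma cutoff_out x0 rho d x : 0 < d -> rho <= edist x x0 -> cutoff x0 rho d x = 0.
Proof.
move=> d0 H; apply/max_l; rewrite ge_min; apply/orP; right.
by rewrite pmulr_lle0 ?invr_gt0// subr_le0.
Qed.

Lemma cutoff_in x0 rho d x : 0 < d -> edist x x0 <= rho - d -> cutoff x0 rho d x = 1.
Proof.
move=> d0 H; rewrite /cutoff min_l; first by rewrite max_r.
by rewrite ler_pdivlMr// mul1r lerBrDl -lerBrDr.
Qed.

Lemma cutoff_lip x0 rho d x y : 0 < d ->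
  `|cutoff x0 rho d x - cutoff x0 rho d y| <= Num.min 1 (edist x y / d).
Proof.
move=> d0; rewrite le_min; apply/andP; split.
  have := cutoff_ge0 x0 rho d x; have := cutoff_ge0 x0 rho d y.
  have := cutoff_le1 x0 rho d x; have := cutoff_le1 x0 rho d y.
  by rewrite ler_norml => *; apply/andP; split; lra.
have clamp (s t : R) : s <= t ->
    Num.max 0 (Num.min 1 t) - Num.max 0 (Num.min 1 s) <= t - s.
  move=> st; have ts0 : 0 <= t - s by rewrite subr_ge0.
  rewrite lerBlDr ge_max; apply/andP; split; first by rewrite addr_ge0// le_max lexx.
  apply: (@le_trans _ _ (t - s + Num.min 1 s)); last by rewrite lerD2l le_max lexx orbT.
  have [s1|s1] := leP s 1; first by rewrite subrK ge_min lexx orbT.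
  by apply: (@le_trans _ _ 1); rewrite ?ge_min ?lexx// lerDr.
have mono (s t : R) : s <= t -> Num.max 0 (Num.min 1 s) <= Num.max 0 (Num.min 1 t).
  by move=> st; rewrite ge_max le_max lexx/= le_max le_min !ge_min lexx st/= !orbT.
wlog xy : x y / edist x x0 <= edist y x0 => [H|].
  have [|/ltW yx] := leP (edist x x0) (edist y x0); first exact: H.
  by rewrite distrC edistC; exact: H.
have st : (rho - edist y x0) / d <= (rho - edist x x0) / d.
  by rewrite ler_wpM2r ?invr_ge0 ?(ltW d0)// lerD2l lerN2.
rewrite ger0_norm ?subr_ge0; last exact: mono.
apply: le_trans (clamp _ _ st) _; rewrite -mulrBl ler_wpM2r ?invr_ge0 ?(ltW d0)//.
have := edist_triangle y x x0; rewrite (edistC y x); lra.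
Qed.

(** The half of the cutoff error weighted by d_h u at x; the other half is obtained by exchanging x
    and y and has the same integral. *)
Definition err_term (s1 e a be : R) x0 rho d h (u : V -> R) (x y : V) : R :=
  inb x0 rho x * powR `|u (tadd x h) - u x| be *
  (Num.min 1 (edist x y / d) *
    (2 * powR (edist x y) (- (n%:R + s1)) +
     (powR `|u (tadd x h) - u (tadd y h)| e + powR `|u x - u y| e) *
       powR (edist x y) (- (n%:R + a)))).

(** Localizes the pointwise inequality. [bx] stands for x in the ball of radius rho and [gx] for x
    in the inner ball, where the cutoff is 1; likewise for y. *)
Lemma energy_cases (e be vx vy a b zh z ex ey m k1 kp : R) (bx by_ gx gy : bool) :
  1 <= e -> 1 <= be -> a - b = vx - vy -> `|zh| <= 1 -> `|z| <= 1 ->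
  (b < a -> z <= zh) -> (a < b -> zh <= z) ->
  0 <= ex -> 0 <= ey -> `|ex - ey| <= m -> 0 <= k1 -> 0 <= kp ->
  (~~ bx -> ex = 0) -> (~~ by_ -> ey = 0) -> (gx -> ex = 1) -> (gy -> ey = 1) ->
  (gx -> bx) -> (gy -> by_) ->
  powR 2 (- (e + be)) * (ind gx * ind gy * (powR `|vx - vy| (e + be) * kp)) -
   (ind bx * powR `|vx| be * (m * (2 * k1 + (powR `|a| e + powR `|b| e) * kp)) +
    ind by_ * powR `|vy| be * (m * (2 * k1 + (powR `|a| e + powR `|b| e) * kp)))
  <= (zh - z) * (Jp be vx * ex - Jp be vy * ey) * k1
     + (Jp e a - Jp e b) * (Jp be vx * ex - Jp be vy * ey) * kp.
Proof.
move=> e1 be1 abv zh1 z1 mon1 mon2 ex0 ey0 exy k10 kp0 hbx hby hgx hgy gbx gby.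
have EP := energy_pointwise e1 be1 abv zh1 z1 mon1 mon2 ex0 ey0 exy k10 kp0.
have CO := Jp_coercive_prod e1 be1 abv.
have be0 : 0 < be by exact: lt_le_trans be1.
have e0 : 0 < e by exact: lt_le_trans e1.
have Z2 : `|zh - z| <= 2 by apply: le_trans (ler_normB _ _) _; lra.
have J2 : `|Jp e a - Jp e b| <= powR `|a| e + powR `|b| e.
  by apply: le_trans (ler_normB _ _) _; rewrite !Jp_norm.
have m0 : 0 <= m by exact: le_trans exy.
rewrite -[powR `|vx| be]Jp_norm// -[powR `|vy| be]Jp_norm//.
rewrite -[powR `|vx| be]Jp_norm// -[powR `|vy| be]Jp_norm// in EP.
have Q0 : 0 <= (Jp e a - Jp e b) * (Jp be vx - Jp be vy).
  have : 0 <= powR 2 (e + be) * ((Jp e a - Jp e b) * (Jp be vx - Jp be vy)).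
    by apply: le_trans CO; exact: powR_ge0.
  by rewrite pmulr_rge0 ?powR_gt0.
have C0 : powR 2 (- (e + be)) * (powR `|vx - vy| (e + be) * kp) <=
    (Jp e a - Jp e b) * (Jp be vx - Jp be vy) * kp.
  rewrite mulrA ler_wpM2r// powRN ler_pdivrMl ?powR_gt0//.
move: C0 J2 Q0 EP; clear CO.
move: (powR 2 (- (e + be))) (powR `|vx - vy| (e + be)) (Jp e a - Jp e b)
  (powR `|a| e + powR `|b| e) (Jp be vx) (Jp be vy) => c g A S X Y C0 J2 Q0 EP.
set W := 2 * k1 + S * kp in EP *.
(* For pairs with only one point in the large ball the cutoff vanishes at the other point, so its
   value is itself a cutoff difference and the whole integrand counts as an error. *)
have onesided (T et : R) : 0 <= et -> et <= m ->
    - (`|T| * (m * W)) <= (zh - z) * (T * et) * k1 + A * (T * et) * kp.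
  clear -Z2 J2 m0 k10 kp0 => et0 etm; rewrite lerNl.
  apply: le_trans (ler_norm _) _; rewrite normrN.
  apply: le_trans (ler_normD _ _) _.
  rewrite !normrM (ger0_norm et0) (ger0_norm k10) (ger0_norm kp0).
  have -> : `|T| * (m * W) = 2 * (`|T| * m) * k1 + S * (`|T| * m) * kp by rewrite /W; ring.
  have Tm : `|T| * et <= `|T| * m by rewrite ler_wpM2l.
  have Te : 0 <= `|T| * et by rewrite mulr_ge0.
  by apply: lerD; rewrite ler_wpM2r//; apply: ler_pM.
case: bx hbx gbx => /= hbx gbx; case: by_ hby gby => /= hby gby; rewrite ?mul1r ?mul0r.
- apply: le_trans EP.
  have -> : `|X| * (m * W) + `|Y| * (m * W) = (`|X| + `|Y|) * m * W by ring.
  rewrite lerD2r.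
  have R0 : 0 <= A * (X - Y) * ((ex + ey) / 2) * kp.
    by apply: mulr_ge0 => //; apply: mulr_ge0 => //; rewrite divr_ge0// addr_ge0.
  case: gx hgx gbx => /= hgx gbx; last by rewrite !mul0r mulr0.
  case: gy hgy gby => /= hgy gby; last by rewrite mulr0 mul0r mulr0.
  rewrite hgx// hgy// !mul1r; have -> : (1 + 1) / 2 = 1 :> R by field.
  by rewrite mulr1.
- have -> : ind gy = 0 :> R by case: gy gby {hgy} => // /(_ isT).
  rewrite mulr0 mul0r mulr0 sub0r addr0 hby// mulr0 subr0; apply: onesided => //.
  by move: exy; rewrite hby// subr0 ger0_norm.
- have -> : ind gx = 0 :> R by case: gx gbx {hgx} => // /(_ isT).
  rewrite !mul0r mulr0 sub0r add0r hbx// mulr0 sub0r.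
  rewrite -[`|Y|]normrN -(mulNr Y ey); apply: onesided => //.
  by move: exy; rewrite hbx// sub0r normrN ger0_norm.
- have -> : ind gx = 0 :> R by case: gx gbx {hgx} => // /(_ isT).
  by rewrite hbx// hby// !(mulr0, mul0r, subrr, addr0).
Qed.

Lemma energy_estimate (s1 sp p be : R) x0 Rad rho d h u Z :
  0 < s1 < 1 -> 0 < sp < 1 -> 2 <= p -> 1 <= be ->
  normalized_solution x0 Rad s1 sp p u Z ->
  0 < d <= 1 -> 0 <= rho -> rho + d <= Rad -> enorm h <= d ->
  (gagI x0 (rho - d - d) (p - 1 + be) (n%:R + sp * p) (fun x => u (tadd x h) - u x)%R
    <= (powR 2 (p - 1 + be) * 2)%:E *
       I2 (err_term s1 (p - 1) (sp * p) be x0 rho d h u))%E.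
Proof.
move=> s1b spb p2 be1 [[mu ub _] [mZ Zb] Zm [g1f gpf] weak] d1 r0 rR hd.
have /andP[d0 dle1] := d1.
set e := p - 1.
have e1 : 1 <= e by rewrite /e; lra.
have be0 : 0 < be by exact: lt_le_trans be1.
have p1 : 1 <= p by lra.
pose v x := u (tadd x h) - u x.
have mv : measurable_fun setT v by rewrite /v; mtac.
(* Vanishing already at radius rho - d, so that the test function translated by h still vanishes
   outside radius rho <= Rad. *)
pose eta := cutoff x0 (rho - d) d.
have meta : measurable_fun setT eta by exact: measurable_cutoff.
have eta0 x : 0 <= eta x by exact: cutoff_ge0.
have eta1 x : eta x <= 1 by exact: cutoff_le1.
have etaout x : rho - d <= edist x x0 -> eta x = 0 by exact: cutoff_out.
have etain x : edist x x0 < rho - d - d -> eta x = 1.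
  by move=> H; apply: cutoff_in => //; exact: ltW.
have etalip x y : `|eta x - eta y| <= Num.min 1 (edist x y / d) by exact: cutoff_lip.
clearbody eta.
pose phi x := Jp be (v x) * eta x.
have mphi : measurable_fun setT phi.
  by rewrite /phi; apply: measurable_mulR => //; exact: measurable_Jp.
have phiout x : rho - d <= edist x x0 -> phi x = 0.
  by move=> H; rewrite /phi etaout// mulr0.
have rRad : rho <= Rad by apply: le_trans rR; rewrite lerDl ltW.
have vb x : edist x x0 < rho -> `|v x| <= 2.
  move=> xr; have B1 := ub (tadd x h) (lt_le_trans (eball_tadd xr hd) rR).
  have B2 := ub x (lt_le_trans xr rRad).
  by apply: le_trans (ler_normB _ _) _; lra.
pose L := 2 * (be * powR 2 (be - 1)) + powR 2 be.
have L10 : 0 <= 2 * (be * powR 2 (be - 1)) by rewrite !mulr_ge0 ?powR_ge0// ltW.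
have L0 : 0 <= L by rewrite addr_ge0 ?powR_ge0.
have Jb x : edist x x0 < rho -> `|Jp be (v x)| <= powR 2 be.
  by move=> xr; rewrite Jp_norm//; apply: powR_le; rewrite ?vb// ltW.
have phib x : `|phi x| <= L.
  have [xr|xr] := leP (rho - d) (edist x x0); first by rewrite phiout// normr0.
  have xr' : edist x x0 < rho by apply: lt_trans xr _; rewrite gtrBl.
  rewrite /phi normrM (ger0_norm (eta0 x)).
  apply: (@le_trans _ _ (powR 2 be)); last by rewrite lerDr.
  by apply: le_trans (Jb x xr'); rewrite ler_piMr.
have philip x y : edist x x0 < rho -> edist y x0 < rho ->
    `|phi x - phi y| <= L * (`|u x - u y| + `|u (tadd x h) - u (tadd y h)| +
        Num.min 1 (edist x y / d)).
  move=> xr yr.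
  have -> : phi x - phi y = (Jp be (v x) - Jp be (v y)) * eta x + Jp be (v y) * (eta x - eta y).
    by rewrite /phi; ring.
  apply: le_trans (ler_normD _ _) _; rewrite [leRHS]mulrDr; apply: lerD.
    rewrite normrM (ger0_norm (eta0 x)).
    apply: (@le_trans _ _ `|Jp be (v x) - Jp be (v y)|); first by rewrite ler_piMr.
    apply: le_trans (Jp_lip be1 (vb x xr) (vb y yr)) _.
    apply: (@le_trans _ _ (2 * (be * powR 2 (be - 1)) * (`|u x - u y| + `|u (tadd x h) - u (tadd y h)|))).
      rewrite ler_wpM2l//.
      have -> : v x - v y = (u (tadd x h) - u (tadd y h)) - (u x - u y) by rewrite /v; ring.
      by apply: le_trans (ler_normB _ _) _; rewrite addrC.
    by rewrite ler_wpM2r ?addr_ge0// lerDl powR_ge0.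
  have md0 : 0 <= Num.min 1 (edist x y / d).
    by rewrite le_min ler01/= divr_ge0 ?edist_ge0// ltW.
  rewrite normrM; apply: (@le_trans _ _ (powR 2 be * Num.min 1 (edist x y / d))).
    by apply: ler_pM => //; exact: Jb.
  by rewrite ler_wpM2r// lerDr.
have W1 : Wfin s1 1 phi by apply: (cutoff_Wfin n0 s1b _ mu mphi d1 r0 rR hd L0 g1f phiout phib philip).
have gpf' : (gagI x0 Rad p (n%:R + sp * p) u < +oo)%E.
  by apply: le_lt_trans gpf _; rewrite ltry.
have Wp : Wfin sp p phi by apply: (cutoff_Wfin n0 spb p1 mu mphi d1 r0 rR hd L0 gpf' phiout phib philip).
(* The equation tested with phi(. - h) becomes, after the change of variables x -> x + h, the
   translated equation tested with phi. *)
pose psi x := phi (tadd x (topp h)).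
have mpsi : measurable_fun setT psi by rewrite /psi; mtac.
have phioutR x : Rad <= edist x x0 -> phi x = 0.
  by move=> H; apply: phiout; apply: le_trans H; apply: le_trans rRad; rewrite gerBl ltW.
have psioutR x : Rad <= edist x x0 -> psi x = 0.
  move=> H; apply: phiout; rewrite leNgt; apply/negP => H'.
  have nnh : enorm h <= d by [].
  have := eball_tadd H' nnh; rewrite taddNK subrK ltNge => /negP; apply.
  exact: le_trans rRad H.
have [A1 A2 A3] := weak phi mphi phioutR W1 Wp.
have [B1 B2 B3] := weak psi mpsi psioutR (Wfin_shift _ mphi W1) (Wfin_shift _ mphi Wp).
have psiE x : psi (tadd x h) = phi x by rewrite /psi taddK.
pose k1 (x y : V) := powR (edist x y) (- (n%:R + s1)) : R.
pose kp (x y : V) := powR (edist x y) (- (n%:R + sp * p)) : R.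
pose F x y := flux1 s1 Z psi (tadd x h) (tadd y h) + flux2 e (sp * p) u psi (tadd x h) (tadd y h)
   - (flux1 s1 Z phi x y + flux2 e (sp * p) u phi x y).
have [mF Ff SFz] : [/\ mf2 F, (abs_int2 F < +oo)%E & S2 F = 0].
  apply: S2_diff => //; [exact: mf2_flux1|exact: mf2_flux2|exact: mf2_flux1|exact: mf2_flux2].
have FE x y : F x y = (Z (tadd x h) (tadd y h) - Z x y) * (Jp be (v x) * eta x - Jp be (v y) * eta y) * k1 x y
   + (Jp e (u (tadd x h) - u (tadd y h)) - Jp e (u x - u y)) * (Jp be (v x) * eta x - Jp be (v y) * eta y) * kp x y.
  rewrite /F /flux1 /flux2 !psiE !edist_tadd /k1 /kp /phi; ring.
clearbody F.
pose err := err_term s1 e (sp * p) be x0 rho d h u.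
have merr : mf2 err by rewrite /err /err_term /inb; mtac.
have err0 x y : 0 <= err x y.
  rewrite /err /err_term !mulr_ge0 ?inb_ge0 ?powR_ge0 ?addr_ge0 ?mulr_ge0 ?powR_ge0 ?addr_ge0 ?powR_ge0//.
  by rewrite le_min ler01/= divr_ge0 ?edist_ge0// ltW.
pose r := rho - d - d.
pose G x y := inb x0 r x * inb x0 r y * (powR `|v x - v y| (e + be) * kp x y).
have mG : mf2 G by rewrite /G /inb /kp; mtac.
have G0 x y : 0 <= G x y by rewrite !mulr_ge0 ?inb_ge0 ?powR_ge0.
pose c := powR 2 (- (e + be)) : R.
have c0 : 0 <= c by exact: powR_ge0.
have mono1 x : edist x x0 < r -> edist x x0 < rho.
  move=> xr; apply: lt_le_trans xr _.
  by rewrite /r -addrA gerDl -opprD oppr_le0 addr_ge0// ltW.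
have outx x : ~~ (edist x x0 < rho) -> eta x = 0.
  rewrite -leNgt => H; apply: etaout; apply: le_trans H.
  by rewrite gerBl ltW.
have pt x y : c * G x y - (err x y + err y x) <= F x y.
  rewrite FE /err /err_term (edistC y x) (distrC (u (tadd y h)) (u (tadd x h))) (distrC (u y) (u x)).
  have abv : (u (tadd x h) - u (tadd y h)) - (u x - u y) = v x - v y by rewrite /v; ring.
  exact: (energy_cases e1 be1 abv (Zb _ _) (Zb _ _) (fun H => Zm _ _ _ _ H)
    (fun H => Zm _ _ _ _ H) (eta0 x) (eta0 y) (etalip x y) (powR_ge0 _ _) (powR_ge0 _ _)
    (outx x) (outx y) (etain x) (etain y) (mono1 x) (mono1 y)).
have GG : gagI x0 r (e + be) (n%:R + sp * p) (fun x => u (tadd x h) - u x) = I2 G by [].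
rewrite GG -/err.
have cc : (powR 2 (e + be) * c) = 1.
  by rewrite /c -powRD_ne// subrr powRr0.
clearbody err G c; clear -mF Ff SFz merr err0 mG G0 c0 pt cc.
have merr' := mf2_swap merr.
have merr2 : mf2 (fun x y => err x y + err y x) by mtac.
have mcG : mf2 (fun x y => c * G x y) by mtac.
have I := @S2_lower R n F (fun x y => c * G x y) (fun x y => err x y + err y x) mF mcG merr2
  (fun x y => mulr_ge0 c0 (G0 x y)) (fun x y => addr_ge0 (err0 x y) (err0 y x)) Ff SFz pt.
move: I; rewrite (I2Z mG G0 c0) (I2D merr merr' err0 (fun x y => err0 y x)) -(I2C merr err0) => I.
apply: (@le_trans _ _ ((powR 2 (e + be))%:E * (c%:E * I2 G))%E).
  by rewrite muleA -EFinM cc mul1e.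
rewrite EFinM -muleA; apply: lee_wpmul2l; first by rewrite lee_fin powR_ge0.
have -> : (2%:E = 1%:E + 1%:E :> \bar R)%E by rewrite -EFinD.
rewrite ge0_muleDl ?lee_fin// !mul1e; exact: I.
Qed.

End Energy.

(** * One improvement step *)

Section Iteration.
Context {R : realType} {n : nat}.
Hypothesis n0 : (0 < n)%N.
Local Notation V := (n.-tuple R).

Definition tzero : V := [tuple 0 | i < n].
Lemma tadd0 (x : V) : tadd x tzero = x.
Proof. by apply: eq_from_tnth => i; rewrite !tnth_mktuple addr0. Qed.
Lemma enorm_tzero : enorm tzero = 0 :> R.
Proof.
by rewrite /enorm big1 ?sqrtr0// => i _; rewrite tnth_mktuple expr0n.
Qed.

Lemma err_bound (s1 e a la m tau Rm : R) : 0 < s1 < 1 -> 0 < e -> 0 < a -> 1 < la ->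
  e < la * m -> 0 <= tau -> 0 < 1 - a + tau * (e / la) ->
  exists2 C, 0 <= C & forall (u : V -> R) x0 Rad rho d K (h : V), normalized x0 Rad e a u ->
   0 < d <= 1 -> 0 <= rho -> rho + d + d <= Rad -> Rad <= Rm -> 0 <= K ->
   diff_bound m tau x0 (rho + d) d K u ->
   0 < enorm h -> enorm h <= d ->
   (I2 (err_term s1 e a (m - e / la) x0 rho d h u) <=
     (C * powR d (- (n%:R + a + 2)) * (K + 1) * powR (enorm h) (tau * (m - e / la)))%:E)%E.
Proof.
move=> s1b e0 a0 la1 elm tau0 eps0; have /andP[s10 s11] := s1b.
have la0 : 0 < la by exact: lt_trans la1.
have [C1 C10 H1] := gradient_error n0 Rm e0 a0 la1 elm tau0 eps0.
have [C2 C20 H2] := kernel_mid n0 s1b.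
have Rn0 : 0 <= (2 * `|Rm|) ^+ n by rewrite exprn_ge0// mulr_ge0.
exists (2 * C1 + 2 * C2 * (1 + (2 * `|Rm|) ^+ n)).
  by rewrite !(addr_ge0, mulr_ge0).
move=> u x0 Rad rho d K h nu d1 r0 rR RRm K0 HD h0 hd.
have [mu ub _] := nu; have /andP[d0 dle1] := d1.
set be := m - e / la.
have be0 : 0 < be by rewrite subr_gt0 ltr_pdivrMr// mulrC.
have bem : be <= m by rewrite gerBl divr_ge0// ltW.
have Rad0 : 0 < Rad by apply: lt_le_trans rR; rewrite -addrA ltr_wpDl// addr_gt0.
have Rm0 : 0 < Rm by exact: lt_le_trans RRm.
have HA := H1 u x0 Rad rho d K h h nu d1 r0 rR RRm K0 HD h0 hd hd.
(* The increments of u itself are the case w = 0 of the error estimate; w = h gives those of the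
   translate. *)
have zd : enorm tzero <= d by rewrite enorm_tzero ltW.
have HB := H1 u x0 Rad rho d K h tzero nu d1 r0 rR RRm K0 HD h0 hd zd.
pose f x := inb x0 rho x * powR `|u (tadd x h) - u x| be.
pose k (x y : V) := Num.min 1 (edist x y / d) * powR (edist x y) (- (n%:R + s1)) : R.
pose EA x y := f x * (Num.min 1 (edist x y / d) *
  (powR `|u (tadd x h) - u (tadd y h)| e * powR (edist x y) (- (n%:R + a)))).
pose EB x y := f x * (Num.min 1 (edist x y / d) *
  (powR `|u (tadd x tzero) - u (tadd y tzero)| e * powR (edist x y) (- (n%:R + a)))).
have mf : measurable_fun setT f by rewrite /f /inb; mtac.
have mk : mf2 (fun x y : V => k x y) by rewrite /k; mtac.
have mEA : mf2 EA by rewrite /EA; mtac.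
have mEB : mf2 EB by rewrite /EB; mtac.
have f0 x : 0 <= f x by rewrite mulr_ge0 ?inb_ge0 ?powR_ge0.
have md0 (x y : V) : 0 <= Num.min 1 (edist x y / d).
  by rewrite le_min ler01/= divr_ge0 ?edist_ge0// ltW.
have k0 (x y : V) : 0 <= k x y by rewrite mulr_ge0 ?powR_ge0.
have EA0 x y : 0 <= EA x y by rewrite mulr_ge0// mulr_ge0// mulr_ge0 ?powR_ge0.
have EB0 x y : 0 <= EB x y by rewrite mulr_ge0// mulr_ge0// mulr_ge0 ?powR_ge0.
have Ik (x : V) : (I1 (k x) <= (C2 * powR d (- (n%:R + s1 + 1)))%:E)%E.
  have mkx : measurable_fun setT (k x) by exact: (measurable_slice1 x mk).
  rewrite -(I1_shiftl x mkx (k0 x)).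
  rewrite (_ : I1 _ = I1 (fun z : V => powR (Num.min 1 (enorm z / d)) 1 * powR (enorm z) (- (n%:R + s1)))).
    exact: H2.
  by apply: eq_leb_int => z; rewrite /k edist_taddr powRr1// -(edist_taddr x z).
have Hf : (I1 f <= ((K + (2 * `|Rm|) ^+ n) * powR (enorm h) (tau * be))%:E)%E.
  have HD' : diff_bound m tau x0 rho d K u.
    by apply: diff_bound_le HD => //; rewrite lerDl ltW.
  apply: le_trans (weight_bound mu h0 hd (ltW be0) bem r0 K0 HD') _.
  rewrite lee_fin ler_wpM2r ?powR_ge0// lerD2l lerXn2r ?nnegrE ?mulr_ge0//.
  rewrite ler_wpM2l// (ger0_norm (ltW Rm0)); apply: le_trans RRm.
  by apply: le_trans rR; rewrite -addrA lerDl addr_ge0// ltW.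
have cc : 0 <= C2 * powR d (- (n%:R + s1 + 1)) by rewrite mulr_ge0 ?powR_ge0.
have HK := I2_mul_le mf mk f0 k0 cc (fun x _ => Ik x).
have E : err_term s1 e a be x0 rho d h u = fun x y => 2 * (f x * k x y) + (EA x y + EB x y).
  apply/funext => x; apply/funext => y.
  by rewrite /err_term /EA /EB /f /k !tadd0; ring.
rewrite E.
have {}HA : (I2 EA <= (C1 * powR d (- (n%:R + a + 1)) * (K + 1) * powR (enorm h) (tau * be))%:E)%E by exact: HA.
have {}HB : (I2 EB <= (C1 * powR d (- (n%:R + a + 1)) * (K + 1) * powR (enorm h) (tau * be))%:E)%E by exact: HB.
clearbody f k EA EB; clear E Ik H1 H2 HD ub nu.
have mfk : mf2 (fun x y => f x * k x y) by mtac.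
have mE : mf2 (fun x y => EA x y + EB x y) by mtac.
have m2fk : mf2 (fun x y => 2 * (f x * k x y)) by mtac.
have fk0 x y : 0 <= f x * k x y by exact: mulr_ge0.
have E0 x y : 0 <= EA x y + EB x y by exact: addr_ge0.
have fk20 x y : 0 <= 2 * (f x * k x y) by exact: mulr_ge0.
have two0 : (0 : R) <= 2 by [].
rewrite (I2D m2fk mE fk20 E0) (I2Z mfk fk0 two0) (I2D mEA mEB EA0 EB0).
set D := powR d (- (n%:R + a + 2)); set X := powR (enorm h) (tau * be).
have X0 : 0 <= X by exact: powR_ge0.
have D0 : 0 <= D by exact: powR_ge0.
have D1 : powR d (- (n%:R + a + 1)) <= D by apply: le_powR_d => //; rewrite lerD2l; lra.
have D2 : powR d (- (n%:R + s1 + 1)) <= D by apply: le_powR_d => //; lra.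
have LE (T : R) : C1 * powR d (- (n%:R + a + 1)) * (K + 1) * X <= C1 * D * (K + 1) * X.
  by rewrite !ler_wpM2r ?addr_ge0// ler_wpM2l.
apply: (@le_trans _ _ (2%:E * (C2 * D * ((K + (2 * `|Rm|) ^+ n) * X))%:E +
   ((C1 * D * (K + 1) * X)%:E + (C1 * D * (K + 1) * X)%:E))%E).
  apply: leeD; last first.
    apply: leeD; [apply: le_trans HA _|apply: le_trans HB _]; rewrite lee_fin; exact: LE.
  apply: lee_wpmul2l; first by rewrite lee_fin.
  apply: le_trans HK _; rewrite [leRHS]EFinM; apply: lee_pmul;
    [by rewrite lee_fin|exact: I1_ge0|by rewrite lee_fin ler_wpM2l|exact: Hf].
rewrite -!EFinD lee_fin -subr_ge0.
move: Rn0; move: ((2 * `|Rm|) ^+ n) => rn Rn0.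
have -> : (2 * C1 + 2 * C2 * (1 + rn)) * D * (K + 1) * X -
  (2 * (C2 * D * ((K + rn) * X)) + (C1 * D * (K + 1) * X + C1 * D * (K + 1) * X)) =
  2 * C2 * D * X * (1 + rn * K) by clear; ring.
by rewrite !mulr_ge0// addr_ge0 ?mulr_ge0.
Qed.

(** The relation tau' Q = s_p p + tau be adds two powers of |h|: tau be from the error bound, and
    s_p p from passing from the energy of d_h u to its own difference by h. *)
Lemma improvement (s1 sp p la m tau Rm : R) : 0 < s1 < 1 -> 0 < sp < 1 -> 2 <= p -> 1 < la ->
  p <= m -> 0 <= tau -> 0 < 1 - sp * p + tau * ((p - 1) / la) ->
  let be := m - (p - 1) / la in let Q := p - 1 + be in
  let tau' := (sp * p + tau * be) / Q in tau' < 1 ->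
  exists C kap, [/\ 0 <= C, 0 <= kap & forall u Z x0 Rad rho d K,
   normalized_solution x0 Rad s1 sp p u Z ->
   0 < d <= 1 -> 0 <= rho -> rho + d + d <= Rad -> Rad <= Rm -> 0 <= K ->
   @diff_bound R n m tau x0 (rho + d) d K u ->
   diff_bound Q tau' x0 (rho - d - d - d) d (C * powR d (- kap) * (K + 1)) u].
Proof.
move=> s1b spb p2 la1 pm tau0 eps0 be Q tau' tau'1.
have /andP[sp0 sp1] := spb.
have e0 : 0 < p - 1 by lra.
have p0 : 0 < p by lra.
have a0 : 0 < sp * p by rewrite mulr_gt0.
have la0 : 0 < la by exact: lt_trans la1.
have m0 : 0 < m by exact: lt_le_trans pm.
have elm : p - 1 < la * m.
  apply: (@lt_le_trans _ _ m); last by rewrite ler_peMl// ltW.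
  by apply: lt_le_trans pm; rewrite gtrBl.
have ela : (p - 1) / la <= p - 1 by rewrite ler_pdivrMr// ler_peMr// ltW.
have be1 : 1 <= be by rewrite /be; lra.
have be0 : 0 < be by exact: lt_le_trans be1.
have Q1 : 1 <= Q by rewrite /Q; lra.
have Q0 : 0 < Q by exact: lt_le_trans Q1.
have tau'0 : 0 <= tau'.
  by rewrite divr_ge0 ?(ltW Q0)// addr_ge0 ?mulr_ge0// ltW.
have tQ : tau' * Q = sp * p + tau * be by rewrite /tau' divfK// gt_eqF.
have [C1 C10 H1] := err_bound Rm s1b e0 a0 la1 elm tau0 eps0.
have na0 : 0 <= n%:R + sp * p by rewrite addr_ge0// ltW.
have [C2 C20 H2] := gagI_shift n0 Q0 na0.
have tau'b : 0 <= tau' < 1 by rewrite tau'0.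
have [C3 C30 H3] := second_to_first (n := n) Q1 tau'b.
pose B := C2 * (powR 2 Q * 2 * C1).
have B0 : 0 <= B by rewrite !mulr_ge0 ?powR_ge0.
pose M := powR 2 Q * (2 * `|Rm|) ^+ n.
have M0 : 0 <= M by rewrite mulr_ge0 ?powR_ge0// exprn_ge0// mulr_ge0.
exists (C3 * (B + M)), (n%:R + sp * p + 2 + (tau' * Q)); split.
- by rewrite mulr_ge0// addr_ge0.
- by rewrite addr_ge0// ?addr_ge0// mulr_ge0// ltW.
move=> u Z x0 Rad rho d K sol d1 r0 rR RRm K0 HD.
have [nu _ _ _ _] := sol; have [mu ub _] := nu.
have /andP[d0 dle1] := d1.
have rdR : rho + d <= Rad by apply: le_trans rR; rewrite lerDl ltW.
pose A := B * powR d (- (n%:R + sp * p + 2)) * (K + 1).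
have A0 : 0 <= A by rewrite !mulr_ge0 ?powR_ge0// addr_ge0.
have Rad0 : 0 < Rad by apply: lt_le_trans rR; rewrite -addrA ltr_wpDl// addr_gt0.
have Rm0 : 0 < Rm by exact: lt_le_trans RRm.
have r3 : rho - d - d - d <= rho by rewrite -!addrA gerDl -!opprD oppr_le0 !addr_ge0// ltW.
(* Starting bound of the doubling argument, from |u| <= 1 alone. *)
have crude (h : V) : enorm h <= d ->
   (I1 (fun x => inb x0 (rho - d - d - d) x * powR `|u (tadd x h) - u x| Q)%R <= M%:E)%E.
  move=> hd; apply: (@le_trans _ _ (I1 (fun x => powR 2 Q * inb x0 rho x)%R)).
    apply: I1_le; [by rewrite /inb; mtac|by rewrite /inb; mtac| |].
      by move=> x; rewrite mulr_ge0 ?inb_ge0 ?powR_ge0.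
    move=> x; rewrite /inb.
    have [xr|_] := ltP (edist x x0) (rho - d - d - d); last first.
      by rewrite mul0r mulr_ge0 ?powR_ge0 ?ind_ge0.
    have xr' : edist x x0 < rho by exact: lt_le_trans xr r3.
    rewrite xr' mul1r mulr1; apply: powR_le; [exact: ltW| by []|].
    have B1 := ub (tadd x h) (lt_le_trans (eball_tadd xr' hd) rdR).
    have rRad : rho <= Rad by apply: le_trans rdR; rewrite lerDl ltW.
    have B2 := ub x (lt_le_trans xr' rRad).
    by apply: le_trans (ler_normB _ _) _; lra.
  have minb := measurable_inb x0 rho.
  rewrite (I1Z minb (inb_ge0 x0 rho) (powR_ge0 _ _)) /M EFinM.
  apply: lee_wpmul2l; first by rewrite lee_fin powR_ge0.
  apply: le_trans (I1_ball x0 r0) _; rewrite lee_fin lerXn2r ?nnegrE ?mulr_ge0//.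
  rewrite ler_wpM2l// (ger0_norm (ltW Rm0)); apply: le_trans RRm.
  by apply: le_trans rdR; rewrite lerDl ltW.
(* [gagI_shift] is applied to d_h u with the same vector h, which yields the second difference. *)
have second (h : V) : 0 < enorm h -> enorm h <= d ->
   (I1 (fun x => inb x0 (rho - d - d - d) x *
      powR `|(u (tadd (tadd x h) h) - u (tadd x h)) - (u (tadd x h) - u x)| Q)%R <=
    (A * powR (enorm h) (tau' * Q))%:E)%E.
  move=> h0 hd.
  have EE := energy_estimate n0 s1b spb p2 be1 sol d1 r0 rdR hd.
  have IE := H1 u x0 Rad rho d K h nu d1 r0 rR RRm K0 HD h0 hd.
  set X := powR (enorm h) (tau * be) in IE.
  pose A1 := powR 2 Q * 2 * (C1 * powR d (- (n%:R + sp * p + 2)) * (K + 1) * X).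
  have A10 : 0 <= A1 by rewrite !mulr_ge0 ?powR_ge0// addr_ge0.
  have G : (gagI x0 (rho - d - d) Q (n%:R + sp * p) (fun x => u (tadd x h) - u x)%R <= A1%:E)%E.
    apply: le_trans EE _; rewrite /A1 [leRHS]EFinM; apply: lee_wpmul2l; last exact: IE.
    by rewrite lee_fin mulr_ge0 ?powR_ge0.
  have mv : measurable_fun setT (fun x => u (tadd x h) - u x) by mtac.
  have S := H2 (fun x => u (tadd x h) - u x) x0 (rho - d - d) d A1 h mv A10 h0 hd G.
  apply: le_trans S _; rewrite lee_fin tQ.
  have -> : n%:R + sp * p - n%:R = sp * p by ring.
  rewrite (powRD_ne _ _ (lt0r_neq0 h0)) -/X /A1 /A /B.
  by rewrite le_eqVlt; apply/orP; left; apply/eqP; ring.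
clearbody M B => h h0 hd.
apply: le_trans (H3 u x0 (rho - d - d - d) d A M mu d1 A0 M0 crude second h h0 hd) _.
set D := powR d (- (n%:R + sp * p + 2 + tau' * Q)).
rewrite lee_fin ler_wpM2r ?powR_ge0// -(mulrA (C3 * (B + M)) D) -(mulrA C3 (B + M)) ler_wpM2l//.
have D0 : 0 <= D by exact: powR_ge0.
have tq0 : 0 <= tau' * Q by rewrite mulr_ge0// ltW.
have D1 : powR d (- (n%:R + sp * p + 2)) <= D by apply: le_powR_d => //; rewrite lerDl.
have D2 : powR d (- (tau' * Q)) <= D.
  by apply: le_powR_d => //; rewrite lerDr addr_ge0.
rewrite [leRHS]mulrDl; apply: lerD.
  by rewrite /A -(mulrA B); apply: ler_wpM2l => //; apply: ler_wpM2r => //; exact: addr_ge0.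
apply: ler_wpM2l => //; apply: le_trans D2 _; rewrite ler_peMr//.
by rewrite lerDr.
Qed.

End Iteration.

(** * Iteration and regularity of normalized solutions *)

Section NormalizedRegularity.
Context {R : realType} {n : nat}.
Hypothesis n0 : (0 < n)%N.
Local Notation V := (n.-tuple R).

Let nR0 : 0 < n%:R :> R. Proof. by rewrite ltr0n. Qed.

(** Write y = x + z. For |z| < d the rate tau > gam leaves the integrable |z|^((tau - gam) q - n);
    for |z| >= d the bound |u| <= 1 suffices. *)
Lemma seminorm_of_diff (Q tau q gam Rm : R) : 0 < q -> q <= Q -> 0 < gam -> gam < tau ->
  exists2 C, 0 <= C & forall (u : V -> R) x0 r d K, measurable_fun setT u ->
    (forall x, edist x x0 < r -> `|u x| <= 1) -> 0 < d <= 1 -> 0 <= r -> r <= Rm -> 0 <= K ->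
    diff_bound Q tau x0 r d K u ->
    (gagI x0 r q (n%:R + gam * q) u <= (C * (K + 1) * powR d (- (n%:R + gam * q)))%:E)%E.
Proof.
move=> q0 qQ gam0 gt.
have gq0 : 0 < gam * q by rewrite mulr_gt0.
have eps0 : 0 < (tau - gam) * q by rewrite mulr_gt0// subr_gt0.
have [C1 C10 H1] := kernel_near n0 eps0.
have [C2 C20 H2] := kernel_far n0 gq0.
pose vol := (2 * `|Rm|) ^+ n.
have vol0 : 0 <= vol by rewrite exprn_ge0// mulr_ge0.
exists (C1 * (1 + vol) + powR 2 q * vol * C2).
  by rewrite !(addr_ge0, mulr_ge0) ?powR_ge0.
move=> u x0 r d K mu ub d1 r0 rRm K0 HD; have /andP[d0 dle1] := d1.
have Rm0 : 0 <= Rm by exact: le_trans rRm.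
have volr : (2 * r) ^+ n <= vol.
  by rewrite lerXn2r ?nnegrE ?mulr_ge0// ler_wpM2l// ger0_norm.
pose P (x y : V) := inb x0 r x * inb x0 r y *
  (powR `|u x - u y| q * powR (edist x y) (- (n%:R + gam * q))).
have mP : mf2 P by rewrite /P /inb; mtac.
have P0 x y : 0 <= P x y by rewrite !mulr_ge0 ?inb_ge0 ?powR_ge0.
rewrite /gagI -/(I2 P) -(I2_polar mP P0).
have mP' := measurable_polar mP; have mP2 := measurable_polarC mP.
rewrite I2C; [|exact: mP'|by move=> x z; exact: P0].
pose g1 (z : V) := ind (enorm z < 1) * powR (enorm z) ((tau - gam) * q - n%:R).
pose g2 (z : V) := ind (d <= enorm z) * powR (enorm z) (- (n%:R + gam * q)).
have mg1 : measurable_fun setT g1 by rewrite /g1; mtac.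
have mg2 : measurable_fun setT g2 by rewrite /g2; mtac.
have g10 z : 0 <= g1 z by rewrite mulr_ge0 ?ind_ge0 ?powR_ge0.
have g20 z : 0 <= g2 z by rewrite mulr_ge0 ?ind_ge0 ?powR_ge0.
have c10 : 0 <= K + vol by exact: addr_ge0.
have c20 : 0 <= powR 2 q * vol by rewrite mulr_ge0 ?powR_ge0.
have bound z : (I1 (fun x => P x (tadd x z)) <= ((K + vol) * g1 z + powR 2 q * vol * g2 z)%:E)%E.
  have G1 : 0 <= (K + vol) * g1 z by exact: mulr_ge0.
  have G2 : 0 <= powR 2 q * vol * g2 z by exact: mulr_ge0.
  have kz0 : 0 <= powR (enorm z) (- (n%:R + gam * q)) by exact: powR_ge0.
  have mPz : measurable_fun setT (fun x => P x (tadd x z)) by rewrite /P /inb; mtac.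
  have minb := measurable_inb x0 r.
  have [dz|zd] := leP d (enorm z).
    apply: (@le_trans _ _ (powR 2 q * vol * g2 z)%:E); last by rewrite lee_fin lerDr.
    set c := powR 2 q * powR (enorm z) (- (n%:R + gam * q)).
    have c0 : 0 <= c by rewrite mulr_ge0 ?powR_ge0.
    apply: (@le_trans _ _ (I1 (fun x => c * inb x0 r x)%R)).
      apply: I1_le; [exact: mPz|by rewrite /inb; mtac|by move=> x; exact: P0|].
      move=> x; rewrite /P /inb edist_taddr.
      have [xr|_] := ltP (edist x x0) r; last by rewrite !mul0r mulr0.
      have [yr|_] := ltP (edist (tadd x z) x0) r; last by rewrite mulr0 mul0r mulr1.
      rewrite !mul1r mulr1 ler_wpM2r//; apply: powR_le; [exact: ltW|by []|].
      have B1 := ub x xr; have B2 := ub _ yr.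
      by apply: le_trans (ler_normB _ _) _; have -> : (2 : R) = 1 + 1 by []; apply: lerD.
    rewrite (I1Z minb (inb_ge0 x0 r) c0).
    apply: (@le_trans _ _ (c%:E * vol%:E)%E).
      apply: lee_wpmul2l; first by rewrite lee_fin.
      by apply: le_trans (I1_ball x0 r0) _; rewrite lee_fin.
    rewrite -EFinM lee_fin /c /g2 dz mul1r.
    by rewrite le_eqVlt; apply/orP; left; apply/eqP; ring.
  apply: (@le_trans _ _ ((K + vol) * g1 z)%:E); last by rewrite lee_fin lerDl.
  have [z00|zn0] := eqVneq (enorm z) 0.
    rewrite (_ : I1 _ = I1 (fun x : V => 0 * inb x0 r x)%R).
      by rewrite (I1Z minb (inb_ge0 x0 r))// mul0e lee_fin.
    apply: eq_leb_int => x; rewrite /P edist_taddr z00 powR0 ?mulr0 ?mul0r//.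
    by rewrite oppr_eq0 gt_eqF// addr_gt0.
  have z0 : 0 < enorm z by rewrite lt_neqAle eq_sym zn0 enorm_ge0.
  pose f x := inb x0 r x * powR `|u (tadd x z) - u x| q.
  have mf : measurable_fun setT f by rewrite /f /inb; mtac.
  have f0 x : 0 <= f x by rewrite mulr_ge0 ?inb_ge0 ?powR_ge0.
  apply: (@le_trans _ _ (I1 (fun x => powR (enorm z) (- (n%:R + gam * q)) * f x)%R)).
    apply: I1_le; [exact: mPz|by mtac|by move=> x; exact: P0|].
    have GI (i1 i2 A k : R) : 0 <= i1 -> i2 <= 1 -> 0 <= A -> 0 <= k ->
        i1 * i2 * (A * k) <= k * (i1 * A).
      move=> i10 i21 A0 k0; have -> : i1 * i2 * (A * k) = i2 * (k * (i1 * A)) by ring.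
      by rewrite ler_piMl// mulr_ge0// mulr_ge0.
    move=> x; rewrite /P /f edist_taddr distrC.
    by apply: GI; [exact: inb_ge0|exact: ind_le1|exact: powR_ge0|exact: powR_ge0].
  rewrite (I1Z mf f0 kz0).
  have F := weight_bound mu z0 (ltW zd) (ltW q0) qQ r0 K0 HD.
  apply: (@le_trans _ _ ((powR (enorm z) (- (n%:R + gam * q)))%:E * ((K + vol) * powR (enorm z) (tau * q))%:E)%E).
    apply: lee_wpmul2l; first by rewrite lee_fin.
    by apply: le_trans F _; rewrite lee_fin ler_wpM2r ?powR_ge0// lerD2l.
  rewrite -EFinM lee_fin /g1 (lt_le_trans zd dle1) mul1r mulrCA ler_wpM2l//.
  rewrite -powRD_ne// le_eqVlt; apply/orP; left; apply/eqP; congr powR; ring.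
apply: (@le_trans _ _ (I1 (fun z => (K + vol) * g1 z + powR 2 q * vol * g2 z)%R)).
  apply: I2_le_I1; [exact: mP2|by mtac|by move=> z x; exact: P0| |exact: bound].
  by move=> z; apply: addr_ge0; exact: mulr_ge0.
clear bound; have I1g1 : (I1 g1 <= C1%:E)%E by exact: H1.
have I1g2 : (I1 g2 <= (C2 * powR d (- (n%:R + gam * q)))%:E)%E by exact: H2.
clearbody g1 g2 P vol.
rewrite I1D; [|by mtac|by mtac|by move=> z; exact: mulr_ge0|by move=> z; exact: mulr_ge0].
rewrite (I1Z mg1 g10 c10) (I1Z mg2 g20 c20).
set D := powR d (- (n%:R + gam * q)) in I1g2 *.
have D1 : 1 <= D by apply: powR_d_ge1 => //; rewrite addr_ge0// ltW.
apply: (@le_trans _ _ ((K + vol)%:E * C1%:E + (powR 2 q * vol)%:E * (C2 * D)%:E)%E).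
  by apply: leeD; apply: lee_wpmul2l; [rewrite lee_fin|exact: I1g1|rewrite lee_fin|exact: I1g2].
rewrite -!EFinM -EFinD lee_fin.
have D0 : 0 <= D by exact: le_trans D1.
move: (powR 2 q * vol) c20 => w w0.
apply: (@le_trans _ _ ((C1 * (K + vol) + w * C2) * D)).
  rewrite [leRHS]mulrDl mulrA lerD2r mulrC ler_peMr// mulr_ge0//.
rewrite ler_wpM2r// [leRHS]mulrDl; apply: lerD.
  rewrite -mulrA ler_wpM2l// -subr_ge0.
  have -> : (1 + vol) * (K + 1) - (K + vol) = 1 + vol * K by ring.
  by rewrite addr_ge0// mulr_ge0.
by rewrite ler_peMr ?mulr_ge0// lerDr.
Qed.

(** The decay of t - tau is kept as the invariant (t - tau) m <= (t - s_p) p: one step gives (t -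
    tau') Q = (t - tau) be, and be <= m. As m grows linearly in k, the gap is of order 1/k. *)
Lemma iterate (s1 sp p la Rm : R) : 0 < s1 < 1 -> 0 < sp < 1 -> 2 <= p -> 1 < la ->
  sp * p <= p - 1 -> 0 < 1 - sp * p + sp * ((p - 1) / la) ->
  let t := sp * p / (p - 1) in
  forall k : nat, exists m tau, [/\ m = p + k%:R * ((p - 1) * (1 - la^-1)),
    sp <= tau < t, (t - tau) * m <= (t - sp) * p &
    exists C kap, [/\ 0 <= C, 0 <= kap & forall (u : V -> R) Z x0 Rad d,
      normalized_solution x0 Rad s1 sp p u Z -> 0 < d <= 1 -> (4 * k%:R + 2) * d <= Rad ->
      Rad <= Rm ->
      diff_bound m tau x0 (Rad - d - 4 * k%:R * d) d (C * powR d (- kap)) u]].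
Proof.
move=> s1b spb p2 la1 spp eps0 t; have /andP[sp0 sp1] := spb.
have e0 : 0 < p - 1 by lra.
have p0 : 0 < p by lra.
have la0 : 0 < la by exact: lt_trans la1.
have laV : 0 < la^-1 by rewrite invr_gt0.
have laV1 : la^-1 < 1 by rewrite invf_lt1.
have spt : sp < t by rewrite /t ltr_pdivlMr// ltr_pM2l//; lra.
have t1 : t <= 1 by rewrite /t ler_pdivrMr// mul1r.
have tE : sp * p = t * (p - 1) by rewrite /t divfK// gt_eqF.
elim=> [|k [m [tau [mE /andP[sptau taut] decay [C [kap [C0 kap0 IH]]]]]]].
  (* The unit p-energy gives first differences with exponent p and rate s_p, after giving up a
     margin d. *)
  exists p, sp; split=> //; rewrite ?mul0r ?addr0 ?lexx ?spt//.
  have a0 : 0 <= n%:R + sp * p by rewrite addr_ge0// mulr_ge0// ltW.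
  have [C C0 H] := gagI_shift n0 p0 a0.
  exists C, 0; split=> // u Z x0 Rad d sol d1 dR RRm h h0 hd.
  have [[mu _ _] _ _ [_ gp] _] := sol.
  have := H u x0 Rad d 1 h mu ler01 h0 hd gp.
  rewrite oppr0 powRr0 !mulr1 mulr0 mul0r subr0.
  by have -> : n%:R + sp * p - n%:R = sp * p by ring.
set be := m - (p - 1) / la.
set Q := p - 1 + be.
set tau' := (sp * p + tau * be) / Q.
have kmu0 : 0 <= k%:R * ((p - 1) * (1 - la^-1)).
  by rewrite mulr_ge0// mulr_ge0 ?(ltW e0)// subr_ge0 ltW.
have pm : p <= m by rewrite mE lerDl.
have ela : (p - 1) / la < p - 1 by rewrite ltr_pdivrMr// ltr_pMr.
have be0 : 0 < be by rewrite /be; lra.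
have Q0 : 0 < Q by rewrite /Q; lra.
have tau0 : 0 <= tau by apply: le_trans sptau; exact: ltW.
have dtau : t - tau' = (t - tau) * be / Q.
  by rewrite /tau' tE /Q; field; rewrite gt_eqF.
have tau't : tau' < t by rewrite -subr_gt0 dtau divr_gt0// mulr_gt0// subr_gt0.
have tautau' : tau <= tau'.
  rewrite /tau' ler_pdivlMr// /Q mulrDr lerD2r tE ler_wpM2r// ?(ltW e0)//; exact: ltW.
exists Q, tau'; split.
- by rewrite /Q /be mE -[k.+1]addn1 natrD; ring.
- by rewrite tau't andbT; exact: le_trans tautau'.
- rewrite dtau divfK ?gt_eqF//; apply: le_trans decay.
  apply: ler_wpM2l; first by rewrite subr_ge0 ltW.
  by rewrite /be gerBl mulr_ge0 ?(ltW e0)// ltW.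
have eps' : 0 < 1 - sp * p + tau * ((p - 1) / la).
  apply: lt_le_trans eps0 _; rewrite lerD2l ler_wpM2r// divr_ge0// ltW//.
have tau'1 : tau' < 1 by exact: lt_le_trans tau't t1.
have [C' [kap' [C'0 kap'0 H]]] := improvement n0 Rm s1b spb p2 la1 pm tau0 eps' tau'1.
exists (C' * (C + 1)), (kap' + kap); split; [by rewrite mulr_ge0// addr_ge0|exact: addr_ge0|].
move=> u Z x0 Rad d sol d1 dR RRm; have /andP[d0 dle1] := d1.
have [[mu _ _] _ _ _ _] := sol.
rewrite -[k.+1]addn1 natrD in dR *.
have kd : (4 * k%:R + 2) * d <= Rad.
  by apply: le_trans dR; rewrite ler_wpM2r ?(ltW d0)//; lra.
have D0 := IH u Z x0 Rad d sol d1 kd RRm.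
(* A step costs four widths d: one here, to present the current radius as rho + d, and three in the
   improvement. *)
set rho := Rad - d - 4 * k%:R * d - d.
have D1 : diff_bound m tau x0 (rho + d) d (C * powR d (- kap)) u by rewrite /rho subrK.
have rho0 : 0 <= rho by rewrite /rho; move: dR; rewrite !mulrDl !mulrDr; lra.
have kd0 : 0 <= 4 * k%:R * d by rewrite !mulr_ge0// ltW.
have rhoR : rho + d + d <= Rad by rewrite /rho; lra.
have K0 : 0 <= C * powR d (- kap) by rewrite mulr_ge0 ?powR_ge0.
have D2 := H u Z x0 Rad rho d _ sol d1 rho0 rhoR RRm K0 D1.
apply: diff_bound_le D2 => //.
  by rewrite /rho; lra.
rewrite opprD (powRD_ne _ _ (lt0r_neq0 d0)) -!mulrA ler_wpM2l// [leRHS]mulrCA ler_wpM2l ?powR_ge0//.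
rewrite mulrDl mul1r lerD2l; exact: powR_d_ge1.
Qed.

Lemma normalized_regularity (s1 sp p q gam Rm : R) : 0 < s1 < 1 -> 2 <= p ->
  0 < sp <= (p - 1) / p -> p <= q -> 0 < gam < sp * p / (p - 1) ->
  exists (N : nat) (C kap : R), [/\ 0 <= C, 0 <= kap & forall (u : V -> R) Z x0 Rad r d,
    normalized_solution x0 Rad s1 sp p u Z -> 0 < d <= 1 -> 0 < r ->
    r + N%:R * d <= Rad -> Rad <= Rm ->
    (gagI x0 r q (n%:R + gam * q) u <= (C * powR d (- kap))%:E)%E].
Proof.
move=> s1b p2 /andP[sp0 spp] pq /andP[gam0 gamt].
have e0 : 0 < p - 1 by lra.
have p0 : 0 < p by lra.
have spp' : sp * p <= p - 1 by rewrite -ler_pdivlMr.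
have sp1 : sp < 1 by apply: le_lt_trans spp _; rewrite ltr_pdivrMr//; lra.
have spb : 0 < sp < 1 by rewrite sp0.
have q0 : 0 < q by exact: lt_le_trans pq.
(* With 1/la >= 1 - mu, the condition on la follows from 1 - sp - sp (1 - sp)/2 = (1 - sp)(1 - sp/2)
   > 0. *)
pose mu := (1 - sp) / (2 * (p - 1)).
have mu0 : 0 < mu by rewrite divr_gt0 ?subr_gt0// mulr_gt0.
pose la := 1 + mu.
have la1 : 1 < la by rewrite ltrDl.
have la0 : 0 < la by exact: lt_trans la1.
have eps0 : 0 < 1 - sp * p + sp * ((p - 1) / la).
  have L : 1 - mu <= la^-1.
    rewrite -div1r ler_pdivlMr// /la.
    have -> : (1 - mu) * (1 + mu) = 1 - mu ^+ 2 by ring.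
    by rewrite gerBl sqr_ge0.
  have E : mu * (p - 1) = (1 - sp) / 2 by rewrite /mu; field; rewrite gt_eqF.
  have H : sp * ((p - 1) * (1 - mu)) <= sp * ((p - 1) / la).
    by rewrite ler_wpM2l ?(ltW sp0)// ler_wpM2l// ltW.
  have F : sp * ((p - 1) * (1 - mu)) = sp * (p - 1) - sp * ((1 - sp) / 2).
    by rewrite -E; ring.
  have P : 0 < (1 - sp) * (1 - sp / 2) by rewrite mulr_gt0//; lra.
  rewrite F in H; move: H P; move: (sp * ((p - 1) / la)) => X; clear; lra.
set t := sp * p / (p - 1) in gamt.
pose muu := (p - 1) * (1 - la^-1).
have muu0 : 0 < muu by rewrite mulr_gt0// subr_gt0 invf_lt1.
have tg0 : 0 < t - gam by rewrite subr_gt0.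
(* Number of steps: the first summand secures m >= q, the second makes (t - sp) p/m smaller than t -
   gam, hence tau > gam. *)
pose B := q / muu + ((t - sp) * p) / (t - gam) / muu.
have [k kB] : exists k : nat, B < k%:R.
  exists (Num.bound `|B|); apply: le_lt_trans (ler_norm B) _.
  exact: archi_boundP.
have [m [tau [mE /andP[sptau taut] decay [C [kap [C0 kap0 H]]]]]] :=
  iterate Rm s1b spb p2 la1 spp' eps0 k.
have spt : 0 < t - sp by rewrite subr_gt0; exact: le_lt_trans sptau taut.
have B2 : 0 <= (t - sp) * p / (t - gam) by rewrite divr_ge0 ?mulr_ge0// ltW.
have km : q + (t - sp) * p / (t - gam) < k%:R * muu.
  by rewrite -ltr_pdivrMr// mulrDl.
have qm : q <= m by rewrite mE; rewrite -/muu; lra.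
have m0 : 0 < m by exact: lt_le_trans qm.
have gtau : gam < tau.
  rewrite ltNge; apply/negP => taug.
  have : (t - gam) * m <= (t - sp) * p.
    by apply: le_trans decay; rewrite ler_wpM2r ?(ltW m0)// lerD2l lerN2.
  rewrite mulrC -ler_pdivlMr// leNgt => /negP; apply.
  by rewrite mE -/muu; lra.
have [C1 C10 H1] := seminorm_of_diff Rm q0 qm gam0 gtau.
have nq0 : 0 <= n%:R + gam * q by rewrite addr_ge0// mulr_ge0// ltW.
exists (4 * k + 2)%N, (C1 * (C + 1)), (kap + (n%:R + gam * q)); split.
- by rewrite mulr_ge0// addr_ge0.
- exact: addr_ge0.
move=> u Z x0 Rad r d sol d1 r0 rR RRm; have /andP[d0 dle1] := d1.
have [[mu' ub _] _ _ _ _] := sol.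
rewrite natrD natrM in rR.
have kd : (4 * k%:R + 2) * d <= Rad by apply: le_trans rR; rewrite lerDr ltW.
have D := H u Z x0 Rad d sol d1 kd RRm.
have kd0 : 0 <= 4 * k%:R * d by rewrite !mulr_ge0// ltW.
have rR' : r <= Rad - d - 4 * k%:R * d by move: rR; rewrite mulrDl; lra.
have D' := diff_bound_le mu' rR' (lexx d) (lexx _) D.
have rRad : r <= Rad by lra.
have ub' x : edist x x0 < r -> `|u x| <= 1 by move=> xr; apply: ub; exact: lt_le_trans rRad.
have K0 : 0 <= C * powR d (- kap) by rewrite mulr_ge0 ?powR_ge0.
apply: le_trans (H1 u x0 r d _ mu' ub' d1 (ltW r0) (le_trans rRad RRm) K0 D') _.
rewrite lee_fin (opprD kap) (powRD_ne _ _ (lt0r_neq0 d0)) [leRHS]mulrA ler_wpM2r ?powR_ge0// -mulrA ler_wpM2l//.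
rewrite mulrDl mul1r lerD2l; exact: powR_d_ge1.
Qed.

End NormalizedRegularity.

(** * Null sets in R^n and in the product *)

Section NullSets.
Context {R : realType} {n : nat}.
Local Notation V := (n.-tuple R).

Definition negligible1 (B : set V) := measurable B /\ leb_int (fun x => (\1_B x)%:E : \bar R) = 0%E.
Definition negligible2 (B : set (V * V)) := measurable B /\
  leb_int (fun x => leb_int (fun y => (\1_B (x, y))%:E : \bar R)) = 0%E.

Lemma indic_ereal_ge0 T (B : set T) x : (0 <= (\1_B x : R)%:E)%E.
Proof. by rewrite lee_fin. Qed.

Lemma measurable_indicE d (T : measurableType d) (B : set T) : measurable B ->
  measurable_fun setT (fun x => (\1_B x : R)%:E).
Proof. by move=> mB; apply: measurable_EFinc; exact: measurable_indic. Qed.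

Lemma mf2_indic (B : set (V * V)) : measurable B -> mf2 (fun x y => \1_B (x, y) : R).
Proof.
by move=> mB; under eq_fun do rewrite -surjective_pairing; exact: measurable_indic.
Qed.

(** The pointwise majorant is g plus infinity times the indicator of B; the added term integrates to
    0 because infinity times 0 is 0. *)
Lemma I1_ae_le (B : set V) (f g : V -> R) : negligible1 B ->
  measurable_fun setT f -> measurable_fun setT g ->
  (forall x, 0 <= f x) -> (forall x, 0 <= g x) ->
  (forall x, ~ B x -> f x <= g x) -> (I1 f <= I1 g)%E.
Proof.
move=> [mB B0] mf mg f0 g0 H.
have mi := measurable_indicE mB.
have moi : measurable_fun setT (fun x => (+oo * (\1_B x : R)%:E)%E) by exact: measurable_funeM.
have oi0 x : (0 <= +oo * (\1_B x : R)%:E)%E by rewrite mule_ge0.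
have E : leb_int (fun x => (+oo * (\1_B x : R)%:E)%E) = 0%E.
  by rewrite leb_intZl// ?B0 ?mule0// => x; exact: indic_ereal_ge0.
have g0' x : (0 <= (g x)%:E)%E by rewrite lee_fin.
apply: (@le_trans _ _ (leb_int (fun x => ((g x)%:E + +oo * (\1_B x : R)%:E)%E))); last first.
  by rewrite leb_intD//; [rewrite E adde0|exact: measurable_EFinc].
apply: le_leb_int.
- exact: measurable_EFinc.
- by apply: emeasurable_funD => //; exact: measurable_EFinc.
- by move=> x; rewrite lee_fin.
- move=> x; have [Bx|nBx] := pselect (B x).
    by rewrite indicE mem_set// mule1 addeC leey.
  by rewrite indicE memNset// mule0 adde0 lee_fin; exact: H.
Qed.

Lemma I2_ae_le (B : set (V * V)) (F G : V -> V -> R) : negligible2 B -> mf2 F -> mf2 G ->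
  (forall x y, 0 <= F x y) -> (forall x y, 0 <= G x y) ->
  (forall x y, ~ B (x, y) -> F x y <= G x y) -> (I2 F <= I2 G)%E.
Proof.
move=> [mB B0] mF mG F0 G0 H.
have mi := measurable_indicE mB.
have mis : forall x, measurable_fun setT (fun y => (\1_B (x, y) : R)%:E).
  by move=> x; apply: measurable_EFinc; exact: (measurable_slice1 x (mf2_indic mB)).
have mii : measurable_fun setT (fun x => leb_int (fun y => (\1_B (x, y) : R)%:E)).
  by apply: (@measurable_leb_int R _ V n (fun w => (\1_B w : R)%:E)) => // w; exact: indic_ereal_ge0.
have ii0 x : (0 <= leb_int (fun y => (\1_B (x, y) : R)%:E))%E.
  by apply: leb_int_ge0 => y; exact: indic_ereal_ge0.
have E : leb_int (fun x => (+oo * leb_int (fun y => (\1_B (x, y) : R)%:E))%E) = 0%E.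
  by rewrite leb_intZl// ?B0 ?mule0.
have mGG := measurable_I1_slice mG G0.
have GG0 x : (0 <= leb_int (fun y => (G x y)%:E))%E.
  by apply: leb_int_ge0 => y; rewrite lee_fin.
apply: (@le_trans _ _ (leb_int (fun x => (leb_int (fun y => (G x y)%:E) +
    +oo * leb_int (fun y => (\1_B (x, y) : R)%:E))%E))); last first.
  rewrite leb_intD//; first by rewrite E adde0.
  - exact: measurable_funeM.
  - by move=> x; rewrite mule_ge0.
apply: le_leb_int.
- exact: measurable_I1_slice.
- by apply: emeasurable_funD => //; exact: measurable_funeM.
- by move=> x; apply: leb_int_ge0 => y; rewrite lee_fin.
move=> x; rewrite -leb_intZl//.
have mGx : measurable_fun setT (fun y => (G x y)%:E).
  by apply: measurable_EFinc; exact: measurable_slice1.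
rewrite -leb_intD//; first 1 last.
- exact: measurable_funeM.
- by move=> y; rewrite lee_fin.
apply: le_leb_int.
- by apply: measurable_EFinc; exact: measurable_slice1.
- by apply: emeasurable_funD => //; exact: measurable_funeM.
- by move=> y; rewrite lee_fin.
- move=> y; have [Bx|nBx] := pselect (B (x, y)).
    by rewrite indicE mem_set// mule1 addeC leey.
  by rewrite indicE memNset// mule0 adde0 lee_fin; exact: H.
Qed.

Lemma I2_ae_eq (B : set (V * V)) (F G : V -> V -> R) : negligible2 B -> mf2 F -> mf2 G ->
  (forall x y, 0 <= F x y) -> (forall x y, 0 <= G x y) ->
  (forall x y, ~ B (x, y) -> F x y = G x y) -> I2 F = I2 G.
Proof.
move=> B0 mf mg f0 g0 H; apply/eqP; rewrite eq_le; apply/andP; split.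
  by apply: (I2_ae_le B0) => // x y /H ->.
by apply: (I2_ae_le B0) => // x y /H ->.
Qed.

Lemma negligible2U (A B : set (V * V)) : negligible2 A -> negligible2 B -> negligible2 (A `|` B).
Proof.
move=> [mA A0] [mB B0]; split; first exact: measurableU.
have mi (C : set (V * V)) := @mf2_indic C.
have i0 (C : set (V * V)) (x y : V) : 0 <= (\1_C (x, y) : R) by [].
have H : (I2 (fun x y => \1_(A `|` B) (x, y) : R) <=
    I2 (fun x y => (\1_A (x, y) + \1_B (x, y))%R))%E.
  apply: I2_le => //; [exact: (mi _ (measurableU _ _ mA mB))|exact: (@mf2_add _ _ (fun x y => \1_A (x, y)) (fun x y => \1_B (x, y)) (mi _ mA) (mi _ mB))|].
  move=> x y; rewrite !indicE in_setU.
  by case: (_ \in A); case: (_ \in B); rewrite /= ?addr0 ?add0r// lerDl.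
rewrite (I2D (mi _ mA) (mi _ mB))// in H.
have E1 : I2 (fun x y => \1_A (x, y) : R) = 0%E by exact: A0.
have E2 : I2 (fun x y => \1_B (x, y) : R) = 0%E by exact: B0.
rewrite E1 E2 adde0 in H.
by apply/eqP; rewrite eq_le H/=; apply: I2_ge0.
Qed.

(** The fibers have the full, possibly infinite, measure of R^n; the product with the measure 0 of B
    is 0 by convention. *)
Lemma negligible2_fst (B : set V) : negligible1 B -> negligible2 [set w | B w.1].
Proof.
move=> [mB B0]; split.
  by rewrite -[X in measurable X]setTI; exact: (@measurable_fst _ _ V V measurableT B mB).
have mi := measurable_indicE mB.
transitivity (leb_int (fun x : V => (leb_int (fun _ : V => 1%E : \bar R) * (\1_B x : R)%:E)%E)).
  apply: eq_leb_int => x; rewrite muleC -leb_intZl//.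
  by apply: eq_leb_int => y; rewrite mule1 !indicE; congr (_%:R%:E); apply/idP/idP; rewrite !inE.
rewrite leb_intZl//; [by rewrite B0 mule0|by apply: leb_int_ge0].
Qed.

Lemma negligible2_snd (B : set V) : negligible1 B -> negligible2 [set w | B w.2].
Proof.
move=> [mB B0]; split.
  by rewrite -[X in measurable X]setTI; exact: (@measurable_snd _ _ V V measurableT B mB).
transitivity (leb_int (fun x : V => 0%E : \bar R)).
  apply: eq_leb_int => x; rewrite -[RHS]B0.
  by apply: eq_leb_int => y; rewrite !indicE; congr (_%:R%:E); apply/idP/idP; rewrite !inE.
transitivity (leb_int (fun x : V => (0 * 0)%E : \bar R)).
  by apply: eq_leb_int => x; rewrite mule0.
by rewrite leb_intZl// mul0e.
Qed.

(** Transfers a tested equation from (u, Z) to the normalized pair: the integrands agree off a null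
    set up to the common factor A^(1-p). *)
Lemma S2_ae_scale (B : set (V * V)) (c : R) (F G : V -> V -> R) : negligible2 B ->
  mf2 F -> mf2 G -> 0 < c -> (forall x y, ~ B (x, y) -> F x y = c * G x y) ->
  (abs_int2 G < +oo)%E -> (abs_int2 F < +oo)%E /\ S2 F = c * S2 G.
Proof.
move=> B0 mF mG c0 H fG.
have c0' : 0 <= c by exact: ltW.
have maxM (t : R) : Num.max (c * t) 0 = c * Num.max t 0 by rewrite maxr_pMr// mulr0.
have mcp : mf2 (fun x y => c * Num.max (G x y) 0) by mtac.
have mcn : mf2 (fun x y => c * Num.max (- G x y) 0) by mtac.
have mca : mf2 (fun x y => c * `|G x y|) by mtac.
have P : I2 (fun x y => Num.max (F x y) 0) = (c%:E * I2 (fun x y => Num.max (G x y) 0)%R)%E.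
  rewrite -(I2Z (mf2_pos mG) (fun x y => max0_ge0 _) c0').
  apply: (I2_ae_eq B0 (mf2_pos mF) mcp); [by move=> x y; exact: max0_ge0| |].
    by move=> x y; rewrite mulr_ge0// max0_ge0.
  by move=> x y /H ->; rewrite maxM.
have N : I2 (fun x y => Num.max (- F x y) 0) = (c%:E * I2 (fun x y => Num.max (- G x y) 0)%R)%E.
  rewrite -(I2Z (mf2_neg mG) (fun x y => max0_ge0 _) c0').
  apply: (I2_ae_eq B0 (mf2_neg mF) mcn); [by move=> x y; exact: max0_ge0| |].
    by move=> x y; rewrite mulr_ge0// max0_ge0.
  by move=> x y /H ->; rewrite -mulrN maxM.
have A : abs_int2 F = (c%:E * abs_int2 G)%E.
  rewrite /abs_int2 -(I2Z (mf2_abs mG))//.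
  apply: (I2_ae_eq B0 (mf2_abs mF) mca) => //.
    by move=> x y; rewrite mulr_ge0.
  by move=> x y /H ->; rewrite normrM (ger0_norm c0').
split; first by rewrite A lte_mul_pinfty.
rewrite /S2 P N -(fineK (pos_fin mG fG)) -(fineK (neg_fin mG fG)) -!EFinM /=.
by rewrite mulrBr.
Qed.

End NullSets.

(** * From the definitions of the statement to a normalized solution *)

Section Conversion.
Context {R : realType} {n : nat}.
Hypothesis n0 : (0 < n)%N.
Local Notation V := (n.-tuple R).

Lemma indic_eball (x0 : V) r x : \1_(eball x0 r) x = inb x0 r x :> R.
Proof.
rewrite indicE /inb /ind; case: ifP => H; first by rewrite mem_set.
by rewrite memNset// /eball/= H.
Qed.

Lemma indic_eballC (x0 : V) r x : \1_(~` eball x0 r) x = ind (r <= edist x x0) :> R.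
Proof.
rewrite indicE /ind leNgt; case: ifP => H.
  by rewrite mem_set// /eball/= => H'; rewrite H' in H.
by rewrite memNset// /eball/= => /negP; rewrite H.
Qed.

Lemma gag_qE (g q : R) (x0 : V) r (w : V -> R) : measurable_fun setT w ->
  gag_q g q (eball x0 r) w = gagI x0 r q (n%:R + g * q) w.
Proof.
move=> mw; apply: eq_leb_int => x.
have mg : measurable_fun setT (fun y => inb x0 r y * (powR `|w x - w y| q * powR (edist x y) (- (n%:R + g * q)))).
  by rewrite /inb; mtac.
rewrite indic_eball; transitivity ((inb x0 r x)%:E * I1 (fun y => inb x0 r y * (powR `|w x - w y| q * powR (edist x y) (- (n%:R + g * q))))%R)%E.
  by congr (_ * _)%E; apply: eq_leb_int => y; rewrite indic_eball powRN EFinM.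
rewrite -I1Z ?inb_ge0//; last by move=> y; rewrite !mulr_ge0 ?inb_ge0 ?powR_ge0.
by apply: eq_leb_int => y; congr EFin; ring.
Qed.

Lemma gag_qTE (g q : R) (w : V -> R) :
  gag_q g q setT w = I2 (fun x y => powR `|w x - w y| q * powR (edist x y) (- (n%:R + g * q))).
Proof.
apply: eq_leb_int => x; rewrite indicT mul1e; apply: eq_leb_int => y.
by rewrite mul1e powRN.
Qed.

Lemma in_W_setT (s q : R) (phi : V -> R) : Wfin s q phi -> in_W s q setT phi.
Proof.
move=> [H1 H2]; split; last by rewrite gag_qTE.
rewrite /int_on (_ : leb_int _ = I1 (fun x => powR `|phi x| q))//.
by apply: eq_leb_int => x; rewrite indicT mul1e.
Qed.

Lemma integrable2E (g : V -> V -> R) : integrable2 g <-> (abs_int2 g < +oo)%E.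
Proof.
rewrite /integrable2 (_ : dint_on _ _ _ = abs_int2 g)//.
apply: eq_leb_int => x; rewrite indicT mul1e; apply: eq_leb_int => y.
by rewrite mul1e.
Qed.

Lemma sint2E (g : V -> V -> R) : sint2 g = S2 g.
Proof.
by congr (fine _ - fine _); apply: eq_leb_int => x; rewrite indicT mul1e; apply: eq_leb_int => y;
  rewrite mul1e.
Qed.

Lemma Jp_scale (e A t : R) : 0 < e -> 0 < A -> Jp e (t / A) = powR A (- e) * Jp e t.
Proof.
move=> e0 A0; have AV : 0 < A^-1 by rewrite invr_gt0.
have nA : A != 0 by rewrite gt_eqF.
rewrite /Jp normrM (gtr0_norm AV) powRM ?(ltW AV)//.
have E : powR A (-1) = A^-1 by rewrite powR_inv1 ?(ltW A0).
rewrite -E -powRrM.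
have -> : powR A (- e) = powR A (-1 * (e - 1)) * powR A (-1).
  by rewrite -powRD_ne//; congr powR; ring.
ring.
Qed.

(* Agrees with z when z is in sgn t, and is monotone in t whatever z is: replacing Z x y
   by sgnz (u x - u y) (Z x y) makes the sign field monotone everywhere, not only a.e. *)
Definition sgnz (t z : R) : R :=
  ind (0 < t) - ind (t < 0) + ind (t <= 0) * ind (0 <= t) * Num.max (-1) (Num.min 1 z).

Lemma clamp_norm (z : R) : -1 <= Num.max (-1) (Num.min 1 z) <= 1.
Proof. by rewrite le_max lexx/= ge_max ge_min lexx/= andbT; lra. Qed.

Lemma sgnz_pos (t z : R) : 0 < t -> sgnz t z = 1.
Proof. by move=> t0; rewrite /sgnz t0 ltNge (ltW t0) leNgt t0/= !mul0r subr0 addr0. Qed.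
Lemma sgnz_neg (t z : R) : t < 0 -> sgnz t z = -1.
Proof. by move=> t0; rewrite /sgnz t0 ltNge (ltW t0) (leNgt 0 t) t0/= mulr0 mul0r sub0r addr0. Qed.
Lemma sgnz0 (z : R) : sgnz 0 z = Num.max (-1) (Num.min 1 z).
Proof. by rewrite /sgnz ltxx lexx/= !mul1r subr0 add0r. Qed.

Lemma sgnz_bounds (t z : R) : -1 <= sgnz t z <= 1.
Proof.
have [t0|t0|->] := ltrgt0P t; last by rewrite sgnz0 clamp_norm.
- by rewrite sgnz_pos//; lra.
- by rewrite sgnz_neg//; lra.
Qed.

Lemma sgnz_mono (t t' z z' : R) : t < t' -> sgnz t z <= sgnz t' z'.
Proof.
move=> tt'; have [t0|t0] := ltP 0 t'; last first.
  by rewrite (sgnz_neg _ (lt_le_trans tt' t0)); have /andP[] := sgnz_bounds t' z'.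
by rewrite (sgnz_pos _ t0); have /andP[] := sgnz_bounds t z.
Qed.

Lemma sgnz_id (t z : R) : in_sgn z t -> sgnz t z = z.
Proof.
move=> [H1 H2 H3]; have [t0|t0|t0] := ltrgt0P t.
- by rewrite sgnz_pos// H1.
- by rewrite sgnz_neg// H2.
- by rewrite t0 sgnz0 min_r ?max_r//; have /andP[] := H3 t0.
Qed.

Lemma in_sgn_div (z t A : R) : 0 < A -> in_sgn z t -> in_sgn z (t / A).
Proof.
move=> A0 [H1 H2 H3]; split => [|| /eqP].
- by rewrite pmulr_lgt0 ?invr_gt0.
- by rewrite pmulr_llt0 ?invr_gt0.
- by rewrite mulf_eq0 invr_eq0 (gt_eqF A0) orbF => /eqP.
Qed.

Lemma null1_negligible (S : set V) : null1 S -> exists2 B, negligible1 B & S `<=` B.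
Proof.
move=> [B [mB SB B0]]; exists B => //; split => //; rewrite -[RHS]B0.
by apply: eq_leb_int => x; rewrite mule1.
Qed.

Lemma ae_on_all (A : set V) (P : V -> Prop) : (forall x, A x -> P x) -> ae_on A P.
Proof.
move=> H; exists set0; split; first exact: measurable0.
  by move=> x [/H].
transitivity (leb_int (fun _ : V => 0 * 0 : \bar R)%E).
  by apply: eq_leb_int => x; rewrite indicE in_set0 !mul0e.
by rewrite leb_intZl// mul0e.
Qed.

Lemma gag_q_scale (g q A : R) (x0 : V) r (w w' : V -> R) (B : set V) : 0 < A ->
  measurable_fun setT w -> measurable_fun setT w' -> negligible1 B ->
  (forall x, ~ B x -> w' x = w x / A) ->
  gag_q g q (eball x0 r) w = ((powR A q)%:E * gagI x0 r q (n%:R + g * q) w')%E.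
Proof.
move=> A0 mw mw' B0 H; rewrite gag_qE//.
pose a := n%:R + g * q.
pose F (v : V -> R) (x y : V) := inb x0 r x * inb x0 r y * (powR `|v x - v y| q * powR (edist x y) (- a)).
have mF v : measurable_fun setT v -> mf2 (F v) by move=> mv; rewrite /F /inb; mtac.
have F0 v x y : 0 <= F v x y by rewrite !mulr_ge0 ?inb_ge0 ?powR_ge0.
rewrite -[gagI x0 r q _ w']/(I2 (F w')) -(I2Z (mF _ mw')) ?powR_ge0//.
have mG : mf2 (fun x y => powR A q * F w' x y) by have mFw := mF _ mw'; clearbody F; mtac.
apply: (I2_ae_eq (negligible2U (negligible2_fst B0) (negligible2_snd B0)) (mF _ mw) mG (F0 w)).
  by move=> x y; rewrite mulr_ge0 ?powR_ge0.
move=> x y nB; rewrite /F !H; [|by move=> By; apply: nB; right|by move=> Bx; apply: nB; left].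
rewrite -mulrBl normrM [`|A^-1|]ger0_norm ?invr_ge0 ?(ltW A0)//.
rewrite powRM ?invr_ge0 ?(ltW A0)//.
have -> : powR A^-1 q = powR A (- q).
  by rewrite -(powR_inv1 (ltW A0)) -powRrM mulN1r.
have E : powR A q * powR A (- q) = 1 by rewrite powRN divff// gt_eqF ?powR_gt0.
transitivity ((powR A q * powR A (- q)) * (inb x0 r x * inb x0 r y * (powR `|w x - w y| q * powR (edist x y) (- a)))); last by ring.
by rewrite E mul1r.
Qed.

Lemma normalization (s1 sp p A Rad : R) (x0 : V) (Om : set V) (u : V -> R) :
  2 <= p -> 0 < Rad -> ecball x0 Rad `<=` Om -> 1 <= A ->
  weak_solution s1 sp p Om u ->
  ae_on (eball x0 Rad) (fun x => `|u x| <= A) ->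
  (int_on (~` eball x0 Rad)
     (fun x => (powR `|u x| (p - 1) / powR (edist x x0) (n%:R + sp * p))%:E) <=
     (powR A (p - 1) * powR Rad (- (sp * p)))%:E)%E ->
  (gag_q sp p (eball x0 Rad) u <= (powR A p)%:E)%E ->
  exists u' Z', normalized_solution x0 Rad s1 sp p u' Z' /\
    exists2 B, negligible1 B & forall x, ~ B x -> u' x = u x / A.
Proof.
move=> p2 Rad0 RO A1 [mu W1 Wp _ [Z [mZ _ [BZ [mBZ BZ1 BZ0]] WE]]].
have A0 : 0 < A by apply: lt_le_trans A1.
move=> /null1_negligible[B B0 BA] Ht Hg.
(* Set to 0 on the null set of the ball where |u| > A, so that |u'| <= 1 holds at every point of the
   ball. *)
pose u' x := (1 - inb x0 Rad x * ind (A < `|u x|)) * (u x / A).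
have mu' : measurable_fun setT u' by rewrite /u' /inb; mtac.
have u'B x : ~ B x -> u' x = u x / A.
  move=> nB; rewrite /u' /inb /ind; case: (boolP (edist x x0 < Rad)) => xR; last by rewrite mul0r subr0 mul1r.
  case: (boolP (A < _)) => uA; last by rewrite mulr0 subr0 mul1r.
  by exfalso; apply: nB; apply: BA; split => //; apply/negP; rewrite -ltNge.
have u'1 x : edist x x0 < Rad -> `|u' x| <= 1.
  move=> xR; rewrite /u' /inb /ind xR mul1r; case: (boolP (A < _)) => uA.
    by rewrite subrr mul0r normr0.
  rewrite subr0 mul1r normrM [`|A^-1|]gtr0_norm ?invr_gt0// ler_pdivrMr// mul1r.
  by rewrite leNgt.
clearbody u'.
(* Homogeneity of the p-Laplacian flux: dividing u by A multiplies it by A^(1-p), and the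
   1-Laplacian term must carry the same factor. It is at most 1 because A >= 1. *)
pose cA := powR A (1 - p).
have cA0 : 0 < cA by exact: powR_gt0.
have cAE : powR A (- (p - 1)) = cA by rewrite opprB.
have cA1 : cA <= 1.
  by rewrite -cAE powRN invf_le1 ?powR_gt0// powR_ge1//; lra.
pose Z' x y := cA * sgnz (u' x - u' y) (Z x y).
have mZ' : mf2 Z' by rewrite /Z' /sgnz; mtac.
have N2 := negligible2U (conj mBZ BZ0 : negligible2 BZ)
  (negligible2U (negligible2_fst B0) (negligible2_snd B0)).
exists u', Z'; split; last by exists B.
split.
- split => //.
  pose f (v : V -> R) y := ind (Rad <= edist y x0) * (powR `|v y| (p - 1) * powR (edist y x0) (- (n%:R + sp * p))).
  have mf v : measurable_fun setT v -> measurable_fun setT (f v) by move=> mv; rewrite /f; mtac.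
  have f0 v x : 0 <= f v x by rewrite !mulr_ge0 ?ind_ge0 ?powR_ge0.
  have E : int_on (~` eball x0 Rad) (fun x => (powR `|u x| (p - 1) / powR (edist x x0) (n%:R + sp * p))%:E) = I1 (f u).
    by apply: eq_leb_int => y; rewrite indic_eballC /f powRN.
  rewrite E in Ht.
  have mcf : measurable_fun setT (fun x => cA * f u x) by have mfu := mf _ mu; clearbody f; mtac.
  apply: (@le_trans _ _ (cA%:E * I1 (f u))%E); last first.
    apply: (@le_trans _ _ (cA%:E * (powR A (p - 1) * powR Rad (- (sp * p)))%:E)%E).
      by rewrite lee_pmul2l ?lte_fin.
    rewrite -EFinM lee_fin mulrA -cAE powRN mulVf ?mul1r// gt_eqF// powR_gt0//.
  rewrite -(I1Z (mf _ mu)) ?(ltW cA0)//.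
  apply: (I1_ae_le B0 (mf _ mu') mcf) => // [x|x nB].
    by rewrite mulr_ge0 ?(ltW cA0).
  rewrite /f u'B// normrM [`|A^-1|]ger0_norm ?invr_ge0 ?(ltW A0)//.
  rewrite powRM ?invr_ge0 ?(ltW A0)//.
  have -> : powR A^-1 (p - 1) = cA.
    by rewrite -(powR_inv1 (ltW A0)) -powRrM mulN1r cAE.
  by rewrite le_eqVlt; apply/orP; left; apply/eqP; ring.
- split => // x y; rewrite /Z' normrM (gtr0_norm cA0) mulr_ile1 ?(ltW cA0)//.
  by rewrite ler_norml sgnz_bounds.
- by move=> x y x' y' /sgnz_mono H; rewrite /Z' ler_pM2l.
- split.
    have [_] := W1 _ _ (conj Rad0 RO).
    rewrite (gag_q_scale _ _ _ _ A0 mu mu' B0 u'B).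
    case: (gagI x0 Rad 1 _ u') => [z||]; rewrite ?ltry ?ltNyr//.
    by rewrite mulry gtr0_sg ?powR_gt0// mul1e.
  move: Hg; rewrite (gag_q_scale _ _ _ _ A0 mu mu' B0 u'B).
  by rewrite -[in leRHS](mule1 (powR A p)%:E) lee_pmul2l// lte_fin powR_gt0.
- move=> phi mphi phi0 phi1 phip.
  have aeO : ae_on (~` Om) (fun x => phi x = 0).
    apply: ae_on_all => x nO; apply: phi0; rewrite leNgt; apply/negP => xR; apply: nO.
    by apply: RO; exact: ltW.
  have [] := WE phi mphi (conj (in_W_setT phi1) aeO) (conj (in_W_setT phip) aeO).
  set g1 := (fun x y => _); set g2 := (fun x y => _).
  move=> /integrable2E i1 /integrable2E i2; rewrite !sint2E => S0.
  have mg1 : mf2 g1 by rewrite /g1; mtac.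
  have mg2 : mf2 g2 by rewrite /g2; mtac.
  have [|-> ->] := S2_ae_scale N2 (mf2_flux1 s1 mZ' mphi) mg1 cA0 _ i1.
    move=> x y nN; rewrite /flux1 /Z' /g1 !u'B; last 2 first.
    + by move=> Bz; apply: nN; right; right.
    + by move=> Bz; apply: nN; right; left.
    rewrite -mulrBl sgnz_id; first by rewrite powRN -!mulrA.
    apply: in_sgn_div => //; apply: contrapT => nS; apply: nN; left; exact: BZ1.
  have [|-> ->] := S2_ae_scale N2 (mf2_flux2 (p - 1) (sp * p) mu' mphi) mg2 cA0 _ i2.
    move=> x y nN; rewrite /flux2 /g2 !u'B; last 2 first.
    + by move=> Bz; apply: nN; right; right.
    + by move=> Bz; apply: nN; right; left.
    rewrite -mulrBl Jp_scale//; last by lra.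
    rewrite cAE powRN /Jp (_ : p - 1 - 1 = p - 2); last by ring.
    by rewrite -!mulrA.
  by split => //; rewrite -mulrDr S0 mulr0.
Qed.

End Conversion.

(** * Amplitude, finiteness of its ingredients, and scaling back *)

Section Amplitude.
Context {R : realType} {n : nat}.
Hypothesis n0 : (0 < n)%N.
Local Notation V := (n.-tuple R).

Let nR0 : 0 < n%:R :> R. Proof. by rewrite ltr0n. Qed.

(** By compactness: otherwise points outside [Om] at distance at most rho + 1/(k+1) from x0 have a
    cluster point in the closed ball, near which the open set leaves no room for them. *)
Lemma ecball_enlarge (x0 : V) (rho : R) (Om : set V) : eopen Om ->
  ecball x0 rho `<=` Om -> exists2 rho', rho < rho' & ecball x0 rho' `<=` Om.
Proof.
move=> oO bO; apply: contrapT => nE.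
have [X HX] : {X : nat -> V & forall k, edist (X k) x0 <= rho + k.+1%:R^-1 /\ ~ Om (X k)}.
  apply: (@choice _ _ (fun k x => edist x x0 <= rho + k.+1%:R^-1 /\ ~ Om x)) => k.
  apply: contrapT => nX; apply: nE; exists (rho + k.+1%:R^-1); first by rewrite ltrDl invr_gt0.
  by move=> x xR; apply: contrapT => nO; apply: nX; exists x.
pose Y k : 'rV[R]_n := \row_i tnth (X k) i.
(* Compactness is taken from row vectors, where a product of segments is compact, and carried back
   to tuples coordinatewise. *)
pose box := [set v : 'rV[R]_n | forall i, `[tnth x0 i - (rho + 1), tnth x0 i + (rho + 1)]%classic (v ord0 i)].
have cbox : compact box.
  by apply: (@rV_compact R n (fun i => `[tnth x0 i - (rho + 1), tnth x0 i + (rho + 1)]%classic)) => i; exact: segment_compact.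
have edE (x y : V) : edist x y = enorm [tuple tnth x j - tnth y j | j < n].
  by congr Num.sqrt; apply: eq_bigr => j _; rewrite tnth_mktuple.
have coord (x y : V) i : `|tnth x i - tnth y i| <= edist x y.
  by rewrite edE (_ : tnth x i - _ = tnth [tuple tnth x j - tnth y j | j < n] i) ?ler_tnth_enorm ?tnth_mktuple.
have Ybox k : box (Y k).
  move=> i; rewrite /= in_itv/= mxE.
  have [H _] := HX k; have := le_trans (coord (X k) x0 i) H.
  have : (k.+1%:R^-1 : R) <= 1 by rewrite invf_le1// ler1n.
  move: (k.+1%:R^-1) => z; rewrite ler_norml => z1 /andP[H1 H2].
  by apply/andP; split; lra.
have [|v [_ clv]] := cbox (Y @ \oo) (fmap_proper_filter _ _).
  by exists 0%N => // k _; exact: Ybox.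
pose x : V := [tuple v ord0 i | i < n].
have near_x (e : R) (K : nat) : 0 < e -> exists2 k, (K <= k)%N & edist (X k) x <= n%:R * e.
  move=> e0; have [||w [/= [k Kk <-] bw]] := clv (Y @` [set k | (K <= k)%N]) (ball v e).
  - by exists K => // k /= Kk; exists k.
  - exact: nbhsx_ballx.
  exists k => //.
  rewrite edE; apply: le_trans (enorm_le_sum _) _.
  apply: (@le_trans _ _ (\sum_(i < n) e)); last by rewrite sumr_const card_ord mulr_natl.
  apply: ler_sum => i _; rewrite !tnth_mktuple distrC.
  case: bw => _ bw.
  by have := bw ord0 i; rewrite mxE -ball_normE /= => /ltW.
have xR : edist x x0 <= rho.
  apply/ler_addgt0Pr => e e0.
  have [K HK] : exists K : nat, (K.+1%:R^-1 : R) <= e / 2.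
    exists (Num.truncn (2 / e)); rewrite -[leRHS]invrK invf_div lef_pV2 ?posrE ?divr_gt0//.
    exact/ltW/truncnS_gt.
  have [|k Kk xk] := near_x (e / 2 / n%:R) K; first by rewrite !divr_gt0.
  rewrite mulrC divfK ?gt_eqF// in xk.
  have tri := edist_triangle x (X k) x0; rewrite (edistC x (X k)) in tri.
  have [Xk _] := HX k.
  have kK : (k.+1%:R^-1 : R) <= K.+1%:R^-1 by rewrite lef_pV2 ?posrE// ler_nat.
  move: (k.+1%:R^-1) (K.+1%:R^-1) Xk kK HK => z z' *; lra.
have [e [e0 He]] := oO x (bO x xR).
have [|k _ xk] := near_x (e / 2 / n%:R) 0; first by rewrite !divr_gt0.
rewrite mulrC divfK ?gt_eqF// in xk.
have [_ nO] := HX k; apply: nO; apply: He; rewrite /eball /=; lra.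
Qed.

(** The ball contains a cube of side r/(2n). Consequently no negative number is an essential bound
    of |u|, and the essential supremum is nonnegative. *)
Lemma ball_not_null (x0 : V) (r : R) : 0 < r -> ~ null1 (eball x0 r).
Proof.
move=> r0 /null1_negligible[B [mB B0] HB].
pose c := r / (2 * n%:R).
have c0 : 0 < c by rewrite divr_gt0// mulr_gt0.
pose f (z : V) := \prod_(i < n) (ind (0 <= tnth z i) * ind (tnth z i <= c)) : R.
have mf : measurable_fun setT f by exact: measurable_cube.
have f0 z : 0 <= f z by apply: prodr_ge0 => i _; rewrite mulr_ge0 ?ind_ge0.
have f1 z : f z <= 1.
  by apply: prodr_ile1 => i _; rewrite mulr_ge0 ?ind_ge0//= mulr_ile1 ?ind_ge0 ?ind_le1.
have mi : measurable_fun setT (\1_B : V -> R) by exact: measurable_indic.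
have : (I1 f <= I1 (fun z => \1_B (tadd x0 z) : R))%E.
  apply: I1_le => //; first by mtac.
  move=> z; have [->//|fz] := eqVneq (f z) 0.
  rewrite indicE mem_set//=; apply: HB; rewrite /eball /= edist_taddl.
  apply: le_lt_trans (cube_norm (ltW c0) fz) _.
  have -> : n%:R * c = r / 2 by rewrite /c; field; rewrite gt_eqF.
  lra.
rewrite (I1_shiftl x0 mi)// I1_cube ?(ltW c0)// [I1 _](B0 : I1 (\1_B : V -> R) = 0%E).
by rewrite leNgt lte_fin exprn_gt0.
Qed.

Lemma ae_on_sub (A : set V) (P Q : V -> Prop) : (forall x, P x -> Q x) ->
  ae_on A P -> ae_on A Q.
Proof.
move=> PQ [B [mB H B0]]; exists B; split => // x [Ax nQ]; apply: H; split => //.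
by move=> /PQ.
Qed.

(** Strictness lets the infimum be used without showing that it is attained; the amplitude exceeds
    the essential supremum by at least 1. *)
Lemma esssup_bound (x0 : V) (r : R) (u : V -> R) : 0 < r ->
  (esssup_on (eball x0 r) u < +oo)%E ->
  0 <= fine (esssup_on (eball x0 r) u) /\
  forall A, fine (esssup_on (eball x0 r) u) < A -> ae_on (eball x0 r) (fun x => `|u x| <= A).
Proof.
move=> r0 Hfin; have H0 : (0 <= esssup_on (eball x0 r) u)%E.
  apply: le_ereal_inf_tmp => _ [M HM <-]; rewrite lee_fin leNgt; apply/negP => M0.
  apply: (ball_not_null r0); case: HM => B [mB H B0]; exists B; split => // x xr.
  apply: H; split; first exact: xr.
  by move=> uM; have := le_trans (normr_ge0 _) uM; lra.
split; first exact: fine_ge0.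
have fS : esssup_on (eball x0 r) u \is a fin_num by rewrite ge0_fin_numE.
move=> A; rewrite -lte_fin fineK// => /ereal_inf_lt[_ [M HM <-]].
rewrite lte_fin => /ltW MA; apply: ae_on_sub HM => x /le_trans; exact.
Qed.

Lemma tail_int_fin (a e : R) (x0 : V) (r : R) (u : V -> R) : 0 < a -> 0 < r ->
  measurable_fun setT u -> in_tail_space a e u ->
  (int_on (~` eball x0 r)
     (fun x => (powR `|u x| (e - 1) / powR (edist x x0) (n%:R + a))%:E) < +oo)%E.
Proof.
move=> a0 r0 mu [_ H].
have na : 0 < n%:R + a by rewrite addr_gt0.
(* Chosen so that 1 + |x| <= L |x - x0| whenever |x - x0| >= r. *)
pose L := 1 + (1 + enorm x0) / r.
have L0 : 0 < L by rewrite ltr_pwDl// divr_ge0 ?(ltW r0)// addr_ge0 ?enorm_ge0.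
pose f (x : V) := powR `|u x| (e - 1) * powR (1 + enorm x) (- (n%:R + a)).
have mf : measurable_fun setT f by rewrite /f; mtac.
have f0 x : 0 <= f x by rewrite mulr_ge0 ?powR_ge0.
have {}H : (I1 f < +oo)%E.
  by apply: le_lt_trans H; rewrite le_eqVlt; apply/orP; left; apply/eqP; apply: eq_leb_int => x;
    rewrite /f powRN.
have -> : int_on (~` eball x0 r) (fun x => (powR `|u x| (e - 1) / powR (edist x x0) (n%:R + a))%:E) =
    I1 (fun x => ind (r <= edist x x0) * (powR `|u x| (e - 1) * powR (edist x x0) (- (n%:R + a)))).
  by apply: eq_leb_int => y; rewrite indic_eballC powRN.
apply: (@le_lt_trans _ _ ((powR L (n%:R + a))%:E * I1 f)%E); last first.
  by rewrite lte_mul_pinfty ?lee_fin ?powR_ge0.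
rewrite -(I1Z mf f0) ?powR_ge0//; apply: I1_le.
- by mtac.
- by clearbody f; mtac.
- by move=> x; rewrite !mulr_ge0 ?ind_ge0 ?powR_ge0.
move=> x; rewrite /ind; case: ifP => [rx|_]; last by rewrite mul0r mulr_ge0 ?powR_ge0.
rewrite mul1r /f mulrCA ler_wpM2l ?powR_ge0//.
have x1 : 0 < 1 + enorm x by rewrite ltr_pwDl ?enorm_ge0.
have ex0 : 0 < edist x x0 by exact: lt_le_trans rx.
have -> : powR L (n%:R + a) * powR (1 + enorm x) (- (n%:R + a)) =
    powR (L^-1 * (1 + enorm x)) (- (n%:R + a)).
  rewrite powRM ?invr_ge0 ?(ltW L0) ?(ltW x1)//; congr (_ * _).
  by rewrite -(powR_inv1 (ltW L0)) -powRrM mulN1r opprK.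
apply: powR_ler_neg; rewrite ?(ltW na) ?mulr_gt0 ?invr_gt0//.
rewrite mulrC ler_pdivrMr//.
have -> : edist x x0 * L = edist x x0 + edist x x0 / r * (1 + enorm x0) by rewrite /L; field; rewrite gt_eqF.
have en0 (y : V) : enorm y = edist y [tuple 0 | _ < n].
  by congr Num.sqrt; apply: eq_bigr => i _; rewrite tnth_mktuple subr0.
have tri : enorm x <= edist x x0 + enorm x0 by rewrite !en0; exact: edist_triangle.
have : 1 * (1 + enorm x0) <= edist x x0 / r * (1 + enorm x0).
  by rewrite ler_wpM2r ?addr_ge0 ?enorm_ge0// ler_pdivlMr// mul1r.
lra.
Qed.

(** The first three terms normalize the supremum, the tail and the p-energy; the final 1 gives A >=
    1, hence A^(1-p) <= 1. *)
Definition amplitude (sp p : R) (x0 : V) (Rad : R) (u : V -> R) : R :=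
  fine (esssup_on (eball x0 Rad) u) + Tail (sp * p) p u x0 Rad +
  powR (fine (gag_q sp p (eball x0 Rad) u)) p^-1 + 1.

Lemma powR_inv_le (x A e : R) : 0 < e -> 0 <= x -> powR x e^-1 <= A -> x <= powR A e.
Proof.
move=> e0 x0 H; apply: (@le_trans _ _ (powR (powR x e^-1) e)).
  by rewrite -powRrM mulVf ?gt_eqF// powRr1.
by rewrite powR_le ?(ltW e0) ?powR_ge0.
Qed.

Lemma int_on_ge0 (A : set V) (f : V -> R) : (forall x, 0 <= f x) ->
  (0 <= int_on A (fun x => (f x)%:E))%E.
Proof. by move=> f0; apply: leb_int_ge0 => x; rewrite mule_ge0// lee_fin. Qed.

(** The amplitude is built with [fine], which would turn an infinite quantity into 0; each
    ingredient is therefore shown finite before it is bounded by A. *)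
Lemma amplitude_normalization (s1 sp p : R) (x0 : V) (Rad : R) (Om : set V) (u : V -> R) :
  2 <= p -> 0 < sp -> ball_cc x0 Rad Om -> weak_solution s1 sp p Om u ->
  in_Linfloc Om u -> let A := amplitude sp p x0 Rad u in
  [/\ 1 <= A, ae_on (eball x0 Rad) (fun x => `|u x| <= A) &
  exists u' Z', normalized_solution x0 Rad s1 sp p u' Z' /\
    exists2 B, negligible1 B & forall x, ~ B x -> u' x = u x / A].
Proof.
move=> p2 sp0 bc ws lb A; have [Rad0 RO] := bc.
have p0 : 0 < p by lra.
have e0 : 0 < p - 1 by lra.
have spp : 0 < sp * p by rewrite mulr_gt0.
have [S0 HS] := esssup_bound Rad0 (lb _ _ bc).
have T0 : 0 <= Tail (sp * p) p u x0 Rad by exact: powR_ge0.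
have [mu W1 Wp Wt _] := ws.
have P0 : 0 <= powR (fine (gag_q sp p (eball x0 Rad) u)) p^-1 by exact: powR_ge0.
have A1 : 1 <= A by rewrite /A /amplitude; lra.
have aeA : ae_on (eball x0 Rad) (fun x => `|u x| <= A) by apply: HS; rewrite /A /amplitude; lra.
split => //; apply: (normalization p2 Rad0 RO A1 ws aeA).
- have TA : Tail (sp * p) p u x0 Rad <= A by rewrite /A /amplitude; lra.
  have := tail_int_fin x0 spp Rad0 mu Wt.
  move: TA; rewrite /Tail.
  set K := int_on _ _ => TA Kfin.
  have K0 : (0 <= K)%E.
    by apply: int_on_ge0 => x; rewrite mulr_ge0 ?invr_ge0 ?powR_ge0.
  have fK : K \is a fin_num by rewrite ge0_fin_numE.
  rewrite -(fineK fK) lee_fin powRN -ler_pdivrMr ?invr_gt0 ?powR_gt0// invrK mulrC.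
  by apply: powR_inv_le => //; rewrite mulr_ge0 ?powR_ge0 ?fine_ge0.
- have [_ Gfin] := Wp _ _ bc.
  have G0 : (0 <= gag_q sp p (eball x0 Rad) u)%E.
    by rewrite gag_qE//; apply: I2_ge0 => x y; rewrite !mulr_ge0 ?inb_ge0 ?powR_ge0.
  have fG : gag_q sp p (eball x0 Rad) u \is a fin_num by rewrite ge0_fin_numE.
  rewrite -{1}(fineK fG) lee_fin; apply: powR_inv_le => //; first exact: fine_ge0.
  by rewrite /A /amplitude; lra.
Qed.

Lemma seminorm_bound (s1 sp p q gam Rm : R) : 0 < s1 < 1 -> 2 <= p ->
  0 < sp <= (p - 1) / p -> p <= q -> 0 < gam < sp * p / (p - 1) ->
  exists (N : nat) (C kap : R), [/\ 0 <= C, 0 <= kap & forall (Om : set V) u x0 Rad r d,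
    weak_solution s1 sp p Om u -> in_Linfloc Om u -> ball_cc x0 Rad Om ->
    0 < d <= 1 -> 0 < r -> r + N%:R * d <= Rad -> Rad <= Rm ->
    (gag_q gam q (eball x0 r) u <=
      (powR (amplitude sp p x0 Rad u) q * (C * powR d (- kap)))%:E)%E].
Proof.
move=> s1b p2 spb pq gb; have /andP[sp0 _] := spb.
have [N [C [kap [C0 kap0 H]]]] := normalized_regularity n0 Rm s1b p2 spb pq gb.
exists N, C, kap; split => // Om u x0 Rad r d ws lb bc d01 r0 rd RRm.
have [A1 _ [u' [Z' [NS [B B0 HB]]]]] := amplitude_normalization p2 sp0 bc ws lb.
have A0 : 0 < amplitude sp p x0 Rad u by apply: lt_le_trans A1.
have mu : measurable_fun setT u by case: ws.
have mu' : measurable_fun setT u' by case: NS => -[].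
rewrite (gag_q_scale _ _ _ _ A0 mu mu' B0 HB) EFinM lee_pmul2l ?lte_fin ?powR_gt0//.
exact: (H _ _ _ _ _ _ NS).
Qed.

Lemma ae_bounded_Lq (q A : R) (x0 : V) (r : R) (u : V -> R) : 0 <= q -> 0 <= r ->
  measurable_fun setT u -> ae_on (eball x0 r) (fun x => `|u x| <= A) ->
  (int_on (eball x0 r) (fun x => (powR `|u x| q)%:E) < +oo)%E.
Proof.
move=> q0 r0 mu /null1_negligible[B B0 HB].
have -> : int_on (eball x0 r) (fun x => (powR `|u x| q)%:E) =
    I1 (fun x => inb x0 r x * powR `|u x| q).
  by apply: eq_leb_int => x; rewrite indic_eball.
apply: (@le_lt_trans _ _ (I1 (fun x => powR A q * inb x0 r x))).
  apply: (I1_ae_le B0); rewrite /inb; try mtac.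
  - by move=> x; rewrite mulr_ge0 ?ind_ge0 ?powR_ge0.
  - by move=> x; rewrite mulr_ge0 ?ind_ge0 ?powR_ge0.
  move=> x nB; rewrite /ind; case: (boolP (edist x x0 < r)) => xr; last by rewrite mul0r mulr0.
  rewrite mul1r mulr1 powR_le//; apply: contrapT => nA; apply: nB; exact: HB.
rewrite I1Z ?powR_ge0//; [|exact: measurable_inb|by move=> x; exact: inb_ge0].
rewrite lte_mul_pinfty ?lee_fin ?powR_ge0//.
by apply: (@le_lt_trans _ _ ((2 * r) ^+ n)%:E); rewrite ?ltry//; exact: I1_ball.
Qed.

End Amplitude.

Theorem theorem1 (R : realType) (N : nat) (p q s1 sp gam : R) :
  (2 <= N)%N -> 0 < s1 < 1 -> 2 <= p -> 0 < sp <= (p - 1) / p ->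
  p <= q -> 0 < gam < sp * p / (p - 1) ->
  exists C kappa : R, 0 < C /\ 0 < kappa /\
  forall (Om : set (N.-tuple R)) (u : N.-tuple R -> R),
    bounded_domain Om -> weak_solution s1 sp p Om u -> in_Linfloc Om u ->
    in_Wloc gam q Om u /\
    forall (x0 : N.-tuple R) (Rad r : R),
      ball_cc x0 Rad Om -> Rad < 1 -> 0 < r < Rad ->
      let T := fine (esssup_on (eball x0 Rad) u) + Tail (sp * p) p u x0 Rad in
      (gag_q gam q (eball x0 r) u <=
        (C * powR (T + powR (fine (gag_q sp p (eball x0 Rad) u)) p^-1 + 1) q
           / powR (Rad - r) kappa)%:E)%E.
Proof.
move=> N2 s1b p2 spb pq gb.
have N0 : (0 < N)%N by exact: ltn_trans N2.
have /andP[sp0 _] := spb.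
have q0 : 0 <= q by lra.
(* Radii are at most 1 in the quantitative estimate, so its constants depend on the parameters
   only. *)
have [m [C [kap [C0 kap0 H]]]] := seminorm_bound N0 1 s1b p2 spb pq gb.
have m1 : 0 < m.+1%:R :> R by [].
have mC0 : 0 <= C * powR m.+1%:R kap by rewrite mulr_ge0 ?powR_ge0.
(* The added ones make both constants positive; raising the exponent is harmless because Rad - r <
   1. *)
exists (C * powR m.+1%:R kap + 1), (kap + 1).
split; [by lra|split; first by lra].
move=> Om u [_ oO _ _] ws lb; split.
  move=> x0 rho [rho0 bO]; have mu : measurable_fun setT u by case: ws.
  split.
    have [_ aeA _] := amplitude_normalization N0 p2 sp0 (conj rho0 bO) ws lb.
    exact: (ae_bounded_Lq q0 (ltW rho0) mu aeA).
  (* Membership concerns the whole ball, which leaves no gap between radii; a larger ball inside the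
     domain provides one. Its radius may exceed 1 and enters the constants, but only finiteness is
     claimed here. *)
  have [rho' rr bO'] := ecball_enlarge N0 oO bO.
  have [m' [C' [kap' [_ _ H']]]] := seminorm_bound N0 rho' s1b p2 spb pq gb.
  have m'1 : 0 < m'.+1%:R :> R by [].
  pose d := Num.min 1 ((rho' - rho) / m'.+1%:R).
  have d0 : 0 < d by rewrite lt_min ltr01 divr_gt0 ?subr_gt0.
  apply: le_lt_trans (H' Om u x0 rho' rho d ws lb _ _ rho0 _ (lexx _)) (ltry _).
  - by split => //; exact: lt_trans rr.
  - by rewrite d0 ge_min lexx.
  - rewrite addrC -lerBrDr.
    apply: (@le_trans _ _ (m'.+1%:R * d)); first by rewrite ler_pM2r// ler_nat.
    by rewrite mulrC -ler_pdivlMr// ge_min lexx orbT.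
move=> x0 Rad r bc R1 /andP[r0 rR]; cbv zeta.
set T := (_ + Tail _ _ _ _ _).
have D0 : 0 < Rad - r by rewrite subr_gt0.
(* Room for m widths d between the two radii; the successor avoids division by 0. *)
pose d := (Rad - r) / m.+1%:R.
have d0 : 0 < d by rewrite divr_gt0.
have mge1 : 1 <= m.+1%:R :> R by rewrite ler1n.
have dD : d <= Rad - r by rewrite ler_pdivrMr// ler_peMr// ltW.
apply: le_trans (H Om u x0 Rad r d ws lb bc _ r0 _ (ltW R1)) _.
- by rewrite d0; lra.
- rewrite addrC -lerBrDr; apply: (@le_trans _ _ (m.+1%:R * d)); first by rewrite ler_pM2r// ler_nat.
  by rewrite mulrC divfK// gt_eqF.
rewrite lee_fin -[amplitude _ _ _ _ _]/(T + _ + 1).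
set A := powR (T + _ + 1) q; have A0 : 0 <= A by exact: powR_ge0.
rewrite -powRN (mulrC _ A) -(mulrA A) ler_wpM2l//.
have E : powR d (- kap) = powR m.+1%:R kap * powR (Rad - r) (- kap).
  rewrite /d powRM ?invr_ge0 ?(ltW D0) ?(ltW m1)// mulrC; congr (_ * _).
  by rewrite -(powR_inv1 (ltW m1)) -powRrM mulN1r opprK.
rewrite E mulrA; apply: (@le_trans _ _ (C * powR m.+1%:R kap * powR (Rad - r) (- (kap + 1)))).
  by rewrite ler_wpM2l// le_powR_d; [|rewrite D0; lra|lra].
by rewrite ler_wpM2r ?powR_ge0// lerDl.
Qed.
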